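(* Let $z_0\in\mathcal H$ and $\ell\in\mathcal U(z_0;D(A))$. Then there exists a unique solution $z\in H^1(0,T;\mathcal H)$ of $\dot z\in A(R\ell-Qz)$, $z(0)=z_0$. Moreover there is a constant $C>0$, independent of $z_0$ and $\ell$, such that $$\|z\|_{C([0,T];\mathcal H)}\le C\big(1+\|z_0\|_{\mathcal H}+\|\ell\|_{C([0,T];\mathcal X)}+\|\dot\ell\|_{L^1(0,T;\mathcal X)}\big),$$ $$\|\dot z\|_{L^2(0,T;\mathcal H)}\le C\Big(\|\dot\ell\|_{L^2(0,T;\mathcal X)}+\sup_{\tau\in[0,T]}\|A^0(R\ell(\tau)-Qz(\tau))\|_{\mathcal H}\Big).$$
   Context: Fix $T>0$. $\mathcal X,\mathcal X_c,\mathcal Y,\mathcal Z,\mathcal W$ are real Banach spaces, $\mathcal X_c$ is reflexive and compactly embedded in $\mathcal X$, and $\mathcal H$ is a real separable Hilbert space with continuous embeddings $\mathcal Y\hookrightarrow\mathcal Z\hookrightarrow\mathcal H\hookrightarrow\mathcal W$. $H^1(0,T;\mathcal V)$, $L^p(0,T;\mathcal V)$, $C([0,T];\mathcal V)$ denote Bochner(–Sobolev) spaces and $\dot z$ the time derivative. $A:\mathcal H\to2^{\mathcal H}$ is maximal monotone with closed domain $D(A)$, and its minimal section $A^0:D(A)\to\mathcal H$, $A^0(h)=\operatorname{argmin}_{v\in A(h)}\|v\|_{\mathcal H}$, is bounded on bounded sets. For $\lambda>0$, $R_\lambda=(I+\lambda A)^{-1}$ is the resolvent and $A_\lambda=\lambda^{-1}(I-R_\lambda)$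 the Yosida approximation. $R\in L(\mathcal X;\mathcal Y)$ (hence $R\in L(\mathcal X;\mathcal H)$) and $Q\in L(\mathcal W)$ whose restrictions to $\mathcal H,\mathcal Z,\mathcal Y$ map these spaces boundedly into themselves (denoted again $Q$); as an operator on $\mathcal H$, $Q$ is self-adjoint and coercive with constant $\gamma_Q>0$, i.e. $(Qh,h)_{\mathcal H}\ge\gamma_Q\|h\|_{\mathcal H}^2$. Given $z_0\in\mathcal H$ and $\ell\in H^1(0,T;\mathcal X)$, a solution of the state equation $\dot z\in A(R\ell-Qz)$, $z(0)=z_0$, is $z\in H^1(0,T;\mathcal H)$ with $z(0)=z_0$ and $\dot z(t)\in A(R\ell(t)-Qz(t))$ for a.e. $t\in(0,T)$. For $M\subset D(A)$, $\mathcal U(z_0;M)=\{\ell\in H^1(0,T;\mathcal X):R\ell(0)-Qz_0\in M\}$. *)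

(* Defs.v *)
From mathcomp Require Import all_boot all_order all_algebra all_classical all_reals all_analysis.
Import Order.TTheory GRing.Theory Num.Theory numFieldNormedType.Exports.
Set Implicit Arguments. Unset Strict Implicit. Unset Printing Implicit Defensive.
Local Open Scope classical_set_scope.
Local Open Scope ring_scope.

Section Defs.
Variable R : realType.
Local Notation mu := (@lebesgue_measure R).

Definition simple_fun (V : normedModType R) (s : R -> V) : Prop :=
  finite_set (range s) /\ forall v : V, measurable (s @^-1` [set v]).

Definition simple_integral (V : normedModType R) (D : set R) (s : R -> V) : V :=
  \sum_(v \in range s) (fine (mu (D `&` s @^-1` [set v]))) *: v.

(** Bochner integral (Dunford--Schwartz definition): f is the a.e. limit on D
    of simple functions s_n which are Cauchy in L^1(D), and I is the limit of
    their integrals. *)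
Definition bochner_approx (V : normedModType R) (D : set R) (f : R -> V)
    (s : nat -> R -> V) : Prop :=
  [/\ forall n, simple_fun (s n),
      {ae mu, forall x, D x -> (fun n => s n x) @ \oo --> f x} &
      forall e : R, 0 < e -> exists N : nat, forall n m : nat, (N <= n)%N -> (N <= m)%N ->
        (\int[mu]_(x in D) (`|s n x - s m x|)%:E <= e%:E)%E].

Definition is_bochner_integral (V : normedModType R) (D : set R) (f : R -> V) (I : V)
  : Prop :=
  exists s : nat -> R -> V, bochner_approx D f s /\
    (fun n => simple_integral D (s n)) @ \oo --> I.

(** z : [0,T] -> V belongs to H^1(0,T;V) with (Bochner weak) derivative g:
    g in L^2(0,T;V) and z(t) = z(0) + \int_0^t g for all t in [0,T]. *)
Definition H1_deriv (V : normedModType R) (T : R) (z g : R -> V) : Prop :=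
  (forall t : R, 0 <= t <= T -> is_bochner_integral `[0%R, t] g (z t - z 0%R)) /\
  (\int[mu]_(x in `[0%R, T]) ((`|g x| ^+ 2)%:E) < +oo)%E.

Definition L1norm (V : normedModType R) (T : R) (g : R -> V) : R :=
  fine (\int[mu]_(x in `[0%R, T]) (`|g x|)%:E).

Definition L2norm (V : normedModType R) (T : R) (g : R -> V) : R :=
  Num.sqrt (fine (\int[mu]_(x in `[0%R, T]) ((`|g x| ^+ 2)%:E))).

Definition Cnorm (V : normedModType R) (T : R) (f : R -> V) : R :=
  sup [set `|f t| | t in `[0%R, T]].

Definition is_inner_product (H : normedModType R) (ip : H -> H -> R) : Prop :=
  [/\ forall x y, ip x y = ip y x,
      forall a x y z, ip (a *: x + y) z = a * ip x z + ip y z &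
      forall x, ip x x = `|x| ^+ 2].

Definition separable (H : normedModType R) : Prop :=
  exists S : set H, countable S /\ closure S = setT.

Definition bounded_linear (U V : normedModType R) (f : U -> V) : Prop :=
  linear f /\ continuous f.

Definition cont_embedding (U V : normedModType R) (e : U -> V) : Prop :=
  bounded_linear e /\ injective e.

Definition compact_embedding (U V : normedModType R) (e : U -> V) : Prop :=
  cont_embedding e /\ compact (closure (e @` [set u | `|u| <= 1])).

Definition dom (H : normedModType R) (A : H -> set H) : set H :=
  [set h | A h !=set0].

Definition monotone_op (H : normedModType R) (ip : H -> H -> R) (A : H -> set H)
  : Prop :=
  forall x y u v, A x u -> A y v -> 0 <= ip (u - v) (x - y).

Definition maximal_monotone (H : normedModType R) (ip : H -> H -> R) (A : H -> set H)
  : Prop :=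
  monotone_op ip A /\
  forall x u, (forall y v, A y v -> 0 <= ip (u - v) (x - y)) -> A x u.

(** minimal section A^0(h) = argmin_{v in A h} |v| (well defined for
    maximal monotone A on D(A); default 0 elsewhere). *)
Definition min_section (H : normedModType R) (A : H -> set H) (h : H) : H :=
  xget 0 [set v | A h v /\ forall w, A h w -> `|v| <= `|w|].

Definition bounded_on_bounded (H : normedModType R) (A : H -> set H)
    (F : H -> H) : Prop :=
  forall M : R, exists K : R, forall h, dom A h -> `|h| <= M -> `|F h| <= K.

End Defs.

(* Main.v *)
(** Put [y = f - Q z] with [f = R l]; then [y' + Q A y] contains [f'], and [Q A]
    is maximal monotone for the inner product [(Q^-1 x, y)].  Its resolvents
    exist by Minty's theorem, obtained by minimising the Fitzpatrick function of
    the operator plus half the squared norms.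

    The implicit Euler scheme keeps [y_i] in [D(A)] and satisfies, for every
    [w] in [A a] and with the norm [p] attached to [Q^-1],
      [p (y_j - a) <= p (y_i - a) + int p (f') + (t_j - t_i) p (Q w)].
    With a fixed [a] this bounds [y]; with [a = y_i] and [w = A^0 y_i], which is
    bounded by hypothesis, it bounds the discrete velocities in [L^2].  Since [f]
    is 1/2-Hoelder, monotonicity and the energy [(Q z, z)] make the schemes Cauchy
    uniformly in time.  Almost minimisers of the [L^2] norm among tail convex
    combinations of the velocities (Mazur) converge almost everywhere, and
    maximality identifies their limit [g] as an element of [A (y)].

    The displayed inequality survives in the limit: with a fixed [a] it gives the
    first estimate; with [a = y(s)], which lies in the closed set [D(A)], it
    bounds the increments of [z], hence, at Lebesgue points tested against a
    countable dense set, [|z'|] by [|f'| + sup |A^0 y|].  Uniqueness is the energy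
    inequality for the difference of two solutions. *)

Require Import Defs.
From HB Require Import structures.
From mathcomp Require Import all_boot all_order all_algebra all_classical all_reals all_analysis.
From mathcomp Require Import measurable_realfun ring lra.
Import Order.TTheory GRing.Theory Num.Theory numFieldNormedType.Exports.
Local Open Scope classical_set_scope.
Local Open Scope ring_scope.

Set Implicit Arguments.
Unset Strict Implicit.
Unset Printing Implicit Defensive.

(** * Symmetric bilinear forms and almost minimisers *)

(** The forcing [f'] is only square integrable in time, so differences of consecutive velocities
    cannot be controlled as for smoother data. This is why the comparison is restarted at the
    current point, where the minimal section is known to be bounded. No weak compactness is used:
    [almost_minimisers] yields strong limits three times, for Minty's theorem, for the minimal
    section and for the velocities. The derivative in [H1_deriv] is a mere function, fixed only up
    to null sets and possibly not measurable. It is replaced at once by a strongly measurable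
    version, and later work uses real integrals of [ip (g x) w], with a dominating function
    controlling the norm of [g]. The constant of the theorem precedes the data. The constants of the
    scheme may depend on [z0] and [l], since they serve convergence only; the final ones are read
    off the limit inequality, which involves [T], operator bounds and one fixed pair of the
    graph. *)

Definition sym_bilinear (R : realType) (V : lmodType R) (b : V -> V -> R) :=
  (forall x y, b x y = b y x) /\
  (forall a x y z, b (a *: x + y) z = a * b x z + b y z).

Section SymBilinear.
Context (R : realType) (V : lmodType R) (b : V -> V -> R).
Hypothesis hb : sym_bilinear b.

Lemma bilinC x y : b x y = b y x. Proof. exact: hb.1. Qed.

Lemma bilinDl x y z : b (x + y) z = b x z + b y z.
Proof. by rewrite -[x in LHS]scale1r hb.2 mul1r. Qed.

Lemma bilin0l z : b 0 z = 0.
Proof. by have := bilinDl 0 0 z; rewrite addr0; lra. Qed.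

Lemma bilinZl a x z : b (a *: x) z = a * b x z.
Proof. by rewrite -[a *: x]addr0 hb.2 bilin0l addr0. Qed.

Lemma bilinNl x z : b (- x) z = - b x z.
Proof. by rewrite -scaleN1r bilinZl mulN1r. Qed.

Lemma bilinDr x y z : b z (x + y) = b z x + b z y.
Proof. by rewrite bilinC bilinDl !(bilinC z). Qed.

Lemma bilin0r z : b z 0 = 0. Proof. by rewrite bilinC bilin0l. Qed.

Lemma bilinZr a x z : b z (a *: x) = a * b z x.
Proof. by rewrite bilinC bilinZl (bilinC z). Qed.

Lemma bilinNr x z : b z (- x) = - b z x.
Proof. by rewrite bilinC bilinNl (bilinC z). Qed.

Definition bilinE :=
  (bilinDl, bilinDr, bilinNl, bilinNr, bilinZl, bilinZr, bilin0l, bilin0r).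

Hypothesis hpos : forall x, 0 <= b x x.

Lemma bilin_CS x y : b x y ^+ 2 <= b x x * b y y.
Proof.
have h t : 0 <= b x x + 2 * t * b x y + t ^+ 2 * b y y.
  have := hpos (x + t *: y); rewrite !bilinE (bilinC y x) => h.
  apply: le_trans h _; rewrite le_eqVlt; apply/orP; left; apply/eqP; ring.
(* If [b y y = 0] the quadratic in [t] is affine; unless [b x y = 0], the chosen [t] gives it the
   value -1. *)
have [/eqP b0|bn0] := boolP (b y y == 0).
  have [/eqP ->|xy0] := boolP (b x y == 0); first by rewrite b0; lra.
  have := h (- (b x x + 1) / (2 * b x y)); rewrite b0.
  have -> : 2 * (- (b x x + 1) / (2 * b x y)) * b x y = - (b x x + 1) by field.
  lra.
have bp : 0 < b y y by rewrite lt_def bn0 hpos.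
have := h (- b x y / b y y).
have -> : b x x + 2 * (- b x y / b y y) * b x y + (- b x y / b y y) ^+ 2 * b y y
  = (b x x * b y y - b x y ^+ 2) / b y y by field.
by rewrite pmulr_lge0 ?invr_gt0 // subr_ge0.
Qed.

Definition bnorm x := Num.sqrt (b x x).

Lemma bnorm_ge0 x : 0 <= bnorm x. Proof. exact: sqrtr_ge0. Qed.

Lemma sqr_bnorm x : bnorm x ^+ 2 = b x x.
Proof. by rewrite sqr_sqrtr. Qed.

Lemma bilin_le_bnorm x y : b x y <= bnorm x * bnorm y.
Proof.
apply: le_trans (ler_norm _) _.
rewrite -(@ler_pXn2r _ 2) ?nnegrE ?mulr_ge0 ?bnorm_ge0 //.
by rewrite exprMn !sqr_bnorm real_normK ?num_real// bilin_CS.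
Qed.

Lemma bnormD x y : bnorm (x + y) <= bnorm x + bnorm y.
Proof.
rewrite -(@ler_pXn2r _ 2) ?nnegrE ?addr_ge0 ?bnorm_ge0 //.
rewrite sqr_bnorm !bilinE sqrrD !sqr_bnorm (bilinC y).
by have := bilin_le_bnorm x y; lra.
Qed.

Lemma bnormN x : bnorm (- x) = bnorm x.
Proof. by rewrite /bnorm !bilinE opprK. Qed.

Lemma bnormZ a x : 0 <= a -> bnorm (a *: x) = a * bnorm x.
Proof.
move=> a0; rewrite /bnorm !bilinE mulrA -expr2 sqrtrM ?sqr_ge0//.
by rewrite sqrtr_sqr ger0_norm.
Qed.

Lemma bilin_mid x y : b (2^-1 *: (x + y)) (2^-1 *: (x + y)) =
  (b x x + b y y) / 2 - b (x - y) (x - y) / 4.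
Proof. by rewrite !bilinE (bilinC y); field. Qed.

End SymBilinear.

(* [g] is almost minimising for [q] along the sets [S n]; the last clause is
   the convexity gap, which controls distances when [q] is strongly convex. *)
Lemma almost_minimisers (R : realType) (E : Type) (mid : E -> E -> E) (q : E -> R)
    (S : nat -> set E) (K : R) :
  (forall n, exists2 x, S n x & q x <= K) ->
  (forall n m, (n <= m)%N -> S m `<=` S n) ->
  (forall n x y, S n x -> S n y -> S n (mid x y)) ->
  (forall x, S 0%N x -> 0 <= q x) ->
  exists g : nat -> E, [/\ forall n, S n (g n),
    (forall n x, S n x -> q (g n) <= q x + n.+1%:R^-1) &
    forall e : R, 0 < e -> exists N, forall n m, (N <= n)%N -> (N <= m)%N ->
      (q (g n) + q (g m)) / 2 - q (mid (g n) (g m)) <= e].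
Proof.
move=> Sne Sdec Smid qpos.
pose d n := inf (q @` S n).
have lbS n : has_lbound (q @` S n).
  by exists 0 => _ [x Sx <-]; apply: qpos; apply: Sdec Sx.
have neS n : (q @` S n) !=set0.
  by have [x Sx _] := Sne n; exists (q x), x.
have infS n : has_inf (q @` S n) by split.
have dle n x : S n x -> d n <= q x.
  by move=> Sx; apply: ge_inf => //; exists x.
have /choice[g gP] : forall n, exists x, S n x /\ q x <= d n + n.+1%:R^-1.
  move=> n.
  have e0 : (0 : R) < n.+1%:R^-1 by rewrite invr_gt0.
  have [_ [x Sx <-] h] := inf_adherent e0 (infS n).
  by exists x; split=> //; exact: ltW.
have d_homo n m : (n <= m)%N -> d n <= d m.
  move=> nm; apply: lb_le_inf => // _ [x Sx <-].
  by apply: dle; apply: Sdec Sx.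
have dK n : d n <= K.
  by have [x Sx qx] := Sne n; apply: le_trans qx; exact: dle.
exists g; split; [by move=> n; case: (gP n)| |].
  by move=> n x Sx; apply: le_trans (gP n).2 _; rewrite lerD2r dle.
move=> e e0.
(* The infima increase and stay below [K], hence converge to [D]. Past [N1] a midpoint still lies in
   [S (maxn N1 N2)], so it costs more than [D - e / 4]. *)
pose D := sup (range d).
have supd : has_sup (range d).
  by split; [exists (d 0%N), 0%N | exists K => _ [n _ <-]].
have e4 : 0 < e / 4 by lra.
have [_ [N1 _ <-] hN1] := sup_adherent e4 supd.
have dD n : d n <= D by apply: ub_le_sup; [exact: supd.2 | exists n].
have [N2 hN2] : exists N2 : nat, N2.+1%:R^-1 < e / 4.
  have [N _ hN] := near_infty_natSinv_lt (PosNum e4).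
  by exists N; exact: (hN N (leqnn _)).
exists (maxn N1 N2) => n m hn hm.
have inv_le k : (maxn N1 N2 <= k)%N -> (k.+1%:R^-1 : R) <= N2.+1%:R^-1.
  move=> hk; rewrite lef_pV2 ?posrE// ler_nat ltnS.
  by apply: leq_trans hk; exact: leq_maxr.
have midle : d (maxn N1 N2) <= q (mid (g n) (g m)).
  apply: dle; apply: Smid.
    by apply: (Sdec _ n hn); case: (gP n).
  by apply: (Sdec _ m hm); case: (gP m).
have := d_homo _ _ (leq_maxl N1 N2).
have := (gP n).2; have := (gP m).2; have := inv_le n hn; have := inv_le m hm.
have := dD n; have := dD m => {dD}.
move: hN1; rewrite -/D; move: midle hN2 => {supd}.
move: (d n) (d m) (d N1) (d _) (D) (q _) (q _) (q _) => a1 a2 a3 a4 a5 a6 a7 a8.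
move: (n.+1%:R^-1) (m.+1%:R^-1) (N2.+1%:R^-1) => i1 i2 i3.
lra.
Qed.

(** * Limits of sequences *)

Section Limits.
Context (R : realType) (V : normedModType R).

Lemma cvgn_distP (u : nat -> V) (l : V) : u @ \oo --> l <->
  forall e : R, 0 < e -> exists N, forall n, (N <= n)%N -> `|u n - l| <= e.
Proof.
split=> [/cvgrPdist_le h e e0|h].
  by have [N _ hN] := h e e0; exists N => n Nn; rewrite distrC; exact: hN.
apply/cvgrPdist_le => e e0; have [N hN] := h e e0; exists N => // n /= Nn.
by rewrite distrC; exact: hN.
Qed.

Lemma cvgn_dist_le (u : nat -> V) (l : V) (d : nat -> R) :
  (forall n, `|u n - l| <= d n) -> d @ \oo --> (0 : R) -> u @ \oo --> l.
Proof.
move=> h /cvgrPdist_le hd; apply/cvgn_distP => e e0.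
have [N _ hN] := hd e e0; exists N => n Nn; apply: le_trans (h n) _.
by have := hN n Nn; rewrite sub0r normrN; apply: le_trans; exact: ler_norm.
Qed.

Lemma cvgn_dist0 (u : nat -> V) (l : V) :
  u @ \oo --> l -> (fun n => `|u n - l|) @ \oo --> (0 : R).
Proof.
move=> ul; rewrite -(@normr0 _ V) -(subrr l).
by apply: cvg_norm; apply: cvgB => //; exact: cvg_cst.
Qed.

End Limits.

Lemma cauchy_cvgn (R : realType) (V : completeNormedModType R) (u : nat -> V) :
  (forall e : R, 0 < e -> exists N, forall n m, (N <= n)%N -> (N <= m)%N ->
     `|u n - u m| <= e) -> exists l : V, u @ \oo --> l.
Proof.
move=> h; suff /cvg_ex : cvgn u by [].
apply: cauchy_cvg; apply: cauchy_exP => e e0.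
have e2 : 0 < e / 2 by lra.
have [N hN] := h _ e2.
exists (u N); exists N => // n /= Nn.
rewrite -ball_normE /=; apply: le_lt_trans (hN N n _ _) _ => //; lra.
Qed.

Lemma cvgn_harmonic (R : realType) : (fun n => n.+1%:R^-1 : R) @ \oo --> (0 : R).
Proof. exact: cvg_harmonic. Qed.

Lemma cvgn_le (R : realType) (u v : nat -> R) (a c : R) :
  u @ \oo --> a -> v @ \oo --> c -> (forall n, u n <= v n) -> a <= c.
Proof. by move=> ua vc h; apply: ler_cvg_to ua vc _; exists 0%N => // n _. Qed.

(** Letting [s] tend to 0 through [1 / (n + 1)]; first-order conditions are read off in this way. *)
Lemma ge0_of_perturb (R : realType) (a k : R) :
  (forall s, 0 < s -> s <= 1 -> 0 <= a + s * k) -> 0 <= a.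
Proof.
move=> h; apply: (@cvgn_le _ (fun=> 0) (fun n => a + n.+1%:R^-1 * k)).
- exact: cvg_cst.
- rewrite -[X in _ --> X]addr0 -[X in _ --> _ + X](mul0r k).
  apply: cvgD; first exact: cvg_cst.
  by apply: cvgM; [exact: cvgn_harmonic | exact: cvg_cst].
- by move=> n; apply: h; rewrite ?invr_gt0 // invf_le1 // ler1n.
Qed.

(** * Bilinear forms equivalent to the squared norm *)

Section EquivalentForm.
Context (R : realType) (H : completeNormedModType R) (b : H -> H -> R).
Hypothesis hb : sym_bilinear b.
Variables (c C : R).
Hypothesis c0 : 0 < c.
Hypothesis bc : forall x, c * `|x| ^+ 2 <= b x x.
Hypothesis bC : forall x, b x x <= C * `|x| ^+ 2.

Lemma form_ge0 x : 0 <= b x x.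
Proof. by apply: le_trans (bc x); rewrite mulr_ge0 ?sqr_ge0 ?ltW. Qed.

Lemma form_bound x y : `|b x y| <= `|C| * `|x| * `|y|.
Proof.
have hC z : b z z <= `|C| * `|z| ^+ 2.
  by apply: le_trans (bC z) _; rewrite ler_wpM2r ?sqr_ge0 ?ler_norm.
rewrite -(@ler_pXn2r _ 2) ?nnegrE ?mulr_ge0 ?normr_ge0 //.
rewrite real_normK ?num_real//.
apply: le_trans (bilin_CS hb form_ge0 x y) _.
have -> : (`|C| * `|x| * `|y|) ^+ 2 = (`|C| * `|x| ^+ 2) * (`|C| * `|y| ^+ 2).
  by ring.
by apply: ler_pM; rewrite ?form_ge0 ?hC.
Qed.

Lemma form_cvg (u v : nat -> H) x y : u @ \oo --> x -> v @ \oo --> y ->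
  (fun n => b (u n) (v n)) @ \oo --> b x y.
Proof.
move=> ux vy.
apply: (@cvgn_dist_le _ _ _ _
  (fun n => `|C| * `|u n - x| * `|v n| + `|C| * `|x| * `|v n - y|)).
  move=> n.
  have -> : b (u n) (v n) - b x y = b (u n - x) (v n) + b x (v n - y).
    by rewrite !(bilinE hb); ring.
  by apply: le_trans (ler_normD _ _) _; apply: lerD; exact: form_bound.
have -> : (0 : R) = `|C| * 0 * `|y| + `|C| * `|x| * 0 by ring.
apply: cvgD.
  apply: cvgM; last exact: cvg_norm.
  by apply: cvgM; [exact: cvg_cst | exact: cvgn_dist0].
by apply: cvgM; [exact: cvg_cst | exact: cvgn_dist0].
Qed.

Lemma form_sep x : (forall w, b x w = 0) -> x = 0.
Proof.
move=> h; apply/eqP; rewrite -normr_eq0 -sqrf_eq0.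
have := bc x; rewrite h => hx; rewrite eq_le sqr_ge0 andbT.
by rewrite -(pmulr_rle0 _ c0).
Qed.

End EquivalentForm.

(** * Minty's theorem *)

Section Minty.
Context (R : realType) (H : completeNormedModType R) (b : H -> H -> R).
Hypothesis hb : sym_bilinear b.
Variables (c C : R).
Hypothesis c0 : 0 < c.
Hypothesis bc : forall x, c * `|x| ^+ 2 <= b x x.
Hypothesis bC : forall x, b x x <= C * `|x| ^+ 2.
Variable A : H -> set H.
Hypothesis hA : maximal_monotone b A.

(* Epigraph of the Fitzpatrick function of [A]. *)
Let epi (e : H * H * R) :=
  forall y v, A y v -> b e.1.1 v + b y e.1.2 - b y v <= e.2.

Let cost (e : H * H * R) := e.2 + b e.1.1 e.1.1 / 2 + b e.1.2 e.1.2 / 2.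

Let comb (s : R) (e f : H * H * R) : H * H * R :=
  (e.1.1 + s *: (f.1.1 - e.1.1), e.1.2 + s *: (f.1.2 - e.1.2),
   e.2 + s * (f.2 - e.2)).

Let epi_comb s e f : 0 <= s -> s <= 1 -> epi e -> epi f -> epi (comb s e f).
Proof.
move=> s0 s1 he hf y v Ayv; rewrite /comb /= !(bilinE hb).
have := he y v Ayv; have := hf y v Ayv.
set p := b e.1.1 v; set q := b y e.1.2; set p' := b f.1.1 v; set q' := b y f.1.2.
move=> h1 h2; rewrite -subr_ge0.
have -> : e.2 + s * (f.2 - e.2) - (p + s * (p' - p) + (q + s * (q' - q)) - b y v)
  = (1 - s) * (e.2 - (p + q - b y v)) + s * (f.2 - (p' + q' - b y v)) by ring.
by apply: addr_ge0; apply: mulr_ge0; lra.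
Qed.

Let epi_mid e f : epi e -> epi f -> epi (comb 2^-1 e f).
Proof. by apply: epi_comb; lra. Qed.

(** An empty graph is not maximal, since [(0, 0)] is vacuously related to it. *)
Let monotone_graph_nonempty : exists y v, A y v.
Proof.
apply: contrapT => h; apply: (h); exists 0, 0; apply: hA.2 => y v Ayv.
by exfalso; apply: h; exists y, v.
Qed.

Let epi_graph y v : A y v -> epi (y, v, b y v).
Proof.
move=> Ayv y' v' A'; rewrite /= -subr_ge0.
have := hA.1 _ _ _ _ Ayv A'; rewrite !(bilinE hb) (bilinC hb v y) (bilinC hb v' y).
rewrite (bilinC hb v y') (bilinC hb v' y'); lra.
Qed.

(** The Fitzpatrick function dominates the pairing. On the graph, test with the point itself; off
    it, maximality supplies a graph point that violates monotonicity. *)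
Let epi_ge e : epi e -> b e.1.1 e.1.2 <= e.2.
Proof.
move=> he; have [Ae|nA] := pselect (A e.1.1 e.1.2).
  by have := he _ _ Ae; rewrite (bilinC hb e.1.1); lra.
have : ~ (forall y v, A y v -> 0 <= b (e.1.2 - v) (e.1.1 - y)).
  by move=> h; apply: nA; exact: hA.2.
move=> /existsNP[y /existsNP[v /not_implyP[Ayv /negP]]]; rewrite -ltNge => h.
have := he y v Ayv; move: h; rewrite !(bilinE hb) (bilinC hb e.1.2 e.1.1).
rewrite (bilinC hb e.1.2 y) (bilinC hb v) (bilinC hb v y).
lra.
Qed.

Let b_ge0 x : 0 <= b x x. Proof. exact: (form_ge0 c0 bc). Qed.

Let cost_ge0 e : epi e -> 0 <= cost e.
Proof.
move=> he; apply: le_trans (_ : b (e.1.1 + e.1.2) (e.1.1 + e.1.2) / 2 <= _).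
  by rewrite divr_ge0.
rewrite /cost !(bilinE hb) (bilinC hb e.1.2 e.1.1).
have := epi_ge he; lra.
Qed.

(** The component [e.2] enters linearly and cancels; the rest is the parallelogram identity. Hence
    almost minimisers are Cauchy in their first two components. *)
Let cost_gap e f : (cost e + cost f) / 2 - cost (comb 2^-1 e f) =
  (b (e.1.1 - f.1.1) (e.1.1 - f.1.1) + b (e.1.2 - f.1.2) (e.1.2 - f.1.2)) / 8.
Proof.
rewrite /cost /comb /= !(bilinE hb).
rewrite (bilinC hb f.1.1 e.1.1) (bilinC hb f.1.2 e.1.2); by field.
Qed.

Let cost_minimiser : exists2 e0, epi e0 & forall e, epi e -> cost e0 <= cost e.
Proof.
have [y [v Ayv]] := monotone_graph_nonempty.
have [] := @almost_minimisers R _ (comb 2^-1) cost (fun=> epi) (cost (y, v, b y v)).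
- by move=> _; exists (y, v, b y v) => //; exact: epi_graph.
- by move=> *.
- by move=> _; exact: epi_mid.
- exact: cost_ge0.
move=> g [gepi gmin gap].
have dist e f (d : R) : 0 < d -> b (e - f) (e - f) <= c * d ^+ 2 -> `|e - f| <= d.
  move=> d0 h; rewrite -(@ler_pXn2r _ 2) ?nnegrE ?(ltW d0)// -(ler_pM2l c0).
  exact: le_trans (bc _) h.
have Cx d : 0 < d -> exists N, forall n m, (N <= n)%N -> (N <= m)%N ->
    `|(g n).1.1 - (g m).1.1| <= d /\ `|(g n).1.2 - (g m).1.2| <= d.
  move=> d0; have cd : 0 < c * d ^+ 2 / 8 by rewrite divr_gt0 ?mulr_gt0 ?exprn_gt0.
  have [N hN] := gap _ cd; exists N => n m Nn Nm.
  have := hN n m Nn Nm; rewrite cost_gap ler_pM2r ?invr_gt0// => h.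
  by split; apply: dist => //; apply: le_trans h; rewrite ?lerDl ?lerDr b_ge0.
have [x0 hx0] : exists x : H, (fun n => (g n).1.1) @ \oo --> x.
  by apply: cauchy_cvgn => d /Cx[N hN]; exists N => n m Nn Nm; case: (hN n m Nn Nm).
have [u0 hu0] : exists x : H, (fun n => (g n).1.2) @ \oo --> x.
  by apply: cauchy_cvgn => d /Cx[N hN]; exists N => n m Nn Nm; case: (hN n m Nn Nm).
(* The third component has no convexity gap; its limit is recovered from the costs, which are
   mutually close because each is almost minimal. *)
have [k0 hk0] : exists k : R, (fun n => cost (g n)) @ \oo --> k.
  apply: cauchy_cvgn => d d0.
  have [N _ hN] := near_infty_natSinv_lt (PosNum d0).
  exists N => n m Nn Nm; have := gmin n _ (gepi m); have := gmin m _ (gepi n).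
  have := hN n Nn; have := hN m Nm; rewrite /= ler_norml.
  move: (n.+1%:R^-1) (m.+1%:R^-1) (cost _) (cost _) => *; apply/andP; split; lra.
have bxx := form_cvg hb c0 bc bC hx0 hx0.
have buu := form_cvg hb c0 bc bC hu0 hu0.
pose t0 := k0 - b x0 x0 / 2 - b u0 u0 / 2.
have ht0 : (fun n => (g n).2) @ \oo --> t0.
  have -> : (fun n => (g n).2) = (fun n => cost (g n) - b (g n).1.1 (g n).1.1 / 2
     - b (g n).1.2 (g n).1.2 / 2) by apply/funext => n; rewrite /cost; ring.
  apply: cvgB; first apply: cvgB => //.
    by apply: cvgM => //; exact: cvg_cst.
  by apply: cvgM => //; exact: cvg_cst.
exists (x0, u0, t0).
  move=> y' v' A' /=; apply: (cvgn_le _ ht0 (fun n => gepi n y' v' A')).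
  apply: cvgB; last exact: cvg_cst.
  apply: cvgD.
    by apply: (form_cvg hb c0 bc bC) => //; exact: cvg_cst.
  by apply: (form_cvg hb c0 bc bC) => //; exact: cvg_cst.
move=> e he; have -> : cost (x0, u0, t0) = k0 by rewrite /cost /t0 /=; ring.
apply: (cvgn_le hk0 _ (fun n => gmin n e he)).
rewrite -[X in _ --> X]addr0; apply: cvgD; first exact: cvg_cst.
exact: cvgn_harmonic.
Qed.

(** Optimality along segments from the minimiser to graph points gives [key]. It says in particular
    that [(- u0, - x0)] is monotonically related to the graph, hence lies on it; inserting this very
    pair in [key] yields [x0 + u0 = 0]. *)
Lemma minty_zero : exists x u, A x u /\ x + u = 0.
Proof.
have [[[x0 u0] t0] he0 hmin] := cost_minimiser.
have key y v : A y v -> b (x0 + u0) (x0 + u0) <= b (y + u0) (v + x0).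
  move=> Ayv.
  have : 0 <= b y v - t0 + b x0 (y - x0) + b u0 (v - u0).
    apply: (@ge0_of_perturb _ _
        ((b (y - x0) (y - x0) + b (v - u0) (v - u0)) / 2)) => s s0 s1.
    have := hmin _ (epi_comb (ltW s0) s1 he0 (epi_graph Ayv)).
    rewrite -subr_ge0 /cost /comb /=.
    rewrite !(bilinE hb) (bilinC hb y x0) (bilinC hb v u0).
    rewrite -(pmulr_rge0 _ s0) => h; rewrite -(pmulr_rge0 _ s0).
    rewrite -(pmulr_rge0 _ s0); apply: le_trans h _; rewrite le_eqVlt; apply/orP; left.
    by apply/eqP; field.
  have := epi_ge he0 => /=; rewrite !(bilinE hb) (bilinC hb u0 x0) (bilinC hb u0 v).
  rewrite (bilinC hb y x0) (bilinC hb v u0); lra.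
have A0 : A (- u0) (- x0).
  apply: hA.2 => y v Ayv; have := key y v Ayv.
  move=> h; apply: le_trans (le_trans (b_ge0 _) h) _.
  rewrite -opprD -opprD (bilinNl hb) (bilinNr hb) opprK (bilinC hb).
  by rewrite (addrC x0) (addrC u0).
have sum0 : x0 + u0 = 0.
  apply/eqP; rewrite -normr_eq0 -sqrf_eq0 eq_le sqr_ge0 andbT.
  rewrite -(pmulr_rle0 _ c0); apply: le_trans (bc _) _.
  by apply: le_trans (key _ _ A0) _; rewrite addNr (bilin0l hb).
exists (- u0), (- x0); split => //.
by rewrite -opprD addrC sum0 oppr0.
Qed.

End Minty.

(** * The inverse of Q and the resolvent of QA *)

Section BoundedLinear.
Context (R : realType) (U V : normedModType R) (f : U -> V).
Hypothesis hf : bounded_linear f.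

Lemma blinD x y : f (x + y) = f x + f y.
Proof. by have := hf.1 1 x y; rewrite !scale1r. Qed.

Lemma blin0 : f 0 = 0.
Proof. by apply: (addIr (f 0)); rewrite -blinD !add0r. Qed.

Lemma blinZ a x : f (a *: x) = a *: f x.
Proof. by have := hf.1 a x 0; rewrite blin0 !addr0. Qed.

Lemma blinN x : f (- x) = - f x.
Proof. by rewrite -scaleN1r blinZ scaleN1r. Qed.

Lemma blinB x y : f (x - y) = f x - f y.
Proof. by rewrite blinD blinN. Qed.

Lemma blin_bound : exists2 M : R, 0 < M & forall x, `|f x| <= M * `|x|.
Proof.
pose fL : {linear U -> V} := HB.pack f (GRing.isLinear.Build _ _ _ _ f hf.1).
have /linear_bounded_continuous/linear_boundedP[M [_ hM]] : continuous fL := hf.2.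
exists (Num.max 1 (M + 1)); first by rewrite lt_max ltr01.
by apply: hM; rewrite lt_max ltrDl ltr01 orbT.
Qed.

End BoundedLinear.

Lemma bounded_linear_comp (R : realType) (U V W : normedModType R)
    (f : U -> V) (g : V -> W) :
  bounded_linear f -> bounded_linear g -> bounded_linear (g \o f).
Proof.
move=> hf hg; split; first by move=> a x y /=; rewrite hf.1 hg.1.
by move=> x; apply: continuous_comp; [exact: hf.2 | exact: hg.2].
Qed.

(** * The coercive operator [Q], its inverse [P], and the form [ip (P x) y] *)

Section Coercive.
Context (R : realType) (H : completeNormedModType R) (ip : H -> H -> R).
Hypothesis hip : is_inner_product ip.

Lemma ip_bilin : sym_bilinear ip.
Proof. by case: hip. Qed.
Local Notation hb := ip_bilin.

Lemma ipxx x : ip x x = `|x| ^+ 2. Proof. by case: hip. Qed.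

Lemma ip_le x y : ip x y <= `|x| * `|y|.
Proof.
have ge0 z : 0 <= ip z z by rewrite ipxx sqr_ge0.
by have := bilin_le_bnorm hb ge0 x y; rewrite /bnorm !ipxx !sqrtr_sqr !normr_id.
Qed.

Lemma ip_abs x y : `|ip x y| <= `|x| * `|y|.
Proof.
rewrite ler_norml ip_le andbT lerNl -(bilinNl hb).
by apply: le_trans (ip_le _ _) _; rewrite normrN.
Qed.

Lemma ip_lower x : 1 * `|x| ^+ 2 <= ip x x. Proof. by rewrite mul1r ipxx. Qed.
Lemma ip_upper x : ip x x <= 1 * `|x| ^+ 2. Proof. by rewrite mul1r ipxx. Qed.

Definition ip_cvg := form_cvg hb ltr01 ip_lower ip_upper.

Lemma ip_sep x : (forall w, ip x w = 0) -> x = 0.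
Proof. exact: form_sep ltr01 ip_lower _. Qed.

Lemma ip_norm_le x k : 0 <= k -> (forall w, ip x w <= k * `|w|) -> `|x| <= k.
Proof.
move=> k0 /(_ x); rewrite ipxx expr2; have [->|x0] := eqVneq x 0.
  by rewrite normr0.
by rewrite ler_pM2r // normr_gt0.
Qed.

Variables (Q : H -> H).
Hypothesis hQ : bounded_linear Q.
Hypothesis hQsa : forall h k, ip (Q h) k = ip h (Q k).
Variable gam : R.
Hypothesis gam0 : 0 < gam.
Hypothesis hQco : forall h, gam * `|h| ^+ 2 <= ip (Q h) h.

(* [Q x = gam (h + x)] means [x + (Q x / gam - x - h) = 0], to which Minty's
   theorem applies. *)
Lemma coercive_surj h : exists x, Q x = h.
Proof.
pose B (x : H) : set H := [set u | u = gam^-1 *: Q x - x - h].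
have Bmax : maximal_monotone ip B.
  split=> [x y u v -> ->|x u hu].
    have -> : gam^-1 *: Q x - x - h - (gam^-1 *: Q y - y - h)
        = gam^-1 *: Q (x - y) - (x - y).
      rewrite opprB addrA subrK !opprB (blinB hQ) scalerBr [y - _]addrC addrACA.
      by rewrite [- x + y]addrC.
    move: (x - y) => d; rewrite !(bilinDl hb, bilinNl hb, bilinZl hb) subr_ge0 ipxx.
    by rewrite -(ler_pM2l gam0) mulVKf ?gt_eqF//.
  (* Maximality by perturbation: testing at [x - s *: - e] and letting [s] tend to 0 leaves
     [- |e|^2 >= 0] for the defect [e]. *)
  apply/eqP; rewrite -subr_eq0; set e := u - _.
  rewrite -normr_eq0 -sqrf_eq0 eq_le sqr_ge0 andbT -oppr_ge0.
  pose k := gam^-1 *: Q (- e) - (- e).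
  apply: (@ge0_of_perturb _ _ (ip k (- e))) => s s0 _.
  have := hu (x - s *: (- e)) _ erefl.
  have sub w : u - (gam^-1 *: Q (x - s *: w) - (x - s *: w) - h) =
      u - (gam^-1 *: Q x - x - h) + s *: (gam^-1 *: Q w - w).
    rewrite (blinB hQ) (blinZ hQ) !scalerBr [_ *: (s *: _)]scalerA (mulrC _ s).
    rewrite -scalerA; move: (s *: w) (s *: _) (gam^-1 *: _) => r p X.
    have -> : X - p - (x - r) = X - x - (p - r).
      by rewrite !opprB addrACA [RHS]addrACA [- p - x]addrC.
    by rewrite [_ - _ - h]addrAC opprB addrA addrAC.
  have -> : x - (x - s *: - e) = s *: - e by rewrite opprB addrC subrK.
  rewrite sub -/e -/k (bilinZr hb) pmulr_rge0//.
  by rewrite (bilinDl hb) (bilinZl hb) [ip e _](bilinNr hb) ipxx.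
(* The two terms [x] cancel, so the zero satisfies [gam^-1 *: Q x = h]. *)
have [x [u [-> /eqP]]] := minty_zero hb ltr01 ip_lower ip_upper Bmax.
rewrite addrA [x + _]addrC subrK subr_eq0 => /eqP e.
by exists (gam^-1 *: x); rewrite (blinZ hQ).
Qed.

Lemma coercive_inj x : Q x = 0 -> x = 0.
Proof.
move=> Qx; apply/eqP; rewrite -normr_eq0 -sqrf_eq0 eq_le sqr_ge0 andbT.
by have := hQco x; rewrite Qx (bilin0l hb) pmulr_rle0.
Qed.

Lemma coercive_inverse : exists P : H -> H, [/\ forall h, Q (P h) = h,
  forall h, P (Q h) = h, sym_bilinear (fun x y => ip (P x) y),
  forall a x y, P (a *: x + y) = a *: P x + P y
  & forall x, `|P x| <= gam^-1 * `|x|].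
Proof.
have [P hP] := choice coercive_surj.
have inj x y : Q x = Q y -> x = y.
  move=> e; apply/eqP; rewrite -subr_eq0; apply/eqP; apply: coercive_inj.
  by rewrite (blinB hQ) e subrr.
have PQ h : P (Q h) = h by apply: inj; rewrite hP.
have Plin a x y : P (a *: x + y) = a *: P x + P y.
  by apply: inj; rewrite (blinD hQ) (blinZ hQ) !hP.
exists P; split => //.
  split=> [x y|a x y z]; first by rewrite -[in LHS](hP y) -hQsa hP (bilinC hb).
  by rewrite Plin !(bilinE hb).
move=> x; rewrite -(ler_pM2l gam0) mulVKf ?gt_eqF//.
have [->|x0] := eqVneq (P x) 0; first by rewrite normr0 mulr0.
rewrite -(@ler_pM2r _ `|P x|) ?normr_gt0// -mulrA -expr2.
by apply: le_trans (hQco _) _; rewrite hP ip_le.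
Qed.

Variables (P : H -> H) (M : R).
Hypothesis M0 : 0 < M.
Hypothesis QM : forall x, `|Q x| <= M * `|x|.
Hypothesis QP : forall h, Q (P h) = h.
Hypothesis PQ : forall h, P (Q h) = h.
Hypothesis Pb : sym_bilinear (fun x y => ip (P x) y).
Hypothesis Plin : forall a x y, P (a *: x + y) = a *: P x + P y.
Hypothesis Pbd : forall x, `|P x| <= gam^-1 * `|x|.
Let pf x y := ip (P x) y.

(** Coercivity at [P x] gives [gam |P x|^2], and [|x| = |Q (P x)| <= M |P x|]. *)
Lemma pform_lower x : gam / M ^+ 2 * `|x| ^+ 2 <= pf x x.
Proof.
rewrite /pf (bilinC hb) -[X in ip X _](QP x).
apply: le_trans (hQco (P x)); rewrite -mulrA ler_pM2l // mulrC ler_pdivrMr ?exprn_gt0//.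
rewrite mulrC -exprMn -[x in `|x|](QP x).
by rewrite ler_pXn2r ?nnegrE ?mulr_ge0 ?(ltW M0).
Qed.

Lemma pform_upper x : pf x x <= gam^-1 * `|x| ^+ 2.
Proof.
by apply: le_trans (ip_le _ _) _; rewrite expr2 mulrA ler_wpM2r.
Qed.

Lemma pform_const_gt0 : 0 < gam / M ^+ 2.
Proof. by rewrite divr_gt0 ?exprn_gt0. Qed.

Lemma pform_ge0 x : 0 <= pf x x.
Proof. exact: form_ge0 pform_const_gt0 pform_lower _. Qed.

Definition pnorm := bnorm pf.

Lemma pnorm_ge0 x : 0 <= pnorm x. Proof. exact: bnorm_ge0. Qed.

Lemma pnormD x y : pnorm (x + y) <= pnorm x + pnorm y.
Proof. exact: bnormD Pb pform_ge0 _ _. Qed.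

Lemma pnormZ a x : 0 <= a -> pnorm (a *: x) = a * pnorm x.
Proof. exact: (bnormZ Pb). Qed.

Lemma pnormN x : pnorm (- x) = pnorm x.
Proof. exact: (bnormN Pb). Qed.

Lemma pnorm_le x : pnorm x <= Num.sqrt gam^-1 * `|x|.
Proof.
rewrite -[X in _ * X]normr_id -sqrtr_sqr -sqrtrM ?invr_ge0 ?(ltW gam0)//.
by rewrite ler_wsqrtr // pform_upper.
Qed.

Lemma le_pnorm x : `|x| <= Num.sqrt (M ^+ 2 / gam) * pnorm x.
Proof.
rewrite -[leLHS]normr_id -sqrtr_sqr /pnorm /bnorm -sqrtrM ?divr_ge0 ?sqr_ge0 ?(ltW gam0)//.
rewrite ler_wsqrtr // mulrC -ler_pdivrMr ?divr_gt0 ?exprn_gt0// invf_div mulrC.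
exact: pform_lower.
Qed.

Variable A : H -> set H.
Hypothesis hA : maximal_monotone ip A.

(** [B] is the operator [tau Q A - h] written through [P]. In the form [pf] the factor [Q] cancels,
    so maximal monotonicity passes from [A] to [B]. *)
Lemma resolvent_ex tau h : 0 < tau -> exists y v, A y v /\ y + tau *: Q v = h.
Proof.
move=> t0.
pose B (x : H) : set H := [set u | A x (tau^-1 *: P (u + h))].
have PB x y : P (x - y) = P x - P y.
  by rewrite addrC -[- y]scaleN1r Plin scaleN1r addrC.
have Bmax : maximal_monotone pf B.
  split=> [x y u v Bu Bv|x u hu].
    have := hA.1 _ _ _ _ Bu Bv; rewrite -scalerBr -PB (bilinZl hb).
    by rewrite opprD addrACA subrr addr0 pmulr_rge0 ?invr_gt0.
  apply: hA.2 => y v Ayv; have := hu y (tau *: Q v - h).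
  rewrite /B /= subrK => /(_ _)/wrap[].
    by rewrite -(blinZ hQ) PQ scalerA mulVf ?gt_eqF// scale1r.
  rewrite /pf opprB addrA PB -(blinZ hQ) PQ => hpos.
  rewrite -(@pmulr_rge0 _ tau)// -(bilinZl hb) scalerBr scalerA.
  by rewrite divff ?gt_eqF// scale1r.
have [x [u [Bxu /eqP]]] := minty_zero Pb pform_const_gt0 pform_lower pform_upper Bmax.
rewrite addrC addr_eq0 => /eqP ux; exists x, (tau^-1 *: P (u + h)); split => //.
by rewrite (blinZ hQ) QP scalerA divff ?gt_eqF// scale1r ux addrA subrr add0r.
Qed.

(** Subtract [tau *: Q w] on both sides and pair with [y - a] in [pf]: the contribution of
    [Q (v - w)] becomes the monotonicity pairing of [A], which is nonnegative and is dropped.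
    Cauchy-Schwarz then lets one factor [pnorm (y - a)] be cancelled. *)
Lemma step_contraction tau y y' v d a w : 0 <= tau -> A y v -> A a w ->
  y + tau *: Q v = y' + d ->
  pnorm (y - a) <= pnorm (y' - a) + pnorm d + tau * pnorm (Q w).
Proof.
move=> t0 Ayv Aaw e.
have mon := hA.1 _ _ _ _ Ayv Aaw.
pose f := y' - a + d - tau *: Q w.
have ef : f = (y - a) + tau *: Q (v - w).
  rewrite /f (_ : y' - a + d = y + tau *: Q v - a); last by rewrite e addrAC.
  by rewrite (blinB hQ) scalerBr addrA; congr (_ - _); rewrite addrAC.
have le1 : pnorm (y - a) ^+ 2 <= pf f (y - a).
  rewrite (sqr_bnorm pform_ge0) ef; move: (y - a) mon => D mon.
  rewrite /pf (bilinDl Pb) lerDl.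
  by rewrite -(blinZ hQ) PQ (bilinZl hb) mulr_ge0.
have lef : pnorm (y - a) <= pnorm f.
  have := le_trans le1 (bilin_le_bnorm Pb pform_ge0 _ _).
  have [->|n0] := eqVneq (pnorm (y - a)) 0; first by rewrite pnorm_ge0.
  by rewrite expr2 ler_pM2r// lt_def n0 pnorm_ge0.
apply: le_trans lef _; rewrite /f; apply: le_trans (pnormD _ _) _.
rewrite pnormN pnormZ // lerD2r; exact: pnormD.
Qed.

(** By maximality [A h] is an intersection of closed half-spaces, hence convex and closed, and the
    parallelogram identity makes a minimising sequence Cauchy. So the [xget] in [min_section] never
    falls back on its default on the domain. *)
Lemma min_section_spec h : dom A h ->
  A h (min_section A h) /\ forall w, A h w -> `|min_section A h| <= `|w|.
Proof.
move=> [v0 Av0].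
have Amid u u' : A h u -> A h u' -> A h (2^-1 *: (u + u')).
  move=> Au Au'; apply: hA.2 => y v Ayv.
  have := hA.1 _ _ _ _ Au Ayv; have := hA.1 _ _ _ _ Au' Ayv.
  rewrite !(bilinE hb); lra.
have [] := @almost_minimisers R _ (fun u u' : H => 2^-1 *: (u + u'))
  (fun u => ip u u) (fun=> A h) (ip v0 v0).
- by move=> _; exists v0.
- by move=> *.
- by move=> _; exact: Amid.
- by move=> u _; rewrite ipxx sqr_ge0.
move=> g [gA gmin gap].
have [l hl] : exists l : H, g @ \oo --> l.
  apply: cauchy_cvgn => d d0.
  have cd : 0 < d ^+ 2 / 4 by rewrite divr_gt0 ?exprn_gt0.
  have [N hN] := gap _ cd; exists N => n m Nn Nm.
  have := hN n m Nn Nm; rewrite (bilin_mid hb) (ipxx (_ - _)) => h1.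
  by rewrite -(@ler_pXn2r _ 2) ?nnegrE ?(ltW d0)//; lra.
have Al : A h l.
  apply: hA.2 => y v Ayv.
  apply: (cvgn_le _ _ (fun n => hA.1 _ _ _ _ (gA n) Ayv)); first exact: cvg_cst.
  by apply: ip_cvg; [apply: cvgB => //|]; exact: cvg_cst.
apply: (@xgetPex _ 0 [set v | A h v /\ forall w, A h w -> `|v| <= `|w|]).
exists l; split=> // w Aw.
rewrite -(@ler_pXn2r _ 2) ?nnegrE// -!ipxx.
apply: (cvgn_le _ _ (fun n => gmin n w Aw)); first exact: ip_cvg.
rewrite -[X in _ --> X]addr0; apply: cvgD; first exact: cvg_cst.
exact: cvgn_harmonic.
Qed.

End Coercive.

(** * Lower integrals and real integrals *)

Section NonMeasurable.
Import HBNNSimple.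
Context d (T : measurableType d) (R : realType) (m : {measure set T -> \bar R}).
Local Open Scope ereal_scope.

(* The functions may fail to be measurable: [\int] is then a lower integral. *)
Lemma le_ae_lower_integral (D : set T) (f g : T -> \bar R) : measurable D ->
  (forall x, D x -> 0 <= f x) -> (forall x, D x -> 0 <= g x) ->
  {ae m, forall x, D x -> f x = g x} ->
  \int[m]_(x in D) f x <= \int[m]_(x in D) g x.
Proof.
move=> mD f0 g0 [N [mN muN hN]].
rewrite integral_mkcond [leRHS]integral_mkcond.
have F0 x : 0 <= (f \_ D) x by apply: erestrict_ge0.
have G0 x : 0 <= (g \_ D) x by apply: erestrict_ge0.
rewrite ge0_integralTE//; apply: ge_ereal_sup => _ [h hf <-].
(* A simple function below [f] is cut off on the null set [N]: its integral is unchanged and it now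
   lies below [g]. *)
have mCN : measurable (~` N) by exact: measurableC.
rewrite -integralT_nnsfun.
have -> : \int[m]_x (h x)%:E = \int[m]_x (proj_nnsfun h mCN x)%:E.
  apply: ge0_ae_eq_integral => //.
  - by apply/measurable_EFinP.
  - by apply/measurable_EFinP.
  - by move=> x _; rewrite lee_fin.
  - by move=> x _; rewrite lee_fin.
  exists N; split => // x /= hx; apply: contrapT => Nx; apply: hx => _.
  by rewrite mindicE mem_set// mulr1.
rewrite integralT_nnsfun ge0_integralTE//; apply: ereal_sup_ubound.
exists (proj_nnsfun h mCN) => // x /=; rewrite mindicE.
have [Nx|Nx] := pselect (N x).
  by rewrite memNset ?mulr0//; apply.
rewrite mem_set// mulr1; apply: le_trans (hf x) _.
rewrite /patch; case: ifPn => //; rewrite inE => Dx.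
have -> // : f x = g x; apply: contrapT => fg; apply: Nx; apply: hN => /= h'.
by apply: fg; exact: h'.
Qed.

Lemma ae_lower_integral (D : set T) (f g : T -> \bar R) : measurable D ->
  (forall x, D x -> 0 <= f x) -> (forall x, D x -> 0 <= g x) ->
  {ae m, forall x, D x -> f x = g x} ->
  \int[m]_(x in D) f x = \int[m]_(x in D) g x.
Proof.
move=> mD f0 g0 fg; apply/eqP; rewrite eq_le !le_ae_lower_integral//.
by apply: filterS fg => x h /h.
Qed.

End NonMeasurable.

(** * Real integrals on measurable sets and intervals *)

Section RealIntegral.
Context (R : realType).
Local Notation mu := (@lebesgue_measure R).
Implicit Types (D : set R) (f g : R -> R) (a b c : R).

Lemma ae_mono (P S : R -> Prop) : (forall x, P x -> S x) ->
  {ae mu, forall x, P x} -> {ae mu, forall x, S x}.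
Proof.
move=> PS [N [mN N0 hN]]; exists N; split => // x nS; apply: hN => Px.
by apply: nS; exact: PS.
Qed.

Lemma ae_and (P S : R -> Prop) : {ae mu, forall x, P x} -> {ae mu, forall x, S x} ->
  {ae mu, forall x, P x /\ S x}.
Proof.
move=> hP hS; have := @filterI _ _ (ae_filter_ringOfSetsType mu) _ _ hP hS.
exact: ae_mono.
Qed.

Lemma ae_all (P : R -> Prop) : (forall x, P x) -> {ae mu, forall x, P x}.
Proof. by move=> h; exists set0; split => // x; apply. Qed.

Definition itg D f := mu.-integrable D (EFin \o f).
Local Notation intg D f := (Rintegral mu D f).

Lemma itg_le D f g : measurable D -> measurable_fun D f -> itg D g ->
  (forall x, D x -> `|f x| <= g x) -> itg D f.
Proof.
move=> mD mf ig h; apply: le_integrable ig => //; first exact/measurable_EFinP.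
move=> x Dx; rewrite /= lee_fin; apply: le_trans (h x Dx) _; exact: ler_norm.
Qed.

Lemma itg_meas D f : itg D f -> measurable_fun D f.
Proof. by move=> /measurable_int/measurable_EFinP. Qed.

Lemma itgD D f g : measurable D -> itg D f -> itg D g -> itg D (fun x => f x + g x).
Proof. by move=> mD; exact: integrableD. Qed.

Lemma itgB D f g : measurable D -> itg D f -> itg D g -> itg D (fun x => f x - g x).
Proof. by move=> mD; exact: integrableB. Qed.

Lemma itgZ D k f : measurable D -> itg D f -> itg D (fun x => k * f x).
Proof. by move=> mD; exact: integrableZl. Qed.

Lemma itgS D D' f : measurable D -> measurable D' -> D' `<=` D -> itg D f -> itg D' f.
Proof. by move=> mD mD' s; exact: integrableS. Qed.

Lemma itg_cst a b k : itg `[a, b] (fun=> k).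
Proof.
apply: measurable_bounded_integrable => //.
- rewrite -[X in (X < _)%E]/(mu `[a, b]%classic) lebesgue_measure_itv /=.
  by case: ifP => _; rewrite -?EFinD ltry.
- exists `|k|; split; first exact: num_real.
  by move=> M kM x _ /=; exact: ltW.
Qed.

Lemma intg_cst a b k : a <= b -> intg `[a, b] (fun=> k) = k * (b - a).
Proof.
move=> ab; rewrite Rintegral_cst// -[X in fine X]/(mu `[a, b]%classic).
rewrite lebesgue_measure_itv /= lte_fin.
move: ab; rewrite le_eqVlt => /predU1P[->|ab]; first by rewrite ltxx subrr.
by rewrite ab.
Qed.

Lemma intg_ge0 D f : (forall x, D x -> 0 <= f x) -> 0 <= intg D f.
Proof. by move=> f0; apply: (@Rintegral_ge0 _ _ _ mu). Qed.

Lemma intg_split f a b c : a <= c -> c <= b -> itg `[a, b] f ->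
  intg `[a, b] f = intg `[a, c] f + intg `[c, b] f.
Proof.
move=> ac cb fi.
have := @Rintegral_itvB R f (BLeft a) (BRight b) c fi.
rewrite !bnd_simp => /(_ ac cb).
rewrite Rintegral_itv_obnd_cbnd; first by move=> <-; rewrite addrC subrK.
by apply: itgS fi => //; apply: subset_itvr; rewrite bnd_simp.
Qed.

Lemma le_intg D f g : measurable D -> itg D f -> itg D g ->
  (forall x, D x -> f x <= g x) -> intg D f <= intg D g.
Proof. by move=> mD fi gi fg; apply: (@le_Rintegral _ _ _ mu). Qed.

Lemma le_intg_ae D f g : measurable D -> itg D f -> itg D g ->
  {ae mu, forall x, D x -> f x <= g x} -> intg D f <= intg D g.
Proof.
move=> mD fi gi fg; rewrite -subr_ge0 -RintegralB//.
have mB : measurable_fun D (fun x => g x - f x).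
  by apply: measurable_funB; exact: itg_meas.
(* The positive part agrees almost everywhere with [g - f] and is nonnegative everywhere. *)
rewrite (_ : intg D _ = intg D (fun x => Num.max 0 (g x - f x))); last first.
  rewrite /Rintegral; congr fine; apply: ae_eq_integral => //.
  - exact/measurable_EFinP.
  - apply/measurable_EFinP; apply: measurable_maxr => //; exact: measurable_cst.
  by apply: ae_mono fg => x h Dx; rewrite /= max_r// subr_ge0 h.
by apply: intg_ge0 => x _; rewrite le_max lexx.
Qed.

Lemma eq_intg_ae D f g : measurable D -> measurable_fun D f -> measurable_fun D g ->
  {ae mu, forall x, D x -> f x = g x} -> intg D f = intg D g.
Proof.
move=> mD mf mg fg; rewrite /Rintegral; congr fine; apply: ae_eq_integral => //.
- exact/measurable_EFinP.
- exact/measurable_EFinP.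
by apply: ae_mono fg => x h Dx; rewrite h.
Qed.

Lemma subset_intg D D' f : measurable D -> measurable D' -> D' `<=` D ->
  (forall x, D x -> 0 <= f x) -> itg D f -> intg D' f <= intg D f.
Proof.
move=> mD mD' s f0 fi; have fi' := itgS mD mD' s fi.
rewrite /Rintegral fine_le ?integrable_fin_num//.
apply: ge0_subset_integral => //; first exact: measurable_int fi.
Qed.

Lemma itg_sqr_itg a b f : measurable_fun `[a, b] f -> itg `[a, b] (fun x => f x ^+ 2) ->
  itg `[a, b] f.
Proof.
move=> mf fi; apply: (@itg_le _ _ (fun x => 1 + f x ^+ 2)) => //.
  by apply: itgD => //; exact: itg_cst.
move=> x _; rewrite -[f x ^+ 2]real_normK ?num_real//.
by have := sqr_ge0 (`|f x| - 1); rewrite sqrrB expr1n; have := sqr_ge0 `|f x|; lra.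
Qed.

(** Young's inequality with a free weight [dl], optimal at [dl = I / (b - a)]. *)
Lemma intg_CS a b f : a <= b -> (forall x, 0 <= f x) -> itg `[a, b] f ->
  itg `[a, b] (fun x => f x ^+ 2) ->
  intg `[a, b] f ^+ 2 <= (b - a) * intg `[a, b] (fun x => f x ^+ 2).
Proof.
move=> ab f0 fi f2i; set J := intg _ (fun x => _ ^+ 2); set I := intg _ f.
have I0 : 0 <= I by apply: intg_ge0.
have J0 : 0 <= J by apply: intg_ge0 => x _; exact: sqr_ge0.
have key dl : 0 < dl -> 2 * I <= (b - a) * dl + J / dl.
  move=> d0.
  have : I <= intg `[a, b] (fun x => dl / 2 + (2 * dl)^-1 * f x ^+ 2).
    apply: le_intg => //; first by apply: itgD => //; [exact: itg_cst | exact: itgZ].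
    move=> x _; rewrite -subr_ge0.
    have -> : dl / 2 + (2 * dl)^-1 * f x ^+ 2 - f x = (dl - f x) ^+ 2 / (2 * dl).
      by field; lra.
    by rewrite divr_ge0 ?sqr_ge0// mulr_ge0 ?ltW.
  rewrite RintegralD//; [|exact: itg_cst|exact: itgZ].
  rewrite intg_cst// RintegralZl// -/J => h.
  have -> : J / dl = 2 * ((2 * dl)^-1 * J) by field; lra.
  lra.
have [I00|In0] := eqVneq I 0; first by rewrite I00 expr0n mulr_ge0 ?subr_ge0.
have Ip : 0 < I by rewrite lt_def In0.
(* On a degenerate interval the weight [(J + 1) / I] gives [2 I <= I J / (J + 1) <= I],
   contradicting [I > 0]. *)
have [ba|ba] := eqVneq (b - a) 0.
  have := key ((J + 1) / I) (divr_gt0 (ltr_wpDl J0 ltr01) Ip); rewrite ba mul0r add0r.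
  have -> : J / ((J + 1) / I) = I * (J / (J + 1)) by field; apply/andP; split; lra.
  have J1 : J / (J + 1) <= 1 by rewrite ler_pdivrMr; lra.
  have := ler_wpM2l I0 J1; lra.
have bap : 0 < b - a by rewrite lt_def ba subr_ge0.
have := key (I / (b - a)) (divr_gt0 Ip bap).
have -> : (b - a) * (I / (b - a)) + J / (I / (b - a)) = I + (b - a) * J / I.
  by field; rewrite !gt_eqF.
move=> h; rewrite expr2 -ler_pdivlMr//; lra.
Qed.

End RealIntegral.

(** * Simple functions and Bochner integrals *)

Notation intg D f := (Rintegral (@lebesgue_measure _) D f).

Section SimpleFun.
Context (R : realType).
Local Notation mu := (@lebesgue_measure R).

(** [B] is an arbitrary set, with no sigma-algebra on [V]: its preimage is a finite union of
    fibres. *)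
Lemma simple_preimage (V : normedModType R) (s : R -> V) (B : set V) :
  simple_fun s -> measurable (s @^-1` B).
Proof.
move=> [fs ms].
rewrite (_ : s @^-1` B = \bigcup_(v in range s `&` B) s @^-1` [set v]); last first.
  apply/seteqP; split=> x /=; first by move=> Bx; exists (s x) => //; split=> //; exists x.
  by move=> [v [_ Bv] /= ->].
apply: fin_bigcup_measurable => [|v _]; last exact: ms.
exact: finite_setIl.
Qed.

Lemma simple_op (V1 V2 V : normedModType R) (op : V1 -> V2 -> V) (s1 : R -> V1)
    (s2 : R -> V2) : simple_fun s1 -> simple_fun s2 ->
  simple_fun (fun x => op (s1 x) (s2 x)).
Proof.
move=> h1 h2; split.
  apply: (@sub_finite_set _ _ ((fun p => op p.1 p.2) @` (range s1 `*` range s2))).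
    move=> _ [x _ <-]; exists (s1 x, s2 x) => //; split; exists x => //.
  by apply: finite_image; apply: finite_setX; [exact: h1.1 | exact: h2.1].
move=> v.
rewrite (_ : _ @^-1` _ = \bigcup_(a in range s1)
   (s1 @^-1` [set a] `&` s2 @^-1` [set y | op a y = v])); last first.
  apply/seteqP; split=> x /=; first by move=> e; exists (s1 x); [exists x | split].
  by move=> [a _ [-> ]].
apply: fin_bigcup_measurable => [|a _]; first exact: h1.1.
by apply: measurableI; apply: simple_preimage.
Qed.

Lemma simple_indic (V : normedModType R) (G : set R) (s : R -> V) :
  measurable G -> simple_fun s -> simple_fun (fun x => if `[< G x >] then s x else 0).
Proof.
move=> mG hs; split.
  apply: (@sub_finite_set _ _ (range s `|` [set 0])).
    by move=> _ [x _ <-]; case: asboolP => _; [left; exists x | right].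
  by rewrite finite_setU; split; [exact: hs.1 | exact: finite_set1].
move=> v.
rewrite (_ : _ @^-1` _ = (G `&` s @^-1` [set v]) `|`
   (~` G `&` (fun=> (0 : V)) @^-1` [set v])); last first.
  apply/seteqP; split=> x /=.
    by case: asboolP => Gx h; [left | right].
  by case: asboolP => Gx [[]|[]].
apply: measurableU; apply: measurableI => //; first exact: hs.2.
- exact: measurableC.
- have [v0|v0] := pselect (0 = v).
    by rewrite (_ : _ @^-1` _ = setT)//; apply/seteqP; split.
  by rewrite (_ : _ @^-1` _ = set0)//; apply/seteqP; split.
Qed.

Lemma simple_range_seq (V : normedModType R) (s : R -> V) : simple_fun s ->
  exists2 r : seq V, uniq r & range s = [set` r].
Proof.
move=> hs; have [r hr] := (finite_seqP _).1 hs.1.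
exists (undup r); first exact: undup_uniq.
by rewrite hr; apply/seteqP; split=> x /=; rewrite mem_undup.
Qed.

Lemma simple_comp_meas (V : normedModType R) (s : R -> V) (psi : V -> R) (D : set R) :
  measurable D -> simple_fun s -> measurable_fun D (psi \o s).
Proof.
move=> mD hs _ B mB; rewrite comp_preimage; apply: measurableI => //.
exact: simple_preimage.
Qed.

Lemma simple_comp_itg (V : normedModType R) (s : R -> V) (psi : V -> R) (a b : R) :
  simple_fun s -> itg `[a, b] (psi \o s).
Proof.
move=> hs; have ms := @simple_comp_meas _ _ psi `[a, b] (measurable_itv _) hs.
have [K hK] : exists K, forall v, range s v -> `|psi v| <= K.
  have [r hr] := (finite_seqP _).1 hs.1.
  exists (\sum_(v <- r) `|psi v|) => v; rewrite hr /= => vr.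
  by rewrite (big_rem v)//= lerDl sumr_ge0.
apply: (@itg_le _ _ _ (fun=> K)) => //; first exact: itg_cst.
by move=> x _; apply: hK; exists x.
Qed.

(** Stated for arbitrary [psi] so as to serve the norm and linear functionals alike. *)
Lemma simple_comp_int (V : normedModType R) (s : R -> V) (psi : V -> R) (a b : R) :
  simple_fun s -> intg `[a, b] (psi \o s) =
  \sum_(v \in range s) fine (mu (`[a, b] `&` s @^-1` [set v])) * psi v.
Proof.
move=> hs; set D := [set` _].
have mD : measurable D by exact: measurable_itv.
have [r ur hr] := simple_range_seq hs.
rewrite hr -fsbig_seq//.
have ir v : itg D (fun x => psi v * \1_(s @^-1` [set v]) x).
  apply: itgZ => //; apply: (@itg_le _ _ _ (fun=> 1)) => //; last 2 first.
  - exact: itg_cst.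
  - by move=> x _; rewrite indicE; case: (_ \in _); rewrite ?normr1 ?normr0.
  apply: measurable_indic; exact: simple_preimage.
transitivity (intg D (fun x => \sum_(v <- r) psi v * \1_(s @^-1` [set v]) x)).
  apply: eq_Rintegral => x _ /=.
  have xr : s x \in r by have : range s (s x) by [exists x]; rewrite hr.
  rewrite (bigD1_seq (s x))//= big1_seq ?addr0.
    by rewrite indicE mem_set// mulr1.
  by move=> v /andP[vs _]; rewrite indicE memNset ?mulr0//= => /eqP; rewrite eq_sym (negbTE vs).
elim: r {ur hr} => [|v r ih].
  by rewrite big_nil; under eq_Rintegral do rewrite big_nil; rewrite Rintegral_cst// mul0r.
have isum : itg D (fun x => \sum_(v <- r) psi v * \1_(s @^-1` [set v]) x).
  elim: r {ih} => [|u r ih]; first by under eq_fun do rewrite big_nil; exact: itg_cst.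
  by under eq_fun do rewrite big_cons; apply: itgD.
under eq_Rintegral do rewrite big_cons.
rewrite RintegralD//; last exact: ir.
rewrite ih big_cons; congr (_ + _).
rewrite RintegralZl//; last first.
  apply: (@itg_le _ _ _ (fun=> 1)) => //; last 2 first.
  - exact: itg_cst.
  - by move=> x _; rewrite indicE; case: (_ \in _); rewrite ?normr1 ?normr0.
  apply: measurable_indic; exact: simple_preimage.
rewrite mulrC; congr (_ * _); rewrite /Rintegral integral_indic 1?setIC//.
exact: simple_preimage.
Qed.

Lemma simple_integral_fun (V : normedModType R) (s : R -> V) (phi : V -> R) (a b : R) :
  simple_fun s -> (forall c x y, phi (c *: x + y) = c * phi x + phi y) ->
  phi (simple_integral `[a, b] s) = intg `[a, b] (phi \o s).
Proof.
move=> hs phil; rewrite simple_comp_int// /simple_integral.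
have phi0 : phi 0 = 0 by have := phil 1 0 0; rewrite scale1r add0r mul1r; lra.
have [r ur ->] := simple_range_seq hs.
rewrite -!fsbig_seq//; elim: r {ur} => [|v r ih].
  by rewrite !big_nil.
by rewrite !big_cons phil ih.
Qed.

Lemma simple_integral_norm (V : normedModType R) (s : R -> V) (a b : R) :
  simple_fun s -> `|simple_integral `[a, b] s| <= intg `[a, b] (fun x => `|s x|).
Proof.
move=> hs; rewrite (simple_comp_int (fun v => `|v|))// /simple_integral.
have [r ur ->] := simple_range_seq hs.
rewrite -!fsbig_seq//; apply: le_trans (ler_norm_sum _ _ _) _.
by apply: ler_sum => v _; rewrite normrZ ger0_norm// fine_ge0.
Qed.

End SimpleFun.

(** * Bochner integrals: regular versions, functionals and norms *)

Section Bochner.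
Context (R : realType).
Local Notation mu := (@lebesgue_measure R).

Lemma fatou_bound (D : set R) (f : nat -> R -> R) (g : R -> R) (e : R) :
  measurable D -> (forall n, measurable_fun D (f n)) ->
  (forall n x, D x -> 0 <= f n x) -> (forall x, D x -> (f^~ x) @ \oo --> g x) ->
  (forall n, (\int[mu]_(x in D) (f n x)%:E <= e%:E)%E) ->
  (\int[mu]_(x in D) (g x)%:E <= e%:E)%E.
Proof.
move=> mD mf f0 fg hf.
have mEf n : measurable_fun D (EFin \o f n) by exact/measurable_EFinP.
have E0 n x : D x -> (0 <= (EFin \o f n) x)%E by move=> Dx; rewrite lee_fin f0.
have -> : (\int[mu]_(x in D) (g x)%:E =
    \int[mu]_(x in D) limn_einf (fun n => (EFin \o f n) x))%E.
  apply: eq_integral => x /[!inE] Dx.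
  suff /cvg_limn_einf_sup[-> _] : (fun n => (f n x)%:E) @ \oo --> (g x)%:E by [].
  by apply: cvg_EFin; [exact: nearW | exact: fg].
apply: (le_trans (@fatou _ _ _ mu D mD (fun n => EFin \o f n) mEf E0)).
rewrite limn_einf_lim; apply: lime_le; first exact: is_cvg_einfs.
apply: nearW => n; apply: le_trans (hf n).
by apply: ereal_inf_lbound; exists n => /=.
Qed.

(** Convergence is asked everywhere, so that continuous compositions are measurable without appeal
    to completeness of the measure. *)
Definition strongly_measurable (V : normedModType R) (g : R -> V) :=
  exists s : nat -> R -> V,
    (forall n, simple_fun (s n)) /\ forall x, (fun n => s n x) @ \oo --> g x.

Lemma strongly_meas_comp (V : normedModType R) (g : R -> V) (psi : V -> R) (D : set R) :
  measurable D -> strongly_measurable g -> continuous psi -> measurable_fun D (psi \o g).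
Proof.
move=> mD [s [hs sg]] cpsi.
apply: (@measurable_fun_cvg _ _ _ _ (fun n => psi \o s n)).
  by move=> n; exact: simple_comp_meas.
by move=> x _; apply: continuous_cvg => //; exact: cpsi.
Qed.

Lemma strongly_meas_norm (V : normedModType R) (g : R -> V) (D : set R) :
  measurable D -> strongly_measurable g -> measurable_fun D (fun x => `|g x|).
Proof. by move=> mD hg; apply: strongly_meas_comp => //; exact: norm_continuous. Qed.

Definition scalar_linear (V : normedModType R) (phi : V -> R) :=
  forall c x y, phi (c *: x + y) = c * phi x + phi y.

Lemma scalar_linearB (V : normedModType R) (phi : V -> R) x y :
  scalar_linear phi -> phi (x - y) = phi x - phi y.
Proof.
by move=> h; rewrite addrC -[- y]scaleN1r h mulN1r addrC.
Qed.

Lemma strongly_meas_lin (V : normedModType R) (g : R -> V) (phi : V -> R) (K : R)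
    (D : set R) : measurable D -> strongly_measurable g -> scalar_linear phi ->
  (forall v, `|phi v| <= K * `|v|) -> measurable_fun D (phi \o g).
Proof.
move=> mD hg pl pK; apply: strongly_meas_comp => // v.
apply/cvgrPdist_le => e e0.
near=> w; rewrite -(scalar_linearB _ _ pl); apply: le_trans (pK _) _.
have K1 : 0 < `|K| + 1 by rewrite ltr_wpDl.
apply: (@le_trans _ _ ((`|K| + 1) * `|v - w|)).
  by rewrite ler_wpM2r// (le_trans (ler_norm _))// lerDl.
rewrite mulrC -ler_pdivlMr//; near: w.
have /cvgrPdist_le := @cvg_id _ (nbhs v).
by apply; rewrite divr_gt0.
Unshelve. all: by end_near. Qed.

(** Setting the simple functions to 0 off the set [E] of convergence makes them converge everywhere,
    to a version [g'] of [g]. The original ones converge to [g'] in L^1, which carries functionals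
    and the norm from simple integrals to [I]. *)
Lemma bochner_regular (V : normedModType R) (T : R) (g : R -> V) (I : V) :
  is_bochner_integral `[0, T] g I -> exists g' : R -> V,
  [/\ strongly_measurable g', {ae mu, forall x, `[0, T]%classic x -> g x = g' x},
      itg `[0, T] (fun x => `|g' x|),
      (forall phi K, scalar_linear phi -> (forall v, `|phi v| <= K * `|v|) ->
        phi I = intg `[0, T] (phi \o g'))
    & `|I| <= intg `[0, T] (fun x => `|g' x|)].
Proof.
move=> [s [[hs [N [mN muN hN]] cauchy] sI]].
set D := [set` _] in cauchy sI hN *.
have mD : measurable D by exact: measurable_itv.
pose G := ~` N.
have mG : measurable G by exact: measurableC.
have aeG : {ae mu, forall x, G x} by exists N; split => // x /= /contrapT.
have sg x : G x -> D x -> (fun n => s n x) @ \oo --> g x.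
  by move=> Gx Dx; apply: contrapT => h; apply: Gx; apply: hN => /= h'; apply: h; exact: h'.
pose E := G `&` D.
have mE : measurable E by exact: measurableI.
pose s' n x := if `[< E x >] then s n x else 0.
pose g' x := if `[< E x >] then g x else 0.
have hs' n : simple_fun (s' n) by exact: simple_indic.
have s'g' x : (fun n => s' n x) @ \oo --> g' x.
  rewrite /s' /g'; case: asboolP => [[Gx Dx]|_]; last exact: cvg_cst.
  exact: sg.
have mg' : strongly_measurable g' by exists s'.
have gg' : {ae mu, forall x, D x -> g x = g' x}.
  by apply: ae_mono aeG => x Gx Dx; rewrite /g'; case: asboolP => // -[].
have mdiff n m : measurable_fun D (fun x => `|s n x - s' m x|).
  exact: (@simple_comp_meas _ _ _ (fun v : V => `|v|) _ mD (simple_op (fun a b : V => a - b) (hs n) (hs' m))).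
have itgs n : itg D (fun x => `|s n x|).
  exact: (@simple_comp_itg _ _ _ (fun v : V => `|v|)).
(* Fatou in the second index turns the L^1 Cauchy property into convergence to [g']. The shift by
   [M] makes the bound hold for every term. *)
have conv e : 0 < e -> exists M, forall n, (M <= n)%N ->
    (\int[mu]_(x in D) (`|s n x - g' x|)%:E <= e%:E)%E.
  move=> e0; have [M hM] := cauchy e e0; exists M => n Mn.
  apply: (@fatou_bound _ (fun m x => `|s n x - s' (m + M)%N x|)) => //.
    move=> x Dx; apply: cvg_norm; apply: cvgB; first exact: cvg_cst.
    by rewrite (cvg_shiftn M (fun m => s' m x)); exact: s'g'.
  move=> m; apply: le_trans (hM n (m + M)%N Mn (leq_addl _ _)).
  rewrite le_eqVlt; apply/orP; left; apply/eqP.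
  apply: ge0_ae_eq_integral => //.
  - by apply/measurable_EFinP; exact: mdiff.
  - apply/measurable_EFinP.
    exact: (@simple_comp_meas _ _ _ (fun v : V => `|v|) _ mD (simple_op (fun a b : V => a - b) (hs _) (hs _))).
  apply: ae_mono aeG => x Gx Dx /=; rewrite /s'; case: asboolP => // -[].
  by split.
have mdg n : measurable_fun D (fun x => `|s n x - g' x|).
  apply: (@measurable_fun_cvg _ _ _ _ (fun m x => `|s n x - s' m x|)) => // x _.
  apply: cvg_norm; apply: cvgB; first exact: cvg_cst.
  exact: s'g'.
have itgd : exists M, forall n, (M <= n)%N -> itg D (fun x => `|s n x - g' x|).
  have [M hM] := conv 1 ltr01; exists M => n Mn.
  apply/integrableP; split; first by apply/measurable_EFinP; exact: mdg.
  apply: (@le_lt_trans _ _ (\int[mu]_(x in D) (`|s n x - g' x|)%:E)%E).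
    rewrite le_eqVlt; apply/orP; left; apply/eqP.
    by apply: eq_integral => x _ /=; rewrite normr_id.
  by apply: le_lt_trans (hM n Mn) _; rewrite ltry.
have [M0 hM0] := itgd.
have ing' : itg D (fun x => `|g' x|).
  apply: (@itg_le _ _ _ (fun x => `|s M0 x| + `|s M0 x - g' x|)) => //.
  - exact: strongly_meas_norm.
  - by apply: itgD => //; exact: hM0.
  move=> x _; rewrite normr_id -{1}[g' x](subKr (s M0 x)).
  exact: ler_normB.
have convR e : 0 < e -> exists M, forall n, (M <= n)%N ->
    intg D (fun x => `|s n x - g' x|) <= e.
  move=> e0; have [M hM] := conv e e0; exists (maxn M M0) => n.
  rewrite geq_max => /andP[Mn M0n]; rewrite /Rintegral -lee_fin fineK ?hM//.
  by apply: integrable_fin_num => //; exact: hM0.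
exists g'; split => //.
- move=> phi K pl pK.
  (* [K] may vanish or be negative; [|K| + 1] is a bound by which one can divide. *)
  have K0 : 0 <= `|K| + 1 by rewrite addr_ge0.
  have pK' v : `|phi v| <= (`|K| + 1) * `|v|.
    apply: le_trans (pK v) _; rewrite ler_wpM2r//.
    by rewrite (le_trans (ler_norm _))// lerDl.
  have iphig : itg D (phi \o g').
    apply: (@itg_le _ _ _ (fun x => (`|K| + 1) * `|g' x|)) => //.
    + exact: strongly_meas_lin pK.
    + exact: itgZ.
    + by move=> x _; exact: pK'.
  have phis : (fun n => phi (simple_integral D (s n))) @ \oo --> phi I.
    apply: (@cvgn_dist_le _ _ _ _ (fun n => (`|K| + 1) * `|simple_integral D (s n) - I|)).
      by move=> n; rewrite -(scalar_linearB _ _ pl).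
    rewrite -[X in _ --> X](mulr0 (`|K| + 1)); apply: cvgM; first exact: cvg_cst.
    exact: cvgn_dist0.
  apply: (cvg_unique _ phis) => //.
  apply/cvgn_distP => e e0.
  have e1 : 0 < e / (`|K| + 1) by rewrite divr_gt0// ltr_wpDl.
  have [M hM] := convR _ e1; exists (maxn M M0) => n.
  rewrite geq_max => /andP[Mn M0n].
  have iphis : itg D (phi \o s n) by exact: simple_comp_itg.
  rewrite simple_integral_fun// -RintegralB//.
  apply: le_trans (le_normr_Rintegral _ _) _ => //; first exact: itgB.
  apply: (@le_trans _ _ (intg D (fun x => (`|K| + 1) * `|s n x - g' x|))).
    apply: le_intg => //.
    + by apply: integrable_norm; exact: itgB.
    + by apply: itgZ => //; exact: hM0.
    + by move=> x _; rewrite -(scalar_linearB _ _ pl).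
  rewrite RintegralZl//; last exact: hM0.
  by rewrite mulrC -ler_pdivlMr ?hM// ltr_wpDl.
- have nI : (fun n => `|simple_integral D (s n)|) @ \oo --> `|I| by exact: cvg_norm.
  rewrite -[leRHS]addr0.
  apply/ler_addgt0Pl => e e0; have [M hM] := convR e e0.
  rewrite addr0; apply: (cvgr_to_le nI); exists (maxn M M0) => // n /=.
  rewrite geq_max => /andP[Mn M0n].
  apply: le_trans (simple_integral_norm _ _ (hs n)) _; rewrite -/D.
  apply: (@le_trans _ _ (intg D (fun x => `|s n x - g' x| + `|g' x|))).
    apply: le_intg => //.
      by apply: itgD => //; exact: hM0.
    by move=> x _; rewrite -{1}[s n x](subrK (g' x)); exact: ler_normD.
  by rewrite RintegralD//; [rewrite lerD2r; exact: hM | exact: hM0].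
Qed.

End Bochner.

(** * The space H^1 and the energy inequality *)

Section H1.
Context (R : realType).
Local Notation mu := (@lebesgue_measure R).

Lemma subset_itvcc (a b c d : R) : a <= c -> d <= b -> (`[c, d] `<=` `[a, b])%classic.
Proof.
move=> ac db x /=; rewrite !in_itv /= => /andP[cx xd].
by rewrite (le_trans ac cx) (le_trans xd db).
Qed.

Lemma itgS_itvcc (a b c d : R) f : a <= c -> d <= b -> itg `[a, b] f -> itg `[c, d] f.
Proof. by move=> ac db; apply: itgS => //; exact: subset_itvcc. Qed.

(** [H1_deriv] provides a separate approximating sequence for each [t]. The version [g] found on
    [[0, T]] serves them all, being almost everywhere equal to each of theirs. The norms of [gl] are
    lower integrals, which ignore null sets even when [gl] is not measurable. *)
Lemma H1_regular (V : normedModType R) (T : R) (l gl : R -> V) :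
  0 <= T -> H1_deriv T l gl -> exists g : R -> V,
  [/\ strongly_measurable g,
      {ae mu, forall x, `[0, T]%classic x -> gl x = g x},
      itg `[0, T] (fun x => `|g x|) /\ itg `[0, T] (fun x => `|g x| ^+ 2),
      L1norm T gl = intg `[0, T] (fun x => `|g x|) /\
        L2norm T gl = Num.sqrt (intg `[0, T] (fun x => `|g x| ^+ 2))
    & forall t, 0 <= t <= T ->
        (forall phi K, scalar_linear phi -> (forall v, `|phi v| <= K * `|v|) ->
          phi (l t - l 0) = intg `[0, t] (phi \o g)) /\
        `|l t - l 0| <= intg `[0, t] (fun x => `|g x|)].
Proof.
move=> T0 [bint fin2].
have TT : 0 <= T <= T by rewrite T0 lexx.
have [g [mg gg ig _ _]] := bochner_regular (bint T TT).
have mD : measurable (`[0, T]%classic : set R) by exact: measurable_itv.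
have mg2 : measurable_fun `[0, T] (fun x => `|g x| ^+ 2).
  by apply: measurable_funX; exact: strongly_meas_norm.
have e1 : (\int[mu]_(x in `[0%R, T]) (`|gl x|)%:E =
           \int[mu]_(x in `[0%R, T]) (`|g x|)%:E)%E.
  apply: ae_lower_integral => //; try by move=> x _; rewrite lee_fin.
  by apply: ae_mono gg => x h Dx; rewrite h.
have e2 : (\int[mu]_(x in `[0%R, T]) (`|gl x| ^+ 2)%:E =
           \int[mu]_(x in `[0%R, T]) (`|g x| ^+ 2)%:E)%E.
  apply: ae_lower_integral => //; try by move=> x _; rewrite lee_fin sqr_ge0.
  by apply: ae_mono gg => x h Dx; rewrite h.
exists g; split => //.
- split => //; apply/integrableP; split; first exact/measurable_EFinP.
  apply: le_lt_trans fin2; rewrite e2.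
  rewrite le_eqVlt; apply/orP; left; apply/eqP.
  by apply: eq_integral => x _ /=; rewrite ger0_norm ?sqr_ge0.
- by rewrite /L1norm /L2norm e1 e2.
move=> t /andP[t0 tT]; have tt : 0 <= t <= T by rewrite t0.
have mDt : measurable (`[0, t]%classic : set R) by exact: measurable_itv.
have [h [mh gh ih hphi hn]] := bochner_regular (bint t tt).
have gheq : {ae mu, forall x, `[0, t]%classic x -> h x = g x}.
  apply: ae_mono (ae_and gg gh) => x [h1 h2] Dx.
  by rewrite -h2// h1//; apply: subset_itvcc Dx.
split.
- move=> phi K pl pK; rewrite (hphi _ _ pl pK); apply: eq_intg_ae => //.
  + exact: strongly_meas_lin pK.
  + exact: strongly_meas_lin pK.
  by apply: ae_mono gheq => x hx Dx /=; rewrite hx.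
- apply: le_trans hn _; rewrite le_eqVlt; apply/orP; left; apply/eqP.
  apply: eq_intg_ae => //; try exact: strongly_meas_norm.
  by apply: ae_mono gheq => x hx Dx /=; rewrite hx.
Qed.

Context (H : completeNormedModType R) (ip : H -> H -> R).
Hypothesis hip : is_inner_product ip.
Let hb := ip_bilin hip.

(* [z' = g] in the weak sense on [0, T]; the square integrable [m] dominates
   [|g|], so that [|g|] itself need not be measurable. *)
Definition weak_H1 (T : R) (z g : R -> H) (m : R -> R) :=
  [/\ forall w, measurable_fun `[0, T] (fun x => ip (g x) w),
      measurable_fun `[0, T] m, forall x, `|g x| <= m x,
      itg `[0, T] (fun x => m x ^+ 2)
    & forall t, 0 <= t <= T -> forall w,
        ip (z t - z 0) w = intg `[0, t] (fun x => ip (g x) w)].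

Section WeakH1.
Variables (T : R) (z g : R -> H) (m : R -> R).
Hypothesis zg : weak_H1 T z g m.

Lemma weak_H1_ge0 x : 0 <= m x.
Proof. by case: zg => _ _ h _ _; exact: le_trans (normr_ge0 _) (h x). Qed.

Lemma weak_H1_itg_dom : itg `[0, T] m.
Proof. by case: zg => _ mm _ i2 _; exact: itg_sqr_itg. Qed.

Lemma weak_H1_itg_ip w : itg `[0, T] (fun x => ip (g x) w).
Proof.
case: zg => mg mm hm _ _; apply: (@itg_le _ _ _ (fun x => `|w| * m x)) => //.
  by apply: itgZ => //; exact: weak_H1_itg_dom.
move=> x _; apply: le_trans (ip_abs hip _ _) _.
by rewrite mulrC ler_wpM2l.
Qed.

Lemma weak_H1_incr s t w : 0 <= s -> s <= t -> t <= T ->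
  ip (z t - z s) w = intg `[s, t] (fun x => ip (g x) w).
Proof.
move=> s0 st tT; case: zg => _ _ _ _ hz.
have := hz t _ w; rewrite (le_trans s0 st) tT => /(_ isT).
rewrite (@intg_split _ _ _ _ s)//; last exact: itgS_itvcc (lexx _) tT (weak_H1_itg_ip w).
have := hz s _ w; rewrite s0 (le_trans st tT) => /(_ isT) <-.
rewrite !(bilinE hb); lra.
Qed.

Lemma weak_H1_incr_le s t : 0 <= s -> s <= t -> t <= T ->
  `|z t - z s| <= intg `[s, t] m.
Proof.
move=> s0 st tT; apply: (ip_norm_le hip) => [|w].
  by apply: intg_ge0 => x _; exact: weak_H1_ge0.
rewrite weak_H1_incr// mulrC -RintegralZl//; last first.
  exact: itgS_itvcc s0 tT weak_H1_itg_dom.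
apply: le_intg => //.
- exact: itgS_itvcc s0 tT (weak_H1_itg_ip w).
- by apply: itgZ => //; exact: itgS_itvcc s0 tT weak_H1_itg_dom.
move=> x _; case: zg => _ _ hm _ _.
by apply: le_trans (ip_le hip _ _) _; rewrite mulrC ler_wpM2l.
Qed.

Lemma weak_H1_itg2 : itg `[0, T] (fun x => m x ^+ 2).
Proof. by case: zg. Qed.

Lemma weak_H1_CS s t : 0 <= s -> s <= t -> t <= T ->
  intg `[s, t] m ^+ 2 <= (t - s) * intg `[s, t] (fun x => m x ^+ 2).
Proof.
move=> s0 st tT; apply: intg_CS => //; first exact: weak_H1_ge0.
- exact: itgS_itvcc s0 tT weak_H1_itg_dom.
- exact: itgS_itvcc s0 tT weak_H1_itg2.
Qed.

(** * The energy inequality *)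

Variables (Q : H -> H) (M : R).
Hypothesis hQ : bounded_linear Q.
Hypothesis hQsa : forall h k, ip (Q h) k = ip h (Q k).
Hypothesis M0 : 0 <= M.
Hypothesis QM : forall x, `|Q x| <= M * `|x|.
Variable kappa : R -> R.
Hypothesis kint : itg `[0, T] kappa.
Hypothesis hk : {ae mu, forall x, `[0, T]%classic x -> 2 * ip (Q (z x)) (g x) <= kappa x}.

(** A chain rule with remainder. By symmetry of [Q] the increment is
    [ip (z t - z s) (Q (z t + z s))]; replacing [z t] and [z s] by [z x] under the integral costs at
    most [2 M L^2], and Cauchy-Schwarz bounds [L^2] by [t - s] times the integral of [m^2]. *)
Lemma energy_step s t : 0 <= s -> s <= t -> t <= T ->
  ip (Q (z t)) (z t) - ip (Q (z s)) (z s) <=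
  intg `[s, t] kappa + 2 * M * ((t - s) * intg `[s, t] (fun x => m x ^+ 2)).
Proof.
move=> s0 st tT; set L := intg `[s, t] m.
have mI : itg `[s, t] m by exact: itgS_itvcc s0 tT weak_H1_itg_dom.
have kI : itg `[s, t] kappa by exact: itgS_itvcc s0 tT kint.
have L0 : 0 <= L by apply: intg_ge0 => x _; exact: weak_H1_ge0.
have -> : ip (Q (z t)) (z t) - ip (Q (z s)) (z s) = ip (z t - z s) (Q (z t + z s)).
  rewrite (blinD hQ) !(bilinE hb) !(bilinC hb _ (Q _)) !hQsa.
  rewrite (bilinC hb (z s) (Q (z t))) hQsa; ring.
rewrite weak_H1_incr//.
apply: (@le_trans _ _ (intg `[s, t] (fun x => kappa x + (2 * M * L) * m x))).
  apply: le_intg_ae => //.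
  - exact: itgS_itvcc s0 tT (weak_H1_itg_ip _).
  - by apply: itgD => //; exact: itgZ.
  apply: ae_mono hk => x h xD.
  have xT : `[0, T]%classic x by apply: subset_itvcc xD.
  move: xD; rewrite /= in_itv /= => /andP[sx xt].
  have -> : ip (g x) (Q (z t + z s)) =
      2 * ip (Q (z x)) (g x) + ip (g x) (Q (z t - z x)) - ip (g x) (Q (z x - z s)).
    rewrite !(blinD hQ) !(blinN hQ) !(bilinE hb) (bilinC hb (Q (z x))); ring.
  rewrite -addrA; apply: lerD; first exact: h.
  have b1 u : `|u| <= L -> `|ip (g x) (Q u)| <= M * L * m x.
    move=> uL; apply: le_trans (ip_abs hip _ _) _.
    rewrite mulrC; apply: ler_pM => //; last by case: zg.
    by apply: le_trans (QM _) _; rewrite ler_wpM2l.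
  have l1 : `|z t - z x| <= L.
    apply: le_trans (weak_H1_incr_le (le_trans s0 sx) xt tT) _.
    by apply: subset_intg => //; [exact: subset_itvcc | move=> y _; exact: weak_H1_ge0].
  have l2 : `|z x - z s| <= L.
    apply: le_trans (weak_H1_incr_le s0 sx (le_trans xt tT)) _.
    by apply: subset_intg => //; [exact: subset_itvcc | move=> y _; exact: weak_H1_ge0].
  have := b1 _ l1; have := b1 _ l2; rewrite !ler_norml => /andP[h1 h2] /andP[h3 h4].
  rewrite (_ : 2 * M * L * m x = 2 * (M * L * m x)); last by ring.
  move: h1 h2 h3 h4; move: (ip (g x) _) (ip (g x) _) (M * L * m x) => p q r.
  by move=> *; lra.
rewrite RintegralD//; last exact: itgZ.
rewrite RintegralZl// lerD2l -/L -mulrA ler_wpM2l ?mulr_ge0//.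
by rewrite -expr2 weak_H1_CS.
Qed.

(** Over [n + 1] equal cells the remainders of [energy_step] add up to [O(1 / (n + 1))], which
    vanishes in the limit. *)
Lemma energy_ineq t : 0 <= t <= T ->
  ip (Q (z t)) (z t) <= ip (Q (z 0)) (z 0) + intg `[0, t] kappa.
Proof.
move=> /andP[t0 tT].
set J := intg `[0, t] (fun x => m x ^+ 2).
have key n : ip (Q (z t)) (z t) - ip (Q (z 0)) (z 0) - intg `[0, t] kappa <=
    n.+1%:R^-1 * (2 * M * t * J).
  pose p (i : nat) := i%:R * (t / n.+1%:R).
  have n0 : (0 : R) < n.+1%:R by [].
  have d0 : 0 <= t / n.+1%:R by rewrite divr_ge0.
  have pS i : p i.+1 = p i + t / n.+1%:R by rewrite /p -natr1 mulrDl mul1r.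
  have pn : p n.+1 = t by rewrite /p mulrC divfK// gt_eqF.
  have p0 i : 0 <= p i by rewrite /p mulr_ge0.
  have pt i : (i <= n.+1)%N -> p i <= t.
    by move=> ile; rewrite -pn /p ler_wpM2r// ler_nat.
  have : forall i, (i <= n.+1)%N ->
    ip (Q (z (p i))) (z (p i)) - ip (Q (z 0)) (z 0) <= intg `[0, p i] kappa +
      2 * M * (t / n.+1%:R * intg `[0, p i] (fun x => m x ^+ 2)).
    elim=> [_|i ih ile].
      rewrite /p mul0r subrr addr_ge0//.
        by rewrite set_itv1 Rintegral_set1.
      apply: mulr_ge0; first exact: mulr_ge0.
      apply: mulr_ge0 => //; by apply: intg_ge0 => x _; exact: sqr_ge0.
    have ppS : p i <= p i.+1 by rewrite pS lerDl.
    have pST : p i.+1 <= T by rewrite (le_trans (pt _ ile)).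
    have := ih (ltnW ile); have := energy_step (p0 i) ppS pST.
    rewrite (@intg_split _ kappa _ _ (p i) (p0 i) ppS); last exact: itgS_itvcc (lexx _) pST kint.
    rewrite (@intg_split _ (fun x => m x ^+ 2) _ _ (p i) (p0 i) ppS); last first.
      exact: itgS_itvcc (lexx _) pST weak_H1_itg2.
    rewrite (_ : p i.+1 - p i = t / n.+1%:R); last by rewrite pS addrAC subrr add0r.
    set a := ip _ _; set a' := ip _ _; set a0 := ip _ _.
    rewrite !mulrDr.
    move: (intg _ _) (intg _ _) (_ * (_ * intg _ _)) (_ * (_ * intg _ _)) => *; lra.
  move=> /(_ n.+1 (leqnn _)); rewrite pn -/J.
  rewrite (_ : 2 * M * (t / n.+1%:R * J) = n.+1%:R^-1 * (2 * M * t * J)); last by ring.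
  by move: (_ * (_ * J)) => *; lra.
suff : ip (Q (z t)) (z t) - ip (Q (z 0)) (z 0) - intg `[0, t] kappa <= 0 by lra.
apply: (cvgn_le _ _ key); first exact: cvg_cst.
rewrite -[X in _ --> X](mul0r (2 * M * t * J)).
by apply: cvgM; [exact: cvgn_harmonic | exact: cvg_cst].
Qed.

End WeakH1.

(** Applied to differences of solutions and to midpoints of approximants. *)
Lemma weak_H1_lin (T c1 c2 : R) (z1 g1 z2 g2 : R -> H) (m1 m2 : R -> R) :
  weak_H1 T z1 g1 m1 -> weak_H1 T z2 g2 m2 ->
  weak_H1 T (fun x => c1 *: z1 x + c2 *: z2 x) (fun x => c1 *: g1 x + c2 *: g2 x)
    (fun x => `|c1| * m1 x + `|c2| * m2 x).
Proof.
move=> h1 h2; have [mg1 mm1 hm1 i1 e1] := h1; have [mg2 mm2 hm2 i2 e2] := h2.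
have mm : measurable_fun `[0, T] (fun x => `|c1| * m1 x + `|c2| * m2 x).
  by apply: measurable_funD; apply: measurable_funM => //; exact: measurable_cst.
have eip w : (fun x => ip (c1 *: g1 x + c2 *: g2 x) w) =
    (fun x => c1 * ip (g1 x) w + c2 * ip (g2 x) w).
  by apply/funext => x; rewrite !(bilinE hb).
split => //.
- move=> w; rewrite eip.
  by apply: measurable_funD; apply: measurable_funM => //; exact: measurable_cst.
- move=> x; apply: le_trans (ler_normD _ _) _; rewrite !normrZ.
  by apply: lerD; rewrite ler_wpM2l.
- apply: (@itg_le _ _ _ (fun x => 2 * `|c1| ^+ 2 * m1 x ^+ 2 + 2 * `|c2| ^+ 2 * m2 x ^+ 2)) => //.
  + by apply: measurable_funX.
  + by apply: itgD => //; exact: itgZ.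
  move=> x _; rewrite ger0_norm ?sqr_ge0// -subr_ge0.
  rewrite (_ : _ - _ = (`|c1| * m1 x - `|c2| * m2 x) ^+ 2) ?sqr_ge0//; ring.
move=> t /andP[t0 tT] w; rewrite eip RintegralD//; last 2 first.
- by apply: itgZ => //; exact: itgS_itvcc (lexx _) tT (weak_H1_itg_ip h1 w).
- by apply: itgZ => //; exact: itgS_itvcc (lexx _) tT (weak_H1_itg_ip h2 w).
rewrite !RintegralZl//; last 2 first.
- exact: itgS_itvcc (lexx _) tT (weak_H1_itg_ip h2 w).
- exact: itgS_itvcc (lexx _) tT (weak_H1_itg_ip h1 w).
have tt : 0 <= t <= T by rewrite t0.
by rewrite -(e1 t tt w) -(e2 t tt w) !(bilinE hb); ring.
Qed.

Lemma H1_weak (T : R) (z g : R -> H) : 0 <= T -> H1_deriv T z g -> exists g',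
  [/\ strongly_measurable g',
      {ae mu, forall x, `[0, T]%classic x -> g x = g' x},
      L2norm T g = Num.sqrt (intg `[0, T] (fun x => `|g' x| ^+ 2))
    & weak_H1 T z g' (fun x => `|g' x|)].
Proof.
move=> T0 /(H1_regular T0)[g' [mg gg [i1 i2] [_ n2] h]].
exists g'; split => //.
have lin w : scalar_linear (fun v => ip v w).
  by move=> c x y; rewrite !(bilinE hb).
have bd w v : `|ip v w| <= `|w| * `|v| by rewrite mulrC; exact: ip_abs.
split => //.
- move=> w; exact: (strongly_meas_lin _ mg (lin w) (bd w)).
- exact: strongly_meas_norm.
- by move=> t /h[e _] w; exact: (e (fun v => ip v w) _ (lin w) (bd w)).
Qed.

End H1.

(** * The implicit Euler scheme *)

Section StepFunctions.
Context (R : realType) (V : normedModType R).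
Local Notation mu := (@lebesgue_measure R).
Variables (T tau : R).
Hypothesis tau0 : 0 < tau.

Definition idx (t : R) : nat := Num.truncn (t / tau).

Lemma idx_itv t : 0 <= t -> (idx t)%:R * tau <= t < (idx t).+1%:R * tau.
Proof.
move=> t0; rewrite -ler_pdivlMr// -ltr_pdivrMr//.
by apply: truncn_itv; rewrite divr_ge0// ltW.
Qed.

Lemma idx_eq t i : 0 <= t -> i%:R * tau <= t -> t < i.+1%:R * tau -> idx t = i.
Proof.
move=> t0 h1 h2; apply: truncn_def.
by rewrite ler_pdivlMr// ltr_pdivrMr// h1.
Qed.

(** The cutoff outside [[0, T]] leaves only finitely many values. *)
Definition stepf (v : nat -> V) (t : R) : V := if 0 <= t <= T then v (idx t) else 0.

Lemma stepf_simple v : simple_fun (stepf v).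
Proof.
split.
  apply: (@sub_finite_set _ _ ((v @` `I_(idx T).+1) `|` [set 0])).
    move=> _ [t _ <-]; rewrite /stepf; case: ifP => [/andP[t0 tT]|_]; last by right.
    left; exists (idx t) => //=; rewrite ltnS; apply: le_truncn.
    by rewrite ler_wpM2r// invr_ge0 ltW.
  by rewrite finite_setU; split; [apply: finite_image; exact: finite_II | exact: finite_set1].
move=> x.
pose B i := [set t | `[0, T]%classic t] `&` `[i%:R * tau, i.+1%:R * tau[%classic.
have -> : stepf v @^-1` [set x] =
    (\bigcup_(i in [set i | v i = x]) B i) `|`
    (~` `[0, T]%classic `&` (fun=> (0 : V)) @^-1` [set x]).
  apply/seteqP; split=> t; rewrite /stepf /=.
    case: ifPn => tT h; [left | right].
      exists (idx t) => //; split; first by rewrite /= in_itv.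
      by rewrite /= in_itv /= idx_itv//; case/andP: tT.
    by split => //; rewrite in_itv /= (negbTE tT).
  move=> [[i vi [/=]]|[]]; rewrite !in_itv /=.
    move=> tT /andP[h1 h2]; rewrite tT (idx_eq _ h1 h2)//.
    by case/andP: tT.
  by move=> /negP/negbTE ->.
apply: measurableU.
  apply: bigcup_measurable => i _; apply: measurableI; exact: measurable_itv.
apply: measurableI; first by apply: measurableC; exact: measurable_itv.
have [v0|v0] := pselect (0 = x).
  by rewrite (_ : _ @^-1` _ = setT)//; apply/seteqP; split.
by rewrite (_ : _ @^-1` _ = set0)//; apply/seteqP; split.
Qed.

Lemma stepf_itg v (psi : V -> R) a b : itg `[a, b] (fun t => psi (stepf v t)).
Proof. exact: (simple_comp_itg psi a b (stepf_simple v)). Qed.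

Lemma stepf_int_cell v (psi : V -> R) a b i : 0 <= a -> i%:R * tau <= a -> a <= b ->
  b <= i.+1%:R * tau -> b <= T ->
  intg `[a, b] (fun t => psi (stepf v t)) = (b - a) * psi (v i).
Proof.
move=> a0 ia ab bi bT.
(* The right endpoint may already belong to the next cell, so it is removed first. *)
rewrite -Rintegral_itv_bndo_bndc; last first.
  apply: (@itgS _ `[a, b]) => //; last exact: stepf_itg.
  by apply: subset_itvl; rewrite bnd_simp.
transitivity (intg `[a, b[ (fun=> psi (v i))).
  apply: eq_Rintegral => t; rewrite inE /= in_itv /= => /andP[at_ tb].
  rewrite /stepf (le_trans a0 at_) (le_trans (ltW tb) bT) /=.
  by rewrite (@idx_eq _ i)// ?(le_trans a0)// ?(le_trans ia)// (lt_le_trans tb).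
rewrite Rintegral_itv_bndo_bndc; first by rewrite intg_cst// mulrC.
apply: (@itgS _ `[a, b]) => //; last exact: itg_cst.
by apply: subset_itvl; rewrite bnd_simp.
Qed.

Lemma stepf_int_grid v (psi : V -> R) j : j%:R * tau <= T ->
  intg `[0, j%:R * tau] (fun t => psi (stepf v t)) = \sum_(i < j) tau * psi (v i).
Proof.
elim: j => [_|j ih jT]; first by rewrite mul0r set_itv1 Rintegral_set1 big_ord0.
have jS : j%:R * tau <= j.+1%:R * tau by rewrite ler_wpM2r ?ler_nat// ltW.
have j0 : 0 <= j%:R * tau by rewrite mulr_ge0// ltW.
rewrite (@intg_split _ _ _ _ (j%:R * tau))//; last exact: stepf_itg.
rewrite ih ?(le_trans jS)// big_ord_recr /= (@stepf_int_cell _ _ _ _ j)//.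
by congr (_ + _ * _); rewrite -natr1; ring.
Qed.

Lemma stepf_int v (psi : V -> R) t : 0 <= t <= T ->
  intg `[0, t] (fun t => psi (stepf v t)) =
  \sum_(i < idx t) tau * psi (v i) + (t - (idx t)%:R * tau) * psi (v (idx t)).
Proof.
move=> /andP[t0 tT]; have /andP[h1 h2] := idx_itv t0.
have j0 : 0 <= (idx t)%:R * tau by rewrite mulr_ge0// ltW.
rewrite (@intg_split _ _ _ _ ((idx t)%:R * tau))//; last exact: stepf_itg.
rewrite stepf_int_grid ?(le_trans h1)// (@stepf_int_cell _ _ _ _ (idx t))//.
exact: ltW.
Qed.

End StepFunctions.

(** * A priori estimates for the scheme *)

Section Euler.
Context (R : realType) (H : completeNormedModType R) (ip : H -> H -> R).
Hypothesis hip : is_inner_product ip.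
Let hb := ip_bilin hip.
Variables (Q : H -> H) (A : H -> set H) (M gam kP kL : R) (p : H -> R).
Hypothesis hQ : bounded_linear Q.
Hypothesis M0 : 0 <= M.
Hypothesis QM : forall x, `|Q x| <= M * `|x|.
Hypothesis gam0 : 0 < gam.
Hypothesis hQlow : forall x, `|x| <= gam^-1 * `|Q x|.
Hypothesis hA : monotone_op ip A.
Hypothesis hres : forall tau h, 0 < tau -> exists y v, A y v /\ y + tau *: Q v = h.
Hypothesis hsec : forall B, exists K, forall h, dom A h -> `|h| <= B ->
  exists2 w, A h w & `|w| <= K.
Hypothesis kP0 : 0 <= kP.
Hypothesis kL0 : 0 <= kL.
Hypothesis p_ge0 : forall x, 0 <= p x.
Hypothesis p_le : forall x, p x <= kP * `|x|.
Hypothesis le_p : forall x, `|x| <= kL * p x.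
Hypothesis contr : forall tau y y' v d a w, 0 <= tau -> A y v -> A a w ->
  y + tau *: Q v = y' + d -> p (y - a) <= p (y' - a) + p d + tau * p (Q w).

Variables (T : R) (f df : R -> H) (mf : R -> R) (z0 : H).
Hypothesis T0 : 0 < T.
Hypothesis hf : weak_H1 ip T f df mf.
Hypothesis hdom : dom A (f 0 - Q z0).

(** The resolvent equation is solved for the velocity: with [h = F i.+1 - Q (z i)], the point
    [h - tau *: Q (v i)] is exactly [F i.+1 - Q (z i.+1)]. *)
Lemma euler_sequence tau (F : nat -> H) : 0 < tau -> exists z v : nat -> H,
  z 0%N = z0 /\ forall i, z i.+1 = z i + tau *: v i /\ A (F i.+1 - Q (z i.+1)) (v i).
Proof.
move=> t0.
have /choice[psi hpsi] : forall h, exists v, A (h - tau *: Q v) v.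
  by move=> h; have [y [v [Ayv <-]]] := hres h t0; exists v; rewrite addrK.
pose z := fix z i := if i is j.+1 then z j + tau *: psi (F j.+1 - Q (z j)) else z0.
exists z, (fun i => psi (F i.+1 - Q (z i))); split => // i; split => //=.
by rewrite (blinD hQ) (blinZ hQ) opprD addrA.
Qed.

Let J := intg `[0, T] (fun x => mf x ^+ 2).
Let I1 := intg `[0, T] mf.

Let mf0 x : 0 <= mf x. Proof. exact: weak_H1_ge0 hf x. Qed.

Let J0 : 0 <= J. Proof. by apply: intg_ge0 => x _; exact: sqr_ge0. Qed.

Let I0 : 0 <= I1. Proof. exact: intg_ge0. Qed.

Let sub2 s t : 0 <= s -> t <= T -> intg `[s, t] (fun x => mf x ^+ 2) <= J.
Proof.
move=> s0 tT; apply: subset_intg => //; first exact: subset_itvcc.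
by move=> x _; exact: sqr_ge0.
exact: weak_H1_itg2 hf.
Qed.

Let short s t tau : 0 <= s -> s <= t -> t <= T -> t - s <= tau ->
  intg `[s, t] mf <= Num.sqrt tau * Num.sqrt J.
Proof.
move=> s0 st tT d; have ta0 : 0 <= tau by lra.
rewrite -(@ler_pXn2r _ 2) ?nnegrE ?mulr_ge0 ?sqrtr_ge0 ?intg_ge0//.
rewrite exprMn !sqr_sqrtr//; apply: le_trans (weak_H1_CS hf s0 st tT) _.
apply: ler_pM => //; first lra; last exact: sub2.
by apply: intg_ge0 => x _; exact: sqr_ge0.
Qed.

Section Scheme.
Variables (tau : R) (z v : nat -> H).
Hypothesis tau0 : 0 < tau.
Hypothesis tauT : tau <= T.
(** Capped at [T]: at time [T] the index is [n.+1] and [euler_x] looks one node further, where [f]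
    is not controlled. *)
Let grid (i : nat) : R := Num.min (i%:R * tau) T.
Hypothesis hz0 : z 0%N = z0.
Hypothesis hz : forall i, z i.+1 = z i + tau *: v i /\
  A (f (grid i.+1) - Q (z i.+1)) (v i).
Let y i := f (grid i) - Q (z i).

Let grid0 i : 0 <= grid i.
Proof. by rewrite /grid le_min (ltW T0) andbT mulr_ge0// ltW. Qed.

Let gridT i : grid i <= T. Proof. by rewrite /grid ge_min lexx orbT. Qed.

Let gridS i : grid i <= grid i.+1.
Proof.
rewrite /grid le_min !ge_min lexx !orbT andbT.
by rewrite ler_wpM2r ?ler_nat ?orbT// ltW.
Qed.

Let grid_mono i j : (i <= j)%N -> grid i <= grid j.
Proof.
move=> /subnK <-; elim: (j - i)%N => // k ih.
by rewrite addSn; apply: le_trans ih _; exact: gridS.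
Qed.

Let grid_step i : grid i.+1 - grid i <= tau.
Proof.
have e : i.+1%:R * tau = i%:R * tau + tau by rewrite -natr1; ring.
rewrite /grid e; have := tau0; move: (i%:R * tau) => r t0.
by case: (leP (r + tau) T) => h1; case: (leP r T) => h2; lra.
Qed.

Let grid00 : grid 0%N = 0. Proof. by rewrite /grid mul0r; apply/min_idPl; exact: ltW. Qed.

Let mfI s t : 0 <= s -> t <= T -> itg `[s, t] mf.
Proof. move=> s0 tT; exact: itgS_itvcc s0 tT (weak_H1_itg_dom hf). Qed.

Let df_le i : `|f (grid i.+1) - f (grid i)| <= intg `[grid i, grid i.+1] mf.
Proof. exact: (weak_H1_incr_le hip hf). Qed.

Let y_step i : y i.+1 + tau *: Q (v i) = y i + (f (grid i.+1) - f (grid i)).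
Proof.
rewrite /y (hz i).1 (blinD hQ) (blinZ hQ).
by rewrite opprD [f _ + (_ - _)]addrA subrK [RHS]addrC addrA subrK.
Qed.

Let yA i : A (y i.+1) (v i). Proof. exact: (hz i).2. Qed.

Let y0E : y 0%N = f 0 - Q z0. Proof. by rewrite /y grid00 hz0. Qed.

Let y_dom i : dom A (y i).
Proof. by case: i => [|i]; [rewrite y0E | exists (v i); exact: yA]. Qed.

(** The contraction summed over steps. Time is counted as the number of steps times [tau], because
    the scheme keeps its full step even where the capped grid stops. *)
Lemma euler_stab i j a w : (i <= j)%N -> A a w ->
  p (y j - a) <= p (y i - a) + kP * intg `[grid i, grid j] mf + (j - i)%:R * tau * p (Q w).
Proof.
move=> /subnK <- Aaw; elim: (j - i)%N => [|k ih].
  by rewrite add0n subnn set_itv1 Rintegral_set1 mulr0 !mul0r !addr0.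
have ki : (i <= k + i)%N by exact: leq_addl.
have := contr (ltW tau0) (yA (k + i)) Aaw (y_step (k + i)).
rewrite addSn (@intg_split _ mf _ _ (grid (k + i)))//; last 2 first.
- exact: grid_mono.
- exact: mfI.
have := le_trans (p_le _) (ler_wpM2l kP0 (df_le (k + i))).
rewrite subSn// addnK; rewrite addnK in ih.
rewrite -natr1; move: ih; rewrite mulrDr.
move: (kP * intg _ _) (kP * intg _ _) (p (f _ - _)) => c1 c2 c3.
rewrite !mulrDl mul1r.
move: (_ * tau * _) (tau * _) (p (_ - a)) (p (_ - a)) (p (_ - a)) => *; lra.
Qed.

Variables (a0 w0 : H).
Hypothesis Aa0 : A a0 w0.
(** A priori radius for [y], from [euler_stab] started at step 0 with the pair [(a0, w0)]; [2 * T]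
    bounds the elapsed time with room to spare. *)
Let B := `|a0| + kL * (p (f 0 - Q z0 - a0) + kP * I1 + 2 * T * p (Q w0)).
Variable K : R.
Hypothesis hK : forall h, dom A h -> `|h| <= B -> exists2 w, A h w & `|w| <= K.

Let sub1 s t : 0 <= s -> t <= T -> intg `[s, t] mf <= I1.
Proof.
move=> s0 tT; apply: subset_intg => //; first exact: subset_itvcc.
exact: weak_H1_itg_dom hf.
Qed.

Lemma euler_bound i : i%:R * tau <= 2 * T -> `|y i| <= B.
Proof.
move=> iT; rewrite -[y i](subrK a0) addrC; apply: le_trans (ler_normD _ _) _.
rewrite lerD2l; apply: le_trans (le_p _) _; rewrite ler_wpM2l//.
have := euler_stab (leq0n i) Aa0; rewrite subn0 y0E => h; apply: le_trans h _.
rewrite -!addrA lerD2l; apply: lerD; last by rewrite ler_wpM2r.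
by rewrite ler_wpM2l// sub1.
Qed.

Let c1 := gam^-1 * (1 + kL * kP).
Let c2 := gam^-1 * kL * kP * M * `|K|.

Let c1_ge0 : 0 <= c1.
Proof. by rewrite mulr_ge0 ?addr_ge0 ?mulr_ge0 // invr_ge0 ltW. Qed.

Let c2_ge0 : 0 <= c2.
Proof. by rewrite !mulr_ge0// invr_ge0 ltW. Qed.

(** A comparison started at [y i] itself has initial distance 0, so it bounds [y i.+1 - y i]. The
    scheme expresses [tau *: Q (v i)] as the increment of [f] minus that of [y], and coercivity
    removes [Q]. *)
Lemma euler_velocity i : i%:R * tau <= 2 * T ->
  tau * `|v i| <= c1 * intg `[grid i, grid i.+1] mf + c2 * tau.
Proof.
move=> iT; have [w Aw wK] := hK (y_dom i) (euler_bound iT).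
have := euler_stab (leqnSn i) Aw; rewrite subrr subSnn mul1r.
have -> : p 0 = 0.
  apply/eqP; rewrite eq_le p_ge0 andbT.
  by apply: le_trans (p_le 0) _; rewrite normr0 mulr0.
rewrite add0r; set L := intg _ _ => hp.
have L0 : 0 <= L by exact: intg_ge0.
have hw : p (Q w) <= kP * (M * `|K|).
  apply: le_trans (p_le _) _; rewrite ler_wpM2l//.
  apply: le_trans (QM _) _; rewrite ler_wpM2l//.
  by apply: le_trans wK _; exact: ler_norm.
have hy : `|y i.+1 - y i| <= kL * (kP * L + tau * (kP * (M * `|K|))).
  apply: le_trans (le_p _) _; rewrite ler_wpM2l//; apply: le_trans hp _.
  by rewrite lerD2l ler_wpM2l// ltW.
have -> : tau * `|v i| = `|tau *: v i| by rewrite normrZ gtr0_norm.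
apply: le_trans (hQlow _) _; rewrite (blinZ hQ).
have -> : tau *: Q (v i) = (f (grid i.+1) - f (grid i)) - (y i.+1 - y i).
  apply: (addrI (y i.+1)); rewrite y_step; move: (f _ - f _) => d.
  by rewrite opprB addrCA [y i.+1 + _]addrC subrK addrC.
have := le_trans (ler_normB _ _) (lerD (df_le i) hy); rewrite -/L => h.
apply: le_trans (ler_wpM2l _ h) _; first by rewrite invr_ge0 ltW.
rewrite /c1 /c2 le_eqVlt; apply/orP; left; apply/eqP; ring.
Qed.

Lemma euler_velocity2 i : i%:R * tau <= 2 * T ->
  tau * `|v i| ^+ 2 <= 2 * c1 ^+ 2 * intg `[grid i, grid i.+1] (fun x => mf x ^+ 2)
    + 2 * c2 ^+ 2 * tau.
Proof.
move=> iT; rewrite -(ler_pM2l tau0).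
set L2 := intg _ _; set L := intg `[grid i, grid i.+1] mf.
have L0 : 0 <= L by exact: intg_ge0.
have L20 : 0 <= L2 by apply: intg_ge0 => x _; exact: sqr_ge0.
have hL : L ^+ 2 <= tau * L2.
  apply: le_trans (weak_H1_CS hf (grid0 i) (gridS i) (gridT _)) _.
  by rewrite ler_wpM2r.
have h := euler_velocity iT; rewrite -/L in h.
have h2 : (tau * `|v i|) ^+ 2 <= (c1 * L + c2 * tau) ^+ 2.
  have p1 : 0 <= tau * `|v i| by rewrite mulr_ge0// ltW.
  by rewrite ler_pXn2r ?nnegrE// (le_trans p1 h).
rewrite (_ : tau * (tau * _) = (tau * `|v i|) ^+ 2); last by ring.
apply: le_trans h2 _.
apply: (@le_trans _ _ (2 * c1 ^+ 2 * L ^+ 2 + 2 * c2 ^+ 2 * tau ^+ 2)).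
  rewrite -subr_ge0 (_ : _ - _ = (c1 * L - c2 * tau) ^+ 2) ?sqr_ge0//; ring.
rewrite mulrDr (_ : tau * (2 * c2 ^+ 2 * tau) = 2 * c2 ^+ 2 * tau ^+ 2); last by ring.
rewrite lerD2r (_ : tau * (2 * c1 ^+ 2 * L2) = 2 * c1 ^+ 2 * (tau * L2)); last by ring.
by rewrite ler_wpM2l// mulr_ge0// sqr_ge0.
Qed.

Variable n : nat.
Hypothesis tauE : tau = T / n.+1%:R.
Let V2 := 2 * c1 ^+ 2 * J + 2 * c2 ^+ 2 * T.

Let nT : n.+1%:R * tau = T.
Proof. by rewrite tauE mulrC divfK// gt_eqF. Qed.

Let idx_le t : 0 <= t <= T -> (idx tau t <= n.+1)%N.
Proof.
move=> /andP[t0 tT]; rewrite -(@ler_nat R) -(ler_pM2r tau0) nT.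
by have /andP[h _] := idx_itv tau0 t0; exact: le_trans h tT.
Qed.

Let le2T i : (i <= n.+1)%N -> i%:R * tau <= 2 * T.
Proof.
move=> h; apply: (@le_trans _ _ (n.+1%:R * tau)).
  by rewrite ler_wpM2r ?ler_nat// ltW.
by rewrite nT ler_peMl ?ler1n// ltW.
Qed.

Definition euler_z t := z (idx tau t) + (t - (idx tau t)%:R * tau) *: v (idx tau t).
Definition euler_v := stepf T tau v.
(** The value at the right node, so that the inclusion with [euler_v] is exact; the price is the
    defect estimated in [euler_consist]. *)
Definition euler_x t := y (idx tau t).+1.

Lemma euler_v2 : intg `[0, T] (fun t => `|euler_v t| ^+ 2) <= V2.
Proof.
have hT : n.+1%:R * tau <= T by rewrite nT.
have := stepf_int_grid tau0 v (fun x => `|x| ^+ 2) hT; rewrite nT => ->.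
have key j : (j <= n.+1)%N -> \sum_(i < j) tau * `|v i| ^+ 2 <=
    2 * c1 ^+ 2 * intg `[0, grid j] (fun x => mf x ^+ 2) + 2 * c2 ^+ 2 * (j%:R * tau).
  elim: j => [_|j ih jn].
    by rewrite big_ord0 grid00 set_itv1 Rintegral_set1 mul0r !mulr0 addr0.
  rewrite big_ord_recr /=.
  rewrite (@intg_split _ (fun x => mf x ^+ 2) _ _ (grid j))//; last first.
    exact: itgS_itvcc (lexx _) (gridT _) (weak_H1_itg2 hf).
  have := euler_velocity2 (le2T (ltnW jn)); have := ih (ltnW jn).
  rewrite -[j.+1%:R]natr1 (mulrDl j%:R) mul1r !(mulrDr (2 * _ ^+ 2)).
  move: (\sum_(_ < _) _) (_ * intg _ _) (_ * intg _ _) (_ * (j%:R * _)) => *; lra.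
apply: le_trans (key n.+1 (leqnn _)) _.
rewrite nT lerD2r; apply: ler_wpM2l; first by rewrite mulr_ge0// sqr_ge0.
exact: sub2.
Qed.

Lemma euler_zsum j w : ip (z j - z0) w = \sum_(i < j) tau * ip (v i) w.
Proof.
elim: j => [|j ih]; first by rewrite big_ord0 hz0 subrr (bilin0l hb).
by rewrite big_ord_recr /= -ih (hz j).1 !(bilinE hb); ring.
Qed.

Lemma euler_z00 : euler_z 0 = z0.
Proof.
by rewrite /euler_z (@idx_eq _ tau tau0 0 0%N) ?mul0r ?mul1r// subrr scale0r addr0.
Qed.

Lemma euler_weak : weak_H1 ip T euler_z euler_v (fun t => `|euler_v t|).
Proof.
have hs := stepf_simple T tau0 v.
split => //.
- by move=> w; apply: (simple_comp_meas (fun u => ip u w)).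
- by apply: (simple_comp_meas (fun u : H => `|u|)).
- exact: (stepf_itg T tau0 v (fun u => `|u| ^+ 2)).
move=> t tT w; rewrite (stepf_int tau0 v (fun u => ip u w) tT) -euler_zsum.
by rewrite euler_z00 /euler_z !(bilinE hb); ring.
Qed.

Lemma euler_incl t : 0 <= t <= T -> A (euler_x t) (euler_v t).
Proof. by move=> tT; rewrite /euler_v /stepf tT; exact: yA. Qed.

Let V2_ge0 : 0 <= V2.
Proof.
have h (c : R) : 0 <= 2 * c ^+ 2 by rewrite mulr_ge0// sqr_ge0.
by apply: addr_ge0; apply: mulr_ge0; rewrite ?h// ltW.
Qed.

(** Within a cell [f] moves by at most [sqrt tau sqrt J] and [z] by [tau |v i| <= sqrt tau sqrt V2],
    the latter from the square bound on a single velocity. *)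
Lemma euler_consist t : 0 <= t <= T ->
  `|f t - Q (euler_z t) - euler_x t| <= Num.sqrt tau * (Num.sqrt J + M * Num.sqrt V2).
Proof.
move=> tT; have /andP[t0 tT'] := tT; have /andP[h1 h2] := idx_itv tau0 t0.
set i := idx tau t in h1 h2 *; have iN : (i <= n.+1)%N by exact: idx_le.
have tg : t <= grid i.+1 by rewrite /grid le_min (ltW h2).
have gt : grid i.+1 - t <= tau.
  apply: le_trans _ (grid_step i); rewrite lerD2l lerN2.
  by rewrite /grid ge_min h1.
have tv : tau * `|v i| <= Num.sqrt tau * Num.sqrt V2.
  rewrite -(@ler_pXn2r _ 2) ?nnegrE ?mulr_ge0 ?sqrtr_ge0 ?(ltW tau0)//.
  rewrite !exprMn !sqr_sqrtr ?(ltW tau0)// expr2 -mulrA ler_wpM2l ?(ltW tau0)//.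
  apply: le_trans (euler_velocity2 (le2T iN)) _.
  by apply: lerD; apply: ler_wpM2l; rewrite ?sub2// mulr_ge0// sqr_ge0.
have -> : f t - Q (euler_z t) - euler_x t =
    (f t - f (grid i.+1)) + Q (z i.+1 - euler_z t).
  rewrite /euler_x -/i /y opprB (blinB hQ) addrACA [RHS]addrACA; congr (_ + _).
  by rewrite addrC.
apply: le_trans (ler_normD _ _) _; rewrite mulrDr; apply: lerD.
  by rewrite distrC; apply: le_trans (weak_H1_incr_le hip hf t0 tg (gridT _)) _; exact: short.
apply: le_trans (QM _) _; rewrite mulrCA ler_wpM2l//.
have -> : z i.+1 - euler_z t = (tau - (t - i%:R * tau)) *: v i.
  by rewrite (hz i).1 /euler_z -/i opprD addrACA subrr add0r -scalerBl.
rewrite normrZ; apply: le_trans tv; rewrite ler_wpM2r// ger0_norm; first by lra.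
by move: h2; rewrite -natr1 mulrDl mul1r; lra.
Qed.

(** Passing from nodes to times costs one cell, since the node after [t] lies at most [tau] beyond
    it. *)
Lemma euler_stab_cont s t a w : 0 <= s -> s <= t -> t <= T -> A a w ->
  p (euler_x t - a) <= p (euler_x s - a) + kP * intg `[s, t] mf + (t - s) * p (Q w)
    + (kP * (Num.sqrt tau * Num.sqrt J) + tau * p (Q w)).
Proof.
move=> s0 st tT Aaw; have t0 := le_trans s0 st.
have /andP[i1 i2] := idx_itv tau0 s0; have /andP[j1 j2] := idx_itv tau0 t0.
set i := idx tau s in i1 i2 *; set j := idx tau t in j1 j2 *.
have ij : (i <= j)%N.
  rewrite -ltnS -(@ltr_nat R) -(ltr_pM2r tau0).
  by apply: le_lt_trans i1 _; apply: le_lt_trans st _.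
have sg : s <= grid i.+1 by rewrite /grid le_min (ltW i2) (le_trans st tT).
have tg : t <= grid j.+1 by rewrite /grid le_min (ltW j2).
have gt : grid j.+1 - t <= tau.
  apply: le_trans _ (grid_step j); rewrite lerD2l lerN2.
  by rewrite /grid ge_min j1.
have ijS : (i.+1 <= j.+1)%N by [].
have := euler_stab ijS Aaw; rewrite subSS /euler_x -/i -/j => h.
apply: le_trans h _.
have hI : intg `[grid i.+1, grid j.+1] mf <= intg `[s, t] mf + Num.sqrt tau * Num.sqrt J.
  apply: (@le_trans _ _ (intg `[s, grid j.+1] mf)).
    apply: subset_intg => //; first exact: subset_itvcc.
    exact: mfI.
  rewrite (@intg_split _ mf _ _ t)//; last exact: mfI.
  by rewrite lerD2l short.
have hj : (j - i)%:R * tau <= (t - s) + tau.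
  rewrite natrB//; move: i2; rewrite -natr1 !mulrBl mulrDl mul1r; lra.
have e1 := ler_wpM2l kP0 hI; have e2 := ler_wpM2r (p_ge0 (Q w)) hj.
move: e1 e2; rewrite mulrDr mulrDl.
move: (kP * _) (kP * _) (kP * _) (_ * p (Q w)) (_ * p (Q w)) (_ * p (Q w)) (p (_ - _)) => *.
lra.
Qed.

End Scheme.

Lemma euler_approx : exists V2 D : R, exists Z V X : nat -> R -> H,
  [/\ 0 <= V2, 0 <= D & forall n,
    [/\ simple_fun (V n), weak_H1 ip T (Z n) (V n) (fun t => `|V n t|),
        Z n 0 = z0 & intg `[0, T] (fun t => `|V n t| ^+ 2) <= V2] /\
    [/\ forall t, 0 <= t <= T -> A (X n t) (V n t),
        forall t, 0 <= t <= T ->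
          `|f t - Q (Z n t) - X n t| <= D * Num.sqrt (T / n.+1%:R)
      & forall s t a w, 0 <= s -> s <= t -> t <= T -> A a w ->
          p (X n t - a) <= p (X n s - a) + kP * intg `[s, t] mf + (t - s) * p (Q w)
            + D * Num.sqrt (T / n.+1%:R) * (1 + p (Q w))]].
Proof.
have [w0 Aw0] := hdom; set a0 := f 0 - Q z0 in Aw0.
have [K hK] := hsec (`|a0| + kL * (p (f 0 - Q z0 - a0) + kP * I1 + 2 * T * p (Q w0))).
pose tau (n : nat) := T / n.+1%:R.
have tau0 n : 0 < tau n by rewrite divr_gt0.
have tauT n : tau n <= T by rewrite ler_pdivrMr// ler_peMr ?ler1n// ltW.
have /choice[zv hzv] : forall n, exists zv : (nat -> H) * (nat -> H),
    zv.1 0%N = z0 /\ forall i, zv.1 i.+1 = zv.1 i + tau n *: zv.2 i /\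
      A (f (Num.min (i.+1%:R * tau n) T) - Q (zv.1 i.+1)) (zv.2 i).
  move=> n.
  have [z [v h]] := euler_sequence (fun i => f (Num.min (i%:R * tau n) T)) (tau0 n).
  by exists (z, v).
pose c1 := gam^-1 * (1 + kL * kP); pose c2 := gam^-1 * kL * kP * M * `|K|.
pose V2 := 2 * c1 ^+ 2 * J + 2 * c2 ^+ 2 * T.
have V20 : 0 <= V2.
  have h (c : R) : 0 <= 2 * c ^+ 2 by rewrite mulr_ge0// sqr_ge0.
  by apply: addr_ge0; apply: mulr_ge0; rewrite ?h// ltW.
(* The summands cover the consistency defect, the overshoot by one cell, and
   [tau <= sqrt T sqrt tau]. *)
pose D := (Num.sqrt J + M * Num.sqrt V2) + kP * Num.sqrt J + Num.sqrt T.
have MV : 0 <= M * Num.sqrt V2 by rewrite mulr_ge0// sqrtr_ge0.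
have kJ : 0 <= kP * Num.sqrt J by rewrite mulr_ge0// sqrtr_ge0.
have [sJ sT] : 0 <= Num.sqrt J /\ 0 <= Num.sqrt T by rewrite !sqrtr_ge0.
have D0 : 0 <= D by rewrite /D; lra.
exists V2, D, (fun n => euler_z (tau n) (zv n).1 (zv n).2),
  (fun n => euler_v (tau n) (zv n).2), (fun n => euler_x (tau n) (zv n).1).
split => // n; have [hz0 hz] := hzv n.
have rt0 : 0 <= Num.sqrt (tau n) by exact: sqrtr_ge0.
split; split.
- exact: stepf_simple.
- exact: euler_weak.
- exact: euler_z00.
- exact: (euler_v2 (tau0 n) hz0 hz Aw0 hK).
- by move=> t tT; apply: euler_incl.
- move=> t tT; apply: le_trans (euler_consist (tau0 n) (tauT n) hz0 hz Aw0 hK erefl tT) _.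
  by rewrite -/c1 -/c2 -/V2 mulrC ler_wpM2r// /D -addrA lerDl addr_ge0.
- move=> s t a w s0 st tT Aaw.
  apply: le_trans (euler_stab_cont (tau0 n) hz s0 st tT Aaw) _.
  rewrite lerD2l mulrDr mulr1; apply: lerD.
    rewrite mulrCA mulrC ler_wpM2r// /D; lra.
  rewrite ler_wpM2r// -{1}[tau n]sqr_sqrtr ?(ltW (tau0 n))// expr2.
  rewrite ler_wpM2r//; apply: le_trans (_ : Num.sqrt T <= _); first exact: ler_wsqrtr.
  by rewrite /D; lra.
Qed.

End Euler.

(** * Passage to the limit *)

Section Series.
Context (R : realType).
Local Notation mu := (@lebesgue_measure R).

Lemma sum_half_pow (n : nat) : \sum_(k < n) (2^-1 : R) ^+ k <= 2.
Proof.
suff -> : \sum_(k < n) (2^-1 : R) ^+ k = 2 - 2 * 2^-1 ^+ n.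
  by rewrite gerBl mulr_ge0// exprn_ge0.
elim: n => [|n ih]; first by rewrite big_ord0 expr0; lra.
by rewrite big_ord_recr /= ih exprS; field.
Qed.

Lemma half_pow_small (e : R) : 0 < e -> exists k, forall j, (k <= j)%N -> (2^-1 : R) ^+ j <= e.
Proof.
move=> e0.
have h : (fun n => (2^-1 : R) ^+ n) @ \oo --> (0 : R).
  by apply: cvg_expr; rewrite ger0_norm; lra.
have [N hN] := (cvgn_distP _ _).1 h e e0.
exists N => j Nj; have := hN j Nj; rewrite subr0 ger0_norm// exprn_ge0//; lra.
Qed.

(** By monotone convergence the sum of the series has integral at most [2 c], hence is finite almost
    everywhere. *)
Lemma ae_bounded_series (D : set R) (h : nat -> R -> R) (c : R) :
  measurable D -> (forall k, itg D (h k)) -> (forall k x, 0 <= h k x) ->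
  (forall k, intg D (h k) <= c * 2^-1 ^+ k) ->
  {ae mu, forall x, D x -> exists B, forall n, \sum_(k < n) h k x <= B}.
Proof.
move=> mD ih h0 hb.
have mh k : measurable_fun D (fun x => (h k x)%:E).
  by apply/measurable_EFinP; exact: itg_meas.
have E0 k x : D x -> (0 <= (h k x)%:E)%E by move=> _; rewrite lee_fin.
have c0 : 0 <= c.
  by have := hb 0%N; rewrite expr0 mulr1; apply: le_trans; exact: intg_ge0.
pose S x := (\sum_(0 <= k <oo) (h k x)%:E)%E.
have S0 x : (0 <= S x)%E by apply: nneseries_ge0 => k _ _; rewrite lee_fin.
have mS : measurable_fun D S.
  by apply: ge0_emeasurable_sum => [k x Dx _|k _]; [rewrite lee_fin | exact: mh].
have iS : (\int[mu]_(x in D) S x <= (2 * c)%:E)%E.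
  rewrite (@integral_nneseries _ _ _ mu D mD (fun k x => (h k x)%:E) mh E0).
  apply: lime_le; first by apply: is_cvg_nneseries => k _ _; apply: integral_ge0 => x Dx; exact: E0.
  apply: nearW => n; rewrite big_mkord.
  apply: (@le_trans _ _ (\sum_(k < n) (c * 2^-1 ^+ k)%:E)%E).
    apply: lee_sum => k _; rewrite -[leLHS]fineK ?lee_fin ?hb//.
    by apply: integrable_fin_num => //; exact: ih.
  rewrite sumEFin lee_fin -mulr_sumr mulrC ler_wpM2r// sum_half_pow//.
have intS : mu.-integrable D S.
  apply/integrableP; split => //.
  apply: le_lt_trans (ltry (2 * c)); apply: le_trans iS.
  rewrite le_eqVlt; apply/orP; left; apply/eqP.
  by apply: eq_integral => x _; rewrite gee0_abs.
apply: (@ae_mono _ (fun x => D x -> S x \is a fin_num)); last first.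
  have [N [mN N0 hN]] := @integrable_ae _ _ _ mu D mD S intS.
  by exists N; split.
move=> x hx Dx.
exists (fine (S x)) => n; rewrite -lee_fin fineK ?hx// -sumEFin.
rewrite -(big_mkord xpredT (fun k => (h k x)%:E)).
by apply: nneseries_lim_ge => k _; rewrite lee_fin.
Qed.

Lemma bounded_series_tail (a : nat -> R) (B : R) : (forall k, 0 <= a k) ->
  (forall n, \sum_(k < n) a k <= B) ->
  forall e, 0 < e -> exists N, forall n m, (N <= n)%N -> (n <= m)%N ->
    \sum_(n <= k < m) a k <= e.
Proof.
move=> a0 hB e e0.
pose s n := \sum_(k < n) a k.
have supS : has_sup (range s).
  by split; [exists (s 0%N), 0%N | exists B => _ [n _ <-]; exact: hB].
have [_ [N _ <-] hN] := sup_adherent e0 supS.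
have s_le n : s n <= sup (range s) by apply: ub_le_sup; [exact: supS.2 | exists n].
exists N => n m Nn nm.
have sE k l : (k <= l)%N -> s l = s k + \sum_(k <= i < l) a i.
  by move=> kl; rewrite /s -!(big_mkord xpredT a) (big_cat_nat (leq0n k) kl).
have : s N <= s n by rewrite (sE N n)// lerDl sumr_ge0.
have := s_le m; rewrite (sE n m)//.
by move: hN; rewrite /=; move: (sup _) (s N) (s n) (\sum_(_ <= _ < _) _) => *; lra.
Qed.

Lemma bounded_series_cauchy (V : completeNormedModType R) (u : nat -> V) (a : nat -> R)
    (B : R) : (forall k, `|u k - u k.+1| <= a k) -> (forall n, \sum_(k < n) a k <= B) ->
  exists l : V, u @ \oo --> l.
Proof.
move=> ua hB; apply: cauchy_cvgn => e e0.
have a0 k : 0 <= a k by apply: le_trans (ua k).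
have e2 : 0 < e / 2 by lra.
have [N hN] := bounded_series_tail a0 hB e2.
have key n m : (n <= m)%N -> `|u n - u m| <= \sum_(n <= k < m) a k.
  elim: m => [|m ih]; first by rewrite leqn0 => /eqP ->; rewrite subrr normr0 sumr_ge0.
  rewrite leq_eqVlt => /predU1P[->|nm]; first by rewrite subrr normr0 sumr_ge0.
  rewrite big_nat_recr//=; apply: le_trans (lerD (ih nm) (ua m)).
  by rewrite -{1}[u n](subrK (u m)) -addrA; exact: ler_normD.
exists N => n m Nn Nm.
have h k : (N <= k)%N -> `|u N - u k| <= e / 2.
  by move=> Nk; apply: le_trans (key _ _ Nk) _; exact: hN.
rewrite -(subrKA (u N)); apply: le_trans (ler_normD _ _) _.
rewrite (distrC (u n)); by have := h n Nn; have := h m Nm; lra.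
Qed.

End Series.

Lemma sqrt_cvg0 (R : realType) (u : nat -> R) : (forall n, 0 <= u n) ->
  u @ \oo --> (0 : R) -> (fun n => Num.sqrt (u n)) @ \oo --> (0 : R).
Proof.
move=> u0 hu; apply/cvgn_distP => e e0.
have [N hN] := (cvgn_distP _ _).1 hu _ (exprn_gt0 2 e0).
exists N => n Nn; rewrite subr0 ger0_norm ?sqrtr_ge0//.
rewrite -(@ler_pXn2r _ 2) ?nnegrE ?sqrtr_ge0 ?(ltW e0)// sqr_sqrtr//.
by have := hN n Nn; rewrite subr0 ger0_norm.
Qed.

Lemma step_cvg0 (R : realType) (T : R) : 0 <= T ->
  (fun n => Num.sqrt (T / n.+1%:R)) @ \oo --> (0 : R).
Proof.
move=> T0; apply: sqrt_cvg0 => [n|]; first by rewrite divr_ge0.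
rewrite -[X in _ --> X](mulr0 T); apply: cvgM; first exact: cvg_cst.
exact: cvgn_harmonic.
Qed.

(** * Uniform convergence of the schemes *)

Section Limit.
Context (R : realType) (H : completeNormedModType R) (ip : H -> H -> R).
Local Notation mu := (@lebesgue_measure R).
Hypothesis hip : is_inner_product ip.
Let hb := ip_bilin hip.
Variables (Q : H -> H) (M gam : R).
Hypothesis hQ : bounded_linear Q.
Hypothesis hQsa : forall h k, ip (Q h) k = ip h (Q k).
Hypothesis M0 : 0 <= M.
Hypothesis QM : forall x, `|Q x| <= M * `|x|.
Hypothesis gam0 : 0 < gam.
Hypothesis hQco : forall h, gam * `|h| ^+ 2 <= ip (Q h) h.
Variable T : R.
Hypothesis T0 : 0 < T.

(** The energy inequality for a difference starting at 0; it serves both the Cauchy estimate and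
    uniqueness. *)
Lemma weak_H1_compare z1 g1 m1 z2 g2 m2 kappa :
  weak_H1 ip T z1 g1 m1 -> weak_H1 ip T z2 g2 m2 -> z1 0 = z2 0 ->
  itg `[0, T] kappa ->
  {ae mu, forall x, `[0, T]%classic x ->
    2 * ip (Q (z1 x - z2 x)) (g1 x - g2 x) <= kappa x} ->
  forall t, 0 <= t <= T -> gam * `|z1 t - z2 t| ^+ 2 <= intg `[0, t] kappa.
Proof.
move=> h1 h2 e0 ik hk t tT.
have hd := weak_H1_lin hip 1 (-1) h1 h2.
have sE (u v : H) : 1 *: u + (-1) *: v = u - v by rewrite scale1r scaleN1r.
have hk' : {ae mu, forall x, `[0, T]%classic x ->
    2 * ip (Q (1 *: z1 x + -1 *: z2 x)) (1 *: g1 x + -1 *: g2 x) <= kappa x}.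
  by apply: ae_mono hk => x; rewrite !sE.
have := energy_ineq hip hd hQ hQsa M0 QM ik hk' tT.
rewrite !sE e0 subrr (bilin0r hb) add0r; apply: le_trans; exact: hQco.
Qed.

Lemma intg_abs_le (g : R -> R) : (forall x, 0 <= g x) -> itg `[0, T] g ->
  itg `[0, T] (fun x => g x ^+ 2) ->
  intg `[0, T] g <= T + intg `[0, T] (fun x => g x ^+ 2).
Proof.
move=> g0 ig ig2.
apply: (@le_trans _ _ (intg `[0, T] (fun x => 1 + g x ^+ 2))).
  apply: le_intg => //; first by apply: itgD => //; exact: itg_cst.
  by move=> x _; have := sqr_ge0 (g x - 1); have := sqr_ge0 (g x); rewrite sqrrB expr1n; lra.
rewrite RintegralD//; last exact: itg_cst.
by rewrite intg_cst ?(ltW T0)// mul1r subr0.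
Qed.

Variables (A : H -> set H) (f : R -> H) (z0 : H).
Hypothesis hA : maximal_monotone ip A.

Section Approximation.
Variables (V2 D : R) (Z V X : nat -> R -> H).
Hypothesis V20 : 0 <= V2.
Hypothesis D0 : 0 <= D.
Let rt n := Num.sqrt (T / n.+1%:R).
Hypothesis ZV : forall n, weak_H1 ip T (Z n) (V n) (fun t => `|V n t|).
Hypothesis Z0 : forall n, Z n 0 = z0.
Hypothesis VV2 : forall n, intg `[0, T] (fun t => `|V n t| ^+ 2) <= V2.
Hypothesis XV : forall n t, 0 <= t <= T -> A (X n t) (V n t).
Hypothesis XZ : forall n t, 0 <= t <= T -> `|f t - Q (Z n t) - X n t| <= D * rt n.

Let rt_ge0 n : 0 <= rt n. Proof. exact: sqrtr_ge0. Qed.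

Let rt_cvg0 : rt @ \oo --> (0 : R).
Proof. exact: step_cvg0 (ltW T0). Qed.

Let Kc := gam^-1 * (4 * D * (T + V2)).

Let Kc_ge0 : 0 <= Kc.
Proof. by rewrite mulr_ge0 ?invr_ge0 ?(ltW gam0)// !mulr_ge0// addr_ge0// ltW. Qed.

(** [Q (Z n - Z m)] is a difference of consistency defects minus [X n - X m]. Paired with
    [V n - V m], the latter has a favourable sign by monotonicity, and the defects are small against
    velocities bounded in L^1. *)
Lemma approx_cauchy n m t : 0 <= t <= T ->
  `|Z n t - Z m t| ^+ 2 <= Kc * (rt n + rt m).
Proof.
move=> tT.
have iV k : itg `[0, T] (fun x => `|V k x|) by exact: weak_H1_itg_dom (ZV k).
have V1 k : intg `[0, T] (fun x => `|V k x|) <= T + V2.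
  have h := intg_abs_le (fun x => normr_ge0 (V k x)) (iV k) (weak_H1_itg2 (ZV k)).
  by apply: le_trans h _; rewrite lerD2l.
pose e := D * rt n + D * rt m.
have e0 : 0 <= e by rewrite addr_ge0 ?mulr_ge0.
pose kappa x := (2 * e) * (`|V n x| + `|V m x|).
have ik : itg `[0, T] kappa by apply: itgZ => //; exact: itgD.
have hk : {ae mu, forall x, `[0, T]%classic x ->
    2 * ip (Q (Z n x - Z m x)) (V n x - V m x) <= kappa x}.
  apply: ae_all => x; rewrite /= in_itv /= => xT.
  have mon := hA.1 _ _ _ _ (XV n xT) (XV m xT).
  pose en := f x - Q (Z n x) - X n x; pose em := f x - Q (Z m x) - X m x.
  have eQ w : ip (Q (Z n x - Z m x)) w = ip (em - en) w - ip (X n x - X m x) w.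
    by rewrite /en /em (blinB hQ) !(bilinE hb); ring.
  rewrite eQ /kappa -mulrA ler_pM2l// (bilinC hb (_ - X m x)).
  apply: (@le_trans _ _ (ip (em - en) (V n x - V m x))); first by rewrite gerBl.
  apply: le_trans (ip_le hip _ _) _; apply: ler_pM => //; last exact: ler_normB.
  apply: le_trans (ler_normB _ _) _; rewrite /e addrC.
  by apply: lerD; exact: XZ.
have := weak_H1_compare (ZV n) (ZV m) _ ik hk tT; rewrite !Z0 => /(_ erefl) h.
have /andP[t0 tT'] := tT.
have k0 x : 0 <= kappa x by apply: mulr_ge0; [exact: mulr_ge0 | exact: addr_ge0].
have h2 : intg `[0, t] kappa <= intg `[0, T] kappa.
  by apply: subset_intg => //; exact: subset_itvcc.
have h3 : intg `[0, T] kappa <= (2 * e) * (2 * (T + V2)).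
  rewrite RintegralZl//; last exact: itgD.
  rewrite RintegralD; [|by []|exact: iV|exact: iV].
  apply: ler_wpM2l; first by rewrite mulr_ge0.
  by have := V1 n; have := V1 m; lra.
have := le_trans h (le_trans h2 h3).
rewrite -ler_pdivlMl// => h4; apply: le_trans h4 _.
by rewrite /Kc /e le_eqVlt; apply/orP; left; apply/eqP; ring.
Qed.

Lemma approx_limit : exists z : R -> H,
  (forall n t, 0 <= t <= T -> `|Z n t - z t| ^+ 2 <= Kc * rt n) /\ z 0 = z0.
Proof.
have /choice[z hz] : forall t, exists l : H, 0 <= t <= T -> (fun n => Z n t) @ \oo --> l.
  move=> t; have [tT|tT] := boolP (0 <= t <= T); last by exists 0.
  suff [l hl] : exists l : H, (fun n => Z n t) @ \oo --> l by exists l.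
  apply: cauchy_cvgn => e e0.
  have e2 : 0 < e ^+ 2 / (2 * (Kc + 1)).
    by rewrite divr_gt0 ?exprn_gt0// mulr_gt0// ltr_wpDl.
  have [N hN] := (cvgn_distP _ _).1 rt_cvg0 _ e2.
  exists N => n m Nn Nm.
  rewrite -(@ler_pXn2r _ 2) ?nnegrE ?(ltW e0)//.
  apply: le_trans (approx_cauchy n m tT) _.
  have := hN n Nn; have := hN m Nm; rewrite !subr0 !ger0_norm// => h1 h2.
  have K1 : 0 < Kc + 1 by rewrite ltr_wpDl.
  apply: (@le_trans _ _ ((Kc + 1) * (e ^+ 2 / (Kc + 1)))); last first.
    by rewrite mulrC divfK// gt_eqF.
  apply: ler_pM => //; rewrite ?addr_ge0 ?lerDl//.
  have -> : e ^+ 2 / (Kc + 1) = 2 * (e ^+ 2 / (2 * (Kc + 1))).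
    by field; rewrite gt_eqF.
  lra.
exists z; split.
  move=> n t tT.
  have := hz t tT => hzt.
  have l1 : (fun m => `|Z n t - Z m t| ^+ 2) @ \oo --> `|Z n t - z t| ^+ 2.
    rewrite expr2; under eq_fun do rewrite expr2.
    have hn : (fun m => `|Z n t - Z m t|) @ \oo --> `|Z n t - z t|.
      by apply: cvg_norm; apply: cvgB => //; exact: cvg_cst.
    exact: cvgM.
  have l2 : (fun m => Kc * (rt n + rt m)) @ \oo --> Kc * rt n.
    rewrite -{2}[rt n]addr0; apply: cvgM; first exact: cvg_cst.
    by apply: cvgD => //; exact: cvg_cst.
  by apply: (cvgn_le l1 l2) => m; exact: approx_cauchy.
have T00 : 0 <= (0 : R) <= T by rewrite lexx ltW.
have := hz 0 T00; rewrite (_ : (fun n => Z n 0) = fun=> z0); last by apply/funext.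
by move=> hl; apply: (cvg_unique _ hl) => //; exact: cvg_cst.
Qed.

End Approximation.
End Limit.

(** * Strong limits of the velocities *)

Section MazurLimit.
Context (R : realType) (H : completeNormedModType R) (ip : H -> H -> R).
Local Notation mu := (@lebesgue_measure R).
Hypothesis hip : is_inner_product ip.
Let hb := ip_bilin hip.
Variables (T : R) (A : H -> set H) (z y : R -> H) (V2 : R).
Hypothesis T0 : 0 < T.
Hypothesis hA : maximal_monotone ip A.

(* A triple (zeta, eta, m) of an approximate solution, its derivative and a
   bound of the latter. *)
Let triple : Type := ((R -> H) * (R -> H) * (R -> R))%type.

(** A midpoint-stable set standing in for tail convex combinations, which are never formed.
    Monotonicity is tested against the common limit [y] with tolerance [2^-n]. The tolerance uses
    the separate bound [e.2], which averages exactly, whereas the norm of an average may be smaller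
    than the average of the norms. *)
Definition approximant (n : nat) (e : triple) :=
  [/\ simple_fun e.1.2, weak_H1 ip T e.1.1 e.1.2 e.2, e.1.1 0 = z 0
    & intg `[0, T] (fun x => e.2 x ^+ 2) <= V2] /\
  forall t, 0 <= t <= T -> `|e.1.1 t - z t| <= 2^-1 ^+ n /\
    forall a w, A a w -> - (2^-1 ^+ n * (e.2 t + `|w|)) <= ip (e.1.2 t - w) (y t - a).

Hypothesis approximable : forall n, exists e, approximant n e.

Let mid (e e' : triple) : triple :=
  (fun x => 2^-1 *: e.1.1 x + 2^-1 *: e'.1.1 x,
   fun x => 2^-1 *: e.1.2 x + 2^-1 *: e'.1.2 x,
   fun x => `|2^-1| * e.2 x + `|2^-1| * e'.2 x).

Let half_norm : `|2^-1| = 2^-1 :> R. Proof. by rewrite ger0_norm. Qed.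

Let half_pow_ge0 n : 0 <= (2^-1 : R) ^+ n. Proof. by rewrite exprn_ge0. Qed.

Lemma approximant_mid n e e' :
  approximant n e -> approximant n e' -> approximant n (mid e e').
Proof.
move=> [[s1 w1 i1 v1] h1] [[s2 w2 i2 v2] h2]; split.
  split.
  - exact: (simple_op (fun u v : H => 2^-1 *: u + 2^-1 *: v) s1 s2).
  - exact: weak_H1_lin.
  - by rewrite /= i1 i2 -scalerDl (_ : 2^-1 + 2^-1 = 1 :> R) ?scale1r//; lra.
  - have q1 := weak_H1_itg2 w1; have q2 := weak_H1_itg2 w2.
    apply: (@le_trans _ _ (intg `[0, T]
        (fun x => 2^-1 * e.2 x ^+ 2 + 2^-1 * e'.2 x ^+ 2))).
      apply: le_intg => //.
      + exact: weak_H1_itg2 (weak_H1_lin hip 2^-1 2^-1 w1 w2).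
      + by apply: itgD => //; exact: itgZ.
      move=> x _ /=; rewrite half_norm -subr_ge0.
      have -> : 2^-1 * e.2 x ^+ 2 + 2^-1 * e'.2 x ^+ 2 - (2^-1 * e.2 x + 2^-1 * e'.2 x) ^+ 2
        = (e.2 x - e'.2 x) ^+ 2 / 4 by field.
      by rewrite divr_ge0// sqr_ge0.
    rewrite RintegralD; [|by []|exact: itgZ|exact: itgZ].
    rewrite !RintegralZl//; lra.
move=> t tT; have [b1 c1] := h1 t tT; have [b2 c2] := h2 t tT; split.
  have -> : (mid e e').1.1 t - z t = 2^-1 *: (e.1.1 t - z t) + 2^-1 *: (e'.1.1 t - z t).
    rewrite /= !scalerBr addrACA -opprD -scalerDl (_ : 2^-1 + 2^-1 = 1 :> R) ?scale1r//.
    lra.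
  apply: le_trans (ler_normD _ _) _; rewrite !normrZ half_norm; lra.
move=> a w Aaw; have := c1 a w Aaw; have := c2 a w Aaw.
rewrite /= half_norm !(bilinDl hb) !(bilinZl hb) !(bilinNl hb).
have : 2^-1 ^+ n * (2^-1 * e.2 t + 2^-1 * e'.2 t + `|w|) =
  2^-1 * (2^-1 ^+ n * (e.2 t + `|w|)) + 2^-1 * (2^-1 ^+ n * (e'.2 t + `|w|)) :> R by field.
move=> ->; move: (_ ^+ n * _) (_ ^+ n * _) (ip _ _) (ip _ _) (ip _ _) => *; lra.
Qed.

Lemma approximant_le n m e : (n <= m)%N -> approximant m e -> approximant n e.
Proof.
move=> nm [h1 h2].
have pw : (2^-1 : R) ^+ m <= 2^-1 ^+ n.
  by apply: ler_wiXn2l => //; lra.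
split => // t tT; have [b1 c1] := h2 t tT; split; first exact: le_trans pw.
move=> a w Aaw; apply: le_trans (c1 a w Aaw); rewrite lerN2 ler_wpM2r//.
by case: h1 => _ w1 _ _; rewrite addr_ge0// (weak_H1_ge0 w1).
Qed.

Let energy (e : triple) := intg `[0, T] (fun x => `|e.1.2 x| ^+ 2).

Let sq_itg n m e e' : approximant n e -> approximant m e' ->
  itg `[0, T] (fun x => `|e.1.2 x - e'.1.2 x| ^+ 2).
Proof.
move=> [[s1 _ _ _] _] [[s2 _ _ _] _].
exact: (simple_comp_itg (fun u : H => `|u| ^+ 2) 0 T (simple_op (fun a b : H => a - b) s1 s2)).
Qed.

Let abs_itg n m e e' : approximant n e -> approximant m e' ->
  itg `[0, T] (fun x => `|e.1.2 x - e'.1.2 x|).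
Proof.
move=> [[s1 _ _ _] _] [[s2 _ _ _] _].
exact: (simple_comp_itg (fun u : H => `|u|) 0 T (simple_op (fun a b : H => a - b) s1 s2)).
Qed.

Let energy_itg n e : approximant n e -> itg `[0, T] (fun x => `|e.1.2 x| ^+ 2).
Proof.
by move=> [[s1 _ _ _] _]; exact: (simple_comp_itg (fun u : H => `|u| ^+ 2) 0 T s1).
Qed.

Let energy_le n e : approximant n e -> energy e <= V2.
Proof.
move=> h; have [[_ w1 _ v1] _] := h; apply: le_trans v1; apply: le_intg => //.
- exact: energy_itg h.
- exact: weak_H1_itg2 w1.
move=> x _; have [_ _ hm _ _] := w1.
by rewrite ler_pXn2r ?nnegrE// (weak_H1_ge0 w1).
Qed.

Let energy_gap n m e e' : approximant n e -> approximant m e' ->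
  (energy e + energy e') / 2 - energy (mid e e') =
  intg `[0, T] (fun x => `|e.1.2 x - e'.1.2 x| ^+ 2) / 4.
Proof.
move=> h h'; have i1 := energy_itg h; have i2 := energy_itg h'; have i3 := sq_itg h h'.
have -> : energy (mid e e') = intg `[0, T] (fun x =>
    (2^-1 * `|e.1.2 x| ^+ 2 + 2^-1 * `|e'.1.2 x| ^+ 2) - 4^-1 * `|e.1.2 x - e'.1.2 x| ^+ 2).
  apply: eq_Rintegral => x _ /=.
  by rewrite -!(ipxx hip) -scalerDr (bilin_mid hb); field.
rewrite RintegralB; [|by []|by apply: itgD => //; exact: itgZ|exact: itgZ].
rewrite RintegralD; [|by []|exact: itgZ|exact: itgZ].
by rewrite !RintegralZl// /energy; field.
Qed.

(* Mazur's trick: almost minimisers of the energy in the convex sets of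
   approximants are Cauchy in L^2, hence strong limits exist. *)
Lemma mazur_sequence : exists G : nat -> triple,
  (forall k, approximant k (G k)) /\
  forall k n m, (k <= n)%N -> (k <= m)%N ->
    intg `[0, T] (fun x => `|(G n).1.2 x - (G m).1.2 x|) <= 2^-1 ^+ k.
Proof.
have [] := @almost_minimisers R triple mid energy approximant V2.
- by move=> n; have [e he] := approximable n; exists e => //; exact: energy_le he.
- by move=> n m nm e; exact: approximant_le.
- by move=> n e e'; exact: approximant_mid.
- by move=> e _; apply: intg_ge0 => x _; exact: sqr_ge0.
move=> g [gS _ gap].
(* The energy gap is a quarter of the squared L^2 distance, and Cauchy-Schwarz on [[0, T]] costs a
   factor [T]; this tolerance thus gives L^1 distance [2^-k]. *)
have ek0 k : 0 < (2^-1 ^+ k) ^+ 2 / (4 * T) :> R.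
  by rewrite divr_gt0 ?mulr_gt0// !exprn_gt0.
have /choice[N hN] : forall k, exists N, forall n m, (N <= n)%N -> (N <= m)%N ->
    (energy (g n) + energy (g m)) / 2 - energy (mid (g n) (g m)) <=
    (2^-1 ^+ k) ^+ 2 / (4 * T) by move=> k; exact: gap.
(* The index dominates [k] and every [N j] with [j <= k], so one subsequence meets all
   tolerances. *)
pose sg k := (k + \sum_(j < k.+1) N j)%N.
have sgN k n : (k <= n)%N -> (N k <= sg n)%N.
  move=> kn; rewrite /sg (bigD1 (Ordinal (kn : (k < n.+1)%N)))//=.
  by rewrite addnCA leq_addr.
exists (fun k => g (sg k)); split.
  by move=> k; apply: approximant_le (gS _); exact: leq_addr.
move=> k n m kn km.
have h := hN k _ _ (sgN _ _ kn) (sgN _ _ km).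
rewrite (energy_gap (gS _) (gS _)) in h.
set d := fun x => `|(g (sg n)).1.2 x - (g (sg m)).1.2 x|.
have d2 := sq_itg (gS (sg n)) (gS (sg m)); have d1 := abs_itg (gS (sg n)) (gS (sg m)).
rewrite -(@ler_pXn2r _ 2) ?nnegrE ?intg_ge0//; last by move=> x _; rewrite /d.
apply: le_trans (intg_CS (ltW T0) _ d1 d2) _; first by move=> x.
have T4 : 0 <= 4 * T by rewrite mulr_ge0// ltW.
rewrite subr0; have := ler_wpM2l T4 h; rewrite -/d.
have -> (u : R) : 4 * T * (u / 4) = T * u by field.
have -> // : 4 * T * ((2^-1 ^+ k) ^+ 2 / (4 * T)) = (2^-1 ^+ k) ^+ 2 :> R.
by field; rewrite gt_eqF.
Qed.

Lemma mazur_limit : exists g : R -> H, H1_deriv T z g /\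
  {ae mu, forall t, `[0, T]%classic t -> A (y t) (g t)}.
Proof.
have [G [GA Gd]] := mazur_sequence.
have mD : measurable (`[0, T]%classic : set R) by exact: measurable_itv.
(* One series for two purposes: the first term makes the velocities Cauchy at almost every point,
   the second makes the monotonicity tolerance vanish there. *)
pose h k x := `|(G k).1.2 x - (G k.+1).1.2 x| + 2^-1 ^+ k * (G k).2 x.
have w k : weak_H1 ip T (G k).1.1 (G k).1.2 (G k).2 by case: (GA k) => -[].
have m0 k x : 0 <= (G k).2 x by exact: weak_H1_ge0 (w k) x.
have h0 k x : 0 <= h k x by rewrite addr_ge0// mulr_ge0.
have im k : itg `[0, T] (G k).2 by exact: weak_H1_itg_dom (w k).
have ih k : itg `[0, T] (h k).
  by apply: itgD => //; [exact: abs_itg (GA k) (GA k.+1) | exact: itgZ].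
have hint k : intg `[0, T] (h k) <= (1 + (T + V2)) * 2^-1 ^+ k.
  rewrite RintegralD; [|by []|exact: abs_itg (GA k) (GA k.+1)|exact: itgZ].
  rewrite mulrDl mul1r; apply: lerD; first exact: Gd.
  rewrite RintegralZl; [|by []|exact: im].
  rewrite mulrC ler_wpM2r//.
  have v2 : intg `[0, T] (fun x => (G k).2 x ^+ 2) <= V2 by case: (GA k) => -[].
  apply: (@le_trans _ _ (intg `[0, T] (fun x => 1 + (G k).2 x ^+ 2))).
    have i2 := weak_H1_itg2 (w k).
    apply: le_intg => //; first by apply: itgD => //; exact: itg_cst.
    move=> x _; have := sqr_ge0 ((G k).2 x - 1); have := sqr_ge0 ((G k).2 x).
    by rewrite sqrrB expr1n; lra.
  rewrite RintegralD; [|by []|exact: itg_cst|exact: weak_H1_itg2 (w k)].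
  by rewrite intg_cst ?(ltW T0)// mul1r subr0 lerD2l.
have [N [mN N0 hN]] := ae_bounded_series mD ih h0 hint.
pose E := ~` N `&` `[0, T]%classic.
have mE : measurable E by apply: measurableI => //; exact: measurableC.
have good x : E x -> exists B, forall n, \sum_(k < n) h k x <= B.
  move=> [Nx Dx]; apply: contrapT => nb; apply: Nx; apply: hN => /= hx.
  by apply: nb; exact: hx.
have /choice[g hg] : forall x, exists l : H,
    (E x -> (fun k => (G k).1.2 x) @ \oo --> l) /\ (~ E x -> l = 0).
  move=> x; have [Ex|nEx] := pselect (E x); last by exists 0; split.
  have [B hB] := good x Ex.
  have [l hl] : exists l : H, (fun k => (G k).1.2 x) @ \oo --> l.
    by apply: (@bounded_series_cauchy _ _ _ (h^~ x) B) => // k; rewrite lerDl mulr_ge0.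
  by exists l; split.
have aeE : {ae mu, forall x, `[0, T]%classic x -> E x}.
  by exists N; split => // x /= nx; apply: contrapT => Nx; apply: nx => Dx; split.
exists g; split; last first.
  apply: ae_mono aeE => t hE Dt; have Et := hE Dt.
  have tT : 0 <= t <= T by move: Dt; rewrite /= in_itv.
  have [B hB] := good t Et; have gl := (hg t).1 Et.
  have small : (fun k => 2^-1 ^+ k * (G k).2 t) @ \oo --> (0 : R).
    apply/cvgn_distP => e e0.
    have [n0 hn0] := bounded_series_tail (h0^~ t) hB e0.
    exists n0 => n n0n; rewrite subr0 ger0_norm ?mulr_ge0//.
    have := hn0 n n.+1 n0n (leqnSn n); rewrite big_nat1; apply: le_trans.
    by rewrite lerDr.
  have pow0 : (fun k => (2^-1 : R) ^+ k) @ \oo --> (0 : R).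
    by apply: cvg_expr; rewrite ger0_norm; lra.
  (* Maximality: at a good point both sides of the approximate monotonicity inequality converge, the
     left one to 0. *)
  apply: hA.2 => a u Aau.
  have l1 : (fun k => - (2^-1 ^+ k * ((G k).2 t + `|u|))) @ \oo --> (0 : R).
    have -> : (0 : R) = - (0 + 0 * `|u|) by rewrite mul0r addr0 oppr0.
    have -> : (fun k => - (2^-1 ^+ k * ((G k).2 t + `|u|))) =
        (fun k => - (2^-1 ^+ k * (G k).2 t + 2^-1 ^+ k * `|u|)).
      by apply/funext => k; rewrite mulrDr.
    apply: cvgN; apply: cvgD => //; apply: cvgM => //; exact: cvg_cst.
  have l2 : (fun k => ip ((G k).1.2 t - u) (y t - a)) @ \oo --> ip (g t - u) (y t - a).
    apply: (ip_cvg hip); last exact: cvg_cst.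
    by apply: cvgB => //; exact: cvg_cst.
  apply: (cvgn_le l1 l2) => k; have [_ /(_ t tT)[_]] := GA k; exact.
split.
  move=> t /andP[t0 tT]; exists (fun k => (G k).1.2).
  have sub : (`[0, t] `<=` `[0, T])%classic by exact: subset_itvcc.
  split; first split.
  - by move=> n; case: (GA n) => -[].
  - by apply: ae_mono aeE => x hE /sub Dx; exact: (hg x).1 (hE Dx).
  - move=> e e0; have [k hk] := half_pow_small e0; exists k => n m kn km.
    have i1 : itg `[0, t] (fun x => `|(G n).1.2 x - (G m).1.2 x|).
      exact: itgS_itvcc (lexx _) tT (abs_itg (GA n) (GA m)).
    rewrite -[leLHS]fineK; last by apply: integrable_fin_num.
    rewrite lee_fin.
    apply: le_trans (hk k (leqnn k)); apply: le_trans (Gd k n m kn km).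
    by apply: subset_intg => //; exact: abs_itg (GA n) (GA m).
  have tt : 0 <= t <= T by rewrite t0.
  apply: (@cvgn_dist_le _ _ _ _ (fun k => 2^-1 ^+ k)); last first.
    by apply: cvg_expr; rewrite ger0_norm; lra.
  (* The simple integral is the exact increment of the approximant, as testing with every [u] shows,
     so it lies within [2^-k] of [z t - z 0]. *)
  move=> k; have [[sk wk ik _] /(_ t tt)[zk _]] := GA k.
  have -> : simple_integral `[0, t] (G k).1.2 = (G k).1.1 t - (G k).1.1 0.
    apply/eqP; rewrite -subr_eq0; apply/eqP; apply: (ip_sep hip) => u.
    rewrite (bilinDl hb) (bilinNl hb).
    rewrite (@simple_integral_fun _ _ _ (fun v => ip v u))//; last first.
      by move=> c x1 x2; rewrite !(bilinE hb).
    by have [_ _ _ _ /(_ t tt u) ->] := wk; rewrite subrr.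
  rewrite ik opprB addrA subrK; exact: zk.
have sG k : simple_fun (G k).1.2 by case: (GA k) => -[].
apply: (@le_lt_trans _ _ V2%:E); last by rewrite ltry.
(* Cut off on the exceptional set, where [g] is 0, so that Fatou applies with convergence
   everywhere. *)
pose G' k x := if `[< E x >] then (G k).1.2 x else 0.
have sG' k : simple_fun (G' k) by exact: simple_indic.
apply: (@fatou_bound _ _ (fun k x => `|G' k x| ^+ 2)) => //.
- by move=> k; apply: (simple_comp_meas (fun u : H => `|u| ^+ 2)).
- move=> x _; rewrite expr2; under eq_fun do rewrite expr2.
  have hn : (fun k => `|G' k x|) @ \oo --> `|g x|.
    apply: cvg_norm; rewrite /G'; case: asboolP => Ex; first exact: (hg x).1.
    by rewrite (hg x).2//; exact: cvg_cst.
  exact: cvgM.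
move=> k.
have i1 : itg `[0, T] (fun x => `|G' k x| ^+ 2).
  exact: (simple_comp_itg (fun u : H => `|u| ^+ 2) 0 T (sG' k)).
rewrite -[leLHS]fineK; last by apply: integrable_fin_num.
rewrite lee_fin; apply: le_trans (energy_le (GA k)).
apply: le_intg => //; first exact: energy_itg (GA k).
by move=> x _; rewrite /G'; case: asboolP => // _; rewrite normr0 expr0n sqr_ge0.
Qed.

End MazurLimit.

(** * Existence and the stability inequality in the limit *)

Section Existence.
Context (R : realType) (H : completeNormedModType R) (ip : H -> H -> R).
Local Notation mu := (@lebesgue_measure R).
Hypothesis hip : is_inner_product ip.
Let hb := ip_bilin hip.
Variables (Q : H -> H) (A : H -> set H) (M gam kP kL : R) (p : H -> R).
Hypothesis hQ : bounded_linear Q.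
Hypothesis hQsa : forall h k, ip (Q h) k = ip h (Q k).
Hypothesis M0 : 0 <= M.
Hypothesis QM : forall x, `|Q x| <= M * `|x|.
Hypothesis gam0 : 0 < gam.
Hypothesis hQco : forall h, gam * `|h| ^+ 2 <= ip (Q h) h.
Hypothesis hA : maximal_monotone ip A.
Hypothesis hDA : closed (dom A).
Hypothesis hres : forall tau h, 0 < tau -> exists y v, A y v /\ y + tau *: Q v = h.
Hypothesis hsec : forall B, exists K, forall h, dom A h -> `|h| <= B ->
  exists2 w, A h w & `|w| <= K.
Hypothesis kP0 : 0 <= kP.
Hypothesis kL0 : 0 <= kL.
Hypothesis p_ge0 : forall x, 0 <= p x.
Hypothesis p_add : forall x y, p (x + y) <= p x + p y.
Hypothesis p_le : forall x, p x <= kP * `|x|.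
Hypothesis le_p : forall x, `|x| <= kL * p x.
Hypothesis contr : forall tau y y' v d a w, 0 <= tau -> A y v -> A a w ->
  y + tau *: Q v = y' + d -> p (y - a) <= p (y' - a) + p d + tau * p (Q w).
Variables (T : R) (f df : R -> H) (mf : R -> R) (z0 : H).
Hypothesis T0 : 0 < T.
Hypothesis hf : weak_H1 ip T f df mf.
Hypothesis hdom : dom A (f 0 - Q z0).

Lemma coercive_lower x : `|x| <= gam^-1 * `|Q x|.
Proof.
rewrite -ler_pdivrMl ?invr_gt0// invrK.
have [->|x0] := eqVneq x 0; first by rewrite normr0 mulr0.
rewrite -(@ler_pM2r _ `|x|) ?normr_gt0// -mulrA -expr2.
exact: le_trans (hQco _) (ip_le hip _ _).
Qed.

Lemma abstract_existence : exists z : R -> H,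
  [/\ exists2 g, H1_deriv T z g &
        {ae mu, forall t, `[0, T]%classic t -> A (f t - Q (z t)) (g t)},
      z 0 = z0, forall t, 0 <= t <= T -> dom A (f t - Q (z t))
    & forall s t a w, 0 <= s -> s <= t -> t <= T -> A a w ->
        p (f t - Q (z t) - a) <= p (f s - Q (z s) - a) + kP * intg `[s, t] mf
          + (t - s) * p (Q w)].
Proof.
have [V2 [D [Z [V [X [V20 D0 happ]]]]]] := euler_approx hip hQ M0 QM gam0 coercive_lower
  hres hsec kP0 kL0 p_ge0 p_le le_p contr T0 hf hdom.
have Vs n : simple_fun (V n) by case: (happ n) => -[].
have ZV n : weak_H1 ip T (Z n) (V n) (fun t => `|V n t|) by case: (happ n) => -[].
have Z0 n : Z n 0 = z0 by case: (happ n) => -[].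
have VV2 n : intg `[0, T] (fun t => `|V n t| ^+ 2) <= V2 by case: (happ n) => -[].
have XV n t : 0 <= t <= T -> A (X n t) (V n t) by case: (happ n) => _ [h _ _]; exact: h.
have XZ n t : 0 <= t <= T -> `|f t - Q (Z n t) - X n t| <= D * Num.sqrt (T / n.+1%:R).
  by case: (happ n) => _ [_ h _]; exact: h.
have XS n := let: conj _ (And3 _ _ h) := happ n in h.
have [z [hz zz]] := approx_limit hip hQ hQsa M0 QM gam0 hQco T0 hA V20 D0 ZV Z0 VV2 XV XZ.
set Kc := gam^-1 * _ in hz.
have Kc0 : 0 <= Kc by rewrite mulr_ge0 ?invr_ge0 ?(ltW gam0)// !mulr_ge0// addr_ge0// ltW.
pose rt n := Num.sqrt (T / n.+1%:R).
have rt0 n : 0 <= rt n by exact: sqrtr_ge0.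
have rtc : rt @ \oo --> (0 : R) := step_cvg0 (ltW T0).
pose eps n := Num.sqrt (Kc * rt n).
have epsc : eps @ \oo --> (0 : R).
  apply: sqrt_cvg0 => [n|]; first by rewrite mulr_ge0.
  by rewrite -[X in _ --> X](mulr0 Kc); apply: cvgM => //; exact: cvg_cst.
have eps0 n : 0 <= eps n by exact: sqrtr_ge0.
have hZ n t : 0 <= t <= T -> `|Z n t - z t| <= eps n.
  move=> tT; have e2 : eps n ^+ 2 = Kc * rt n by rewrite sqr_sqrtr// mulr_ge0.
  by rewrite -(@ler_pXn2r _ 2) ?nnegrE ?eps0// e2; exact: hz.
pose y t := f t - Q (z t).
(* Distance from [X n] to the limit [y]: the consistency defect plus [Q] applied to the error in
   [z]. *)
pose del n := D * rt n + M * eps n.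
have delc : del @ \oo --> (0 : R).
  have -> : (0 : R) = D * 0 + M * 0 by rewrite !mulr0 addr0.
  by apply: cvgD; apply: cvgM => //; exact: cvg_cst.
have hX n t : 0 <= t <= T -> `|X n t - y t| <= del n.
  move=> tT; have -> : X n t - y t = - (f t - Q (Z n t) - X n t) - Q (Z n t - z t).
    rewrite /y (blinB hQ) !opprB -addrA; congr (_ + _).
    by rewrite [RHS]addrC subrKA.
  apply: le_trans (ler_normB _ _) _; rewrite normrN; apply: lerD; first exact: XZ.
  by apply: le_trans (QM _) _; rewrite ler_wpM2l// hZ.
have yX t : 0 <= t <= T -> (fun n => X n t) @ \oo --> y t.
  by move=> tT; apply: (cvgn_dist_le _ delc) => n; exact: hX.
have happrox n : exists e, approximant ip T A z y V2 n e.
  have pn : 0 < (2^-1 : R) ^+ n by rewrite exprn_gt0.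
  have [N1 h1] := (cvgn_distP _ _).1 epsc _ pn.
  have [N2 h2] := (cvgn_distP _ _).1 delc _ pn.
  pose k := maxn N1 N2.
  have e1 : eps k <= 2^-1 ^+ n.
    by apply: le_trans (h1 k (leq_maxl _ _)); rewrite subr0 ler_norm.
  have e2 : del k <= 2^-1 ^+ n.
    by apply: le_trans (h2 k (leq_maxr _ _)); rewrite subr0 ler_norm.
  exists (Z k, V k, fun t => `|V k t|); split; first by split => //=; rewrite Z0 zz.
  move=> t tT /=; split; first exact: le_trans (hZ k t tT) e1.
  move=> a w Aaw.
  (* Exact monotonicity holds at [X k t]; moving to [y t] costs [|V k t - w|] times a small
     distance, whence the form of the tolerance. *)
  have -> : ip (V k t - w) (y t - a) =
      ip (V k t - w) (X k t - a) - ip (V k t - w) (X k t - y t).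
    by rewrite !(bilinE hb); ring.
  have mon := hA.1 _ _ _ _ (XV k t tT) Aaw.
  rewrite -[leLHS]add0r; apply: lerD => //; rewrite lerN2.
  apply: le_trans (ip_le hip _ _) _; rewrite mulrC; apply: ler_pM => //.
    exact: le_trans (hX k t tT) e2.
  exact: ler_normB.
have [g [zg ag]] := mazur_limit hip T0 hA happrox.
exists z; split => //; first by exists g.
- move=> t tT; apply: (closed_cvg (dom A) hDA _ _ (yX t tT)) => //.
  by apply: nearW => n; exists (V n t); exact: XV.
- move=> s t a w s0 st tT Aaw.
  have ts : 0 <= s <= T by rewrite s0 (le_trans st).
  have tt : 0 <= t <= T by rewrite (le_trans s0).
  have key n : p (y t - a) <= p (y s - a) + kP * intg `[s, t] mf + (t - s) * p (Q w)
      + (2 * (kP * del n) + D * rt n * (1 + p (Q w))).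
    have h := XS n s t a w s0 st tT Aaw.
    have c1 : p (y t - a) <= kP * del n + p (X n t - a).
      rewrite -(subrKA (X n t) (y t)); apply: le_trans (p_add _ _) _; rewrite lerD2r.
      apply: le_trans (p_le _) _; rewrite ler_wpM2l// distrC; exact: hX.
    have c2 : p (X n s - a) <= kP * del n + p (y s - a).
      rewrite -(subrKA (y s) (X n s)); apply: le_trans (p_add _ _) _; rewrite lerD2r.
      by apply: le_trans (p_le _) _; rewrite ler_wpM2l//; exact: hX.
    move: h c1 c2; rewrite -/(rt n).
    move: (D * rt n * _) (kP * del n) (kP * _) ((t - s) * p (Q w)).
    move: (p (y t - a)) (p (X n t - a)) (p (X n s - a)) (p (y s - a)) => *.
    lra.
  apply: (cvgn_le (cvg_cst _) _ key).
  rewrite -[X in _ --> X]addr0; apply: cvgD; first exact: cvg_cst.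
  have -> : (0 : R) = 2 * (kP * 0) + D * 0 * (1 + p (Q w)) by ring.
  apply: cvgD.
    by apply: cvgM; [exact: cvg_cst | apply: cvgM => //; exact: cvg_cst].
  by apply: cvgM; last exact: cvg_cst; apply: cvgM => //; exact: cvg_cst.
Qed.

End Existence.

(** * Lebesgue points and the pointwise bound on the derivative *)

Section Differentiation.
Context (R : realType).
Local Notation mu := (@lebesgue_measure R).

(** The primitive of [k] is nondecreasing, and by Lebesgue differentiation its derivative is [k]
    almost everywhere. *)
Lemma ae_ge0_of_intervals (T : R) (k : R -> R) : 0 < T -> itg `[0, T] k ->
  (forall s t, 0 <= s -> s <= t -> t <= T -> 0 <= intg `[s, t] k) ->
  {ae mu, forall x, `[0, T]%classic x -> 0 <= k x}.
Proof.
move=> T0 ik kpos.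
have mD : measurable (`[0, T]%classic : set R) by exact: measurable_itv.
pose f : R -> R := k \_ `[0, T].
have fi y : mu.-integrable [set` Interval (BLeft 0) (BRight y)] (EFin \o f).
  rewrite /f -restrict_EFin; apply/integrable_restrict => //.
  by apply: integrableS ik => //; apply: measurableI; exact: measurable_itv.
have [N [mN N0 hN]] := FTC1 fi (integrable_locally mD ik).
have F_int x : 0 <= x <= T -> intg `[0, x] f = intg `[0, x] k.
  move=> /andP[x0 xT]; apply: eq_Rintegral => u; rewrite inE /= in_itv /= => /andP[u0 ux].
  by rewrite /f /patch mem_set//= in_itv /= u0 (le_trans ux).
have nd x y : 0 <= x -> x <= y -> y <= T -> intg `[0, x] f <= intg `[0, y] f.
  move=> x0 xy yT.
  rewrite F_int; last by rewrite x0 (le_trans xy).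
  rewrite F_int; last by rewrite yT (le_trans x0).
  rewrite (@intg_split _ k _ _ x x0 xy); first by rewrite lerDl kpos.
  exact: itgS_itvcc (lexx _) yT ik.
(* The endpoints are discarded because the difference quotient is two-sided. *)
have ne a : {ae mu, forall x, x <> a}.
  exists [set a]; split; [exact: measurable_set1 | exact: lebesgue_measure_set1 |].
  by move=> x /= /contrapT.
have hF : {ae mu, forall x, 0 < x ->
    derivable (fun y : R => intg `[0, y] f : R) x 1 /\
    derive1 (fun y : R => intg `[0, y] f : R) x = f x}.
  by exists N; split.
apply: ae_mono (ae_and (ae_and (ne 0) (ne T)) hF) => x [[/eqP xn0 /eqP xnT] h].
rewrite /= in_itv /= => /andP[x0 xT].
have x0' : 0 < x by rewrite lt_def xn0.
have xT' : x < T by rewrite lt_def eq_sym xnT.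
have [der] := h x0'; rewrite {2}/f /patch mem_set/=; last by rewrite in_itv /= x0.
move=> <-.
rewrite derive1E; apply: limr_ge => //.
near=> e.
have en0 : e != 0 by near: e; exact: nbhs_dnbhs_neq.
have e1 : `|e| < x by near: e; apply: dnbhs0_lt.
have e2 : `|e| < T - x by near: e; apply: dnbhs0_lt; rewrite subr_gt0.
move: e1 e2; rewrite !ltr_norml => /andP[e1 e1'] /andP[e2 e2'].
rewrite /= [e *: 1]mulr1; have [epos|eneg] := ltP 0 e.
  by apply: mulr_ge0; [rewrite invr_ge0 ltW | rewrite subr_ge0 nd//; lra].
apply: mulr_le0; first by rewrite invr_le0.
by rewrite subr_le0 nd//; lra.
Unshelve. all: by end_near. Qed.

Context (H : completeNormedModType R) (ip : H -> H -> R).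
Hypothesis hip : is_inner_product ip.
Let hb := ip_bilin hip.

Lemma separable_seq : separable H -> exists e : nat -> H,
  forall x eps, 0 < eps -> exists n, `|x - e n| <= eps.
Proof.
move=> [S [cS dS]]; have [i injS] : exists i : H -> nat, {in S &, injective i}.
  exact/countable_injP.
(* Inverts the injection into [nat]; indices outside its image receive the default 0, which does no
   harm to density. *)
have /choice[e he] : forall n, exists w, (exists2 w', S w' & i w' = n) -> S w /\ i w = n.
  move=> n; have [[w Sw <-]|no] := pselect (exists2 w', S w' & i w' = n).
    by exists w.
  by exists 0.
exists e => x eps eps0.
have : closure S x by rewrite dS.
move=> /(_ (ball x eps))[]; first exact: nbhsx_ballx.
move=> w [Sw]; rewrite -ball_normE /= => /ltW hw.
exists (i w); have [Se ie] := he (i w) (ex_intro2 _ _ w Sw erefl).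
by rewrite (injS _ _ _ _ ie)// inE.
Qed.

(** The exceptional null set depends on the test vector, so only countably many are used; at each
    remaining point the vector [g x] is then approximated by one of them. *)
Lemma weak_H1_deriv_bound (T : R) (z g : R -> H) (m G : R -> R) : 0 < T ->
  separable H -> weak_H1 ip T z g m -> itg `[0, T] G -> (forall x, 0 <= G x) ->
  (forall s t, 0 <= s -> s <= t -> t <= T -> `|z t - z s| <= intg `[s, t] G) ->
  {ae mu, forall x, `[0, T]%classic x -> `|g x| <= G x}.
Proof.
move=> T0 /separable_seq[e he] zg iG G0 hz.
have hn n : {ae mu, forall x, `[0, T]%classic x -> 0 <= `|e n| * G x - ip (g x) (e n)}.
  have i1 := weak_H1_itg_ip hip zg (e n).
  apply: ae_ge0_of_intervals => //; first by apply: itgB => //; exact: itgZ.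
  move=> s t s0 st tT.
  have iG' := itgS_itvcc s0 tT iG.
  rewrite RintegralB; [|by []|exact: itgZ|exact: itgS_itvcc s0 tT i1].
  rewrite RintegralZl// subr_ge0 -(weak_H1_incr hip zg)//.
  apply: le_trans (ip_le hip _ _) _; rewrite mulrC ler_wpM2l//; exact: hz.
have all : {ae mu, forall x, forall n, `[0, T]%classic x -> 0 <= `|e n| * G x - ip (g x) (e n)}.
  have [N [mN N0 hN]] := @ae_foralln _ _ _ mu
    (fun n x => `[0, T]%classic x -> 0 <= `|e n| * G x - ip (g x) (e n)) hn.
  by exists N; split.
apply: ae_mono all => x hx Dx.
have [->|gx0] := eqVneq (g x) 0; first by rewrite normr0.
have ng : 0 < `|g x| by rewrite normr_gt0.
suff : 0 <= `|g x| * G x - `|g x| ^+ 2.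
  by rewrite subr_ge0 expr2 ler_pM2l.
apply: (@ge0_of_perturb _ _ (G x + `|g x|)) => s s0 _.
have [n hs] := he (g x) s s0; have := hx n Dx.
have e1 : `|g x| ^+ 2 = ip (g x) (e n) + ip (g x) (g x - e n).
  by rewrite -(ipxx hip) !(bilinE hb); ring.
have e2 : ip (g x) (g x - e n) <= `|g x| * s.
  by apply: le_trans (ip_le hip _ _) _; rewrite ler_wpM2l.
have e3 : `|e n| <= `|g x| + s.
  rewrite -[e n](subrK (g x)) addrC; apply: le_trans (ler_normD _ _) _.
  by rewrite lerD2l distrC.
have e4 := ler_wpM2r (G0 x) e3.
rewrite e1 mulrDr [s * `|g x|]mulrC.
rewrite mulrDl in e4; move: e2 e4.
move: (ip _ _) (ip _ _) (_ * _) (_ * _) (_ * _) (_ * _) => *; lra.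
Qed.

End Differentiation.

(** * The state equation *)

Section StateEquation.
Context (R : realType) (T : R) (X H : completeNormedModType R) (ip : H -> H -> R).
Local Notation mu := (@lebesgue_measure R).
Hypothesis T0 : 0 < T.
Hypothesis hip : is_inner_product ip.
Let hb := ip_bilin hip.
Variables (A : H -> set H) (RH : X -> H) (Q : H -> H) (gam : R).
Hypothesis hsep : separable H.
Hypothesis hA : maximal_monotone ip A.
Hypothesis hDA : closed (dom A).
Hypothesis hA0 : bounded_on_bounded A (min_section A).
Hypothesis hRH : bounded_linear RH.
Hypothesis hQ : bounded_linear Q.
Hypothesis hQsa : forall h k, ip (Q h) k = ip h (Q k).
Hypothesis gam0 : 0 < gam.
Hypothesis hQco : forall h, gam * `|h| ^+ 2 <= ip (Q h) h.

Definition state_solution (z0 : H) (l : R -> X) (z : R -> H) :=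
  exists g : R -> H, [/\ H1_deriv T z g, z 0 = z0 &
    {ae mu, forall t, `[0%R, T]%classic t -> A (RH (l t) - Q (z t)) (g t)}].

Lemma state_solution_unique z0 l z z' :
  state_solution z0 l z -> state_solution z0 l z' ->
  forall t, 0 <= t <= T -> z' t = z t.
Proof.
move=> [g [zg z00 ag]] [g' [zg' z00' ag']] t tT.
have [M M0 QM] := blin_bound hQ.
have [h [_ gh _ wz]] := H1_weak hip (ltW T0) zg.
have [h' [_ gh' _ wz']] := H1_weak hip (ltW T0) zg'.
have hk : {ae mu, forall x, `[0, T]%classic x ->
    2 * ip (Q (z' x - z x)) (h' x - h x) <= 0}.
  apply: ae_mono (ae_and (ae_and ag ag') (ae_and gh gh')) => x [[a1 a2] [e1 e2]] Dx.
  rewrite -e1// -e2//; have := hA.1 _ _ _ _ (a2 Dx) (a1 Dx).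
  rewrite pmulr_rle0// -oppr_ge0 (bilinC hb (Q _)) -(bilinNr hb).
  rewrite (_ : RH (l x) - Q (z' x) - (RH (l x) - Q (z x)) = - Q (z' x - z x))//.
  by rewrite (blinB hQ) !opprB addrC subrKA.
have := weak_H1_compare hip hQ hQsa (ltW M0) QM hQco wz' wz
  (etrans z00' (esym z00)) (itg_cst 0 T 0) hk tT.
have /andP[t0 _] := tT; rewrite intg_cst// mul0r pmulr_rle0// => h0.
apply/eqP; rewrite -subr_eq0 -normr_eq0 -sqrf_eq0.
by rewrite eq_le h0 sqr_ge0.
Qed.

(** Every constant is fixed before [z0] and [l] appear; the last clause treats any derivative [g] of
    [z], not only the one built with it. *)
Lemma state_equation : exists C : R, 0 < C /\
  forall (z0 : H) (l gl : R -> X), H1_deriv T l gl -> dom A (RH (l 0) - Q z0) ->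
    exists z : R -> H,
      [/\ state_solution z0 l z,
          Cnorm T z <= C * (1 + `|z0| + Cnorm T l + L1norm T gl) &
          forall g : R -> H, H1_deriv T z g ->
            L2norm T g <= C * (L2norm T gl +
              sup [set `|min_section A (RH (l tau) - Q (z tau))| | tau in `[0%R, T]%classic])].
Proof.
have [M Mp QM] := blin_bound hQ; have M0 := ltW Mp.
have [KR KRp RK] := blin_bound hRH; have KR0 := ltW KRp.
have [P [QP PQ Pb Plin Pbd]] := coercive_inverse hip hQ hQsa gam0 hQco.
pose p := pnorm ip P.
pose kP := Num.sqrt gam^-1; pose kL := Num.sqrt (M ^+ 2 / gam).
have kP0 : 0 <= kP by exact: sqrtr_ge0.
have kL0 : 0 <= kL by exact: sqrtr_ge0.
have p_ge0 x : 0 <= p x by exact: pnorm_ge0.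
have p_add x y : p (x + y) <= p x + p y := pnormD hip gam0 hQco Mp QM QP Pb x y.
have p_le x : p x <= kP * `|x| := pnorm_le hip gam0 Pbd x.
have le_p x : `|x| <= kL * p x := le_pnorm hip gam0 hQco Mp QM QP x.
have contr := step_contraction hip hQ gam0 hQco Mp QM QP PQ Pb hA.
have hres := resolvent_ex hip hQ gam0 hQco Mp QM QP PQ Pb Plin Pbd hA.
have msec h : dom A h -> A h (min_section A h) by move=> /(min_section_spec hip hA)[].
have hsec B : exists K, forall h, dom A h -> `|h| <= B -> exists2 w, A h w & `|w| <= K.
  have [K hK] := hA0 B; exists K => h dh hB; exists (min_section A h).
    exact: msec.
  exact: hK.
(* A reference pair of the graph chosen independently of the data, here by the resolvent at 0 with
   unit step. *)
have [a0 [w0 [Aa0 _]]] := hres 1 0 ltr01.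
have g0 : 0 <= gam^-1 by rewrite invr_ge0 ltW.
have PQn x : `|x| <= gam^-1 * `|Q x| := coercive_lower hip gam0 hQco x.
(* [al] collects the data-free part of the bound on [y]. [C1] serves the first estimate; [c1] and
   [c2] are the weights in the pointwise bound on the derivative, from which [C2] comes. *)
pose al := `|a0| + kL * (kP * `|a0| + T * p (Q w0)).
pose C1 := gam^-1 * (al + kL * kP * M + KR + 2 * (kL * kP * KR)).
pose c1 := gam^-1 * (1 + kL * kP); pose c2 := gam^-1 * (kL * kP * M).
pose C2 := 2 * (c1 * KR) + 2 * (c2 * (1 + T)).
have al0 : 0 <= al by rewrite addr_ge0// mulr_ge0// addr_ge0 ?mulr_ge0// ltW.
have q1 : 0 <= kL * kP * M by rewrite !mulr_ge0.
have q2 : 0 <= kL * kP * KR by rewrite !mulr_ge0.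
have C10 : 0 <= C1.
  apply: mulr_ge0 => //; apply: addr_ge0; last exact: mulr_ge0.
  by apply: addr_ge0 => //; exact: addr_ge0.
have c10 : 0 <= c1 by rewrite mulr_ge0// addr_ge0// mulr_ge0.
have c20 : 0 <= c2 by rewrite mulr_ge0.
have T1 : 0 <= 1 + T by rewrite addr_ge0// ltW.
have C20 : 0 <= C2 by apply: addr_ge0; apply: mulr_ge0 => //; exact: mulr_ge0.
exists (C1 + C2 + 1); split; first by rewrite ltr_wpDl// addr_ge0.
move=> z0 l gl hl hdom.
have [gl' [mgl ggl [igl igl2] [n1 n2] hphi]] := H1_regular (ltW T0) hl.
pose f t := RH (l t); pose df t := RH (gl' t); pose mf t := KR * `|gl' t|.
have lin w : scalar_linear (fun v => ip (RH v) w).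
  by move=> c x y; rewrite (blinD hRH) (blinZ hRH) !(bilinE hb).
have bd w v : `|ip (RH v) w| <= (`|w| * KR) * `|v|.
  apply: le_trans (ip_abs hip _ _) _; rewrite mulrC -mulrA.
  by rewrite ler_wpM2l.
have wf : weak_H1 ip T f df mf.
  split.
  - by move=> w; exact: (strongly_meas_lin _ mgl (lin w) (bd w)).
  - by apply: measurable_funM; [exact: measurable_cst | exact: strongly_meas_norm].
  - by move=> x; exact: RK.
  - have -> : (fun x => mf x ^+ 2) = (fun x => KR ^+ 2 * `|gl' x| ^+ 2).
      by apply/funext => x; rewrite exprMn.
    exact: itgZ.
  - by move=> t /hphi[e _] w; rewrite -(blinB hRH); exact: (e _ _ (lin w) (bd w)).
have [z [[g zg ag] zz zdom zstab]] := abstract_existence hip hQ hQsa M0 QM gam0 hQco hA hDA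
  hres hsec kP0 kL0 p_ge0 p_add p_le le_p contr T0 wf hdom.
pose y t := f t - Q (z t).
have mf0 x : 0 <= mf x by rewrite mulr_ge0.
have imf : itg `[0, T] mf by exact: itgZ.
have L10 : 0 <= L1norm T gl by rewrite n1; exact: intg_ge0.
have Imf : intg `[0, T] mf = KR * L1norm T gl by rewrite n1 RintegralZl.
have subI (h : R -> R) s t : 0 <= s -> t <= T -> (forall x, 0 <= h x) ->
    itg `[0, T] h -> intg `[s, t] h <= intg `[0, T] h.
  by move=> s0 tT h0 ih; apply: subset_intg => //; exact: subset_itvcc.
have lsup t : 0 <= t <= T -> `|l t| <= Cnorm T l.
  move=> tT; apply: ub_le_sup; last by exists t.
  (* A [sup] dominates its set only if the set is bounded; here the increments of [l] are bounded by
     the L^1 norm of its derivative. *)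
  exists (`|l 0| + L1norm T gl) => _ [s + <-]; rewrite /= in_itv /= => sT.
  have [_ h] := hphi s sT; have /andP[s0 sT'] := sT.
  rewrite -[l s](subrK (l 0)) addrC; apply: le_trans (ler_normD _ _) _.
  by rewrite lerD2l n1; apply: le_trans h _; exact: subI.
have T00 : 0 <= (0 : R) <= T by rewrite lexx ltW.
have Cl0 : 0 <= Cnorm T l by apply: le_trans (lsup 0 T00).
have ybd t : 0 <= t <= T -> `|y t| <=
    al + kL * kP * KR * Cnorm T l + kL * kP * M * `|z0| + kL * kP * KR * L1norm T gl.
  move=> tT; have /andP[t0 tT'] := tT.
  rewrite -[y t](subrK a0) addrC; apply: le_trans (ler_normD _ _) _.
  have h1 := zstab 0 t a0 w0 (lexx _) t0 tT' Aa0.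
  have h2 : kP * intg `[0, t] mf <= kP * (KR * L1norm T gl).
    by rewrite ler_wpM2l// -Imf subI.
  have h3 : (t - 0) * p (Q w0) <= T * p (Q w0) by rewrite subr0 ler_wpM2r.
  have h4 : p (f 0 - Q (z 0) - a0) <= kP * (KR * Cnorm T l + M * `|z0| + `|a0|).
    apply: le_trans (p_le _) _; rewrite ler_wpM2l//.
    apply: le_trans (ler_normB _ _) _; rewrite lerD2r.
    apply: le_trans (ler_normB _ _) _; apply: lerD; last by rewrite zz.
    by apply: le_trans (RK _) _; rewrite ler_wpM2l// lsup.
  have h5 : p (y t - a0) <= kP * (KR * Cnorm T l + M * `|z0| + `|a0|)
      + kP * (KR * L1norm T gl) + T * p (Q w0).
    by apply: le_trans h1 _; apply: lerD => //; apply: lerD.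
  have h6 := le_trans (le_p (y t - a0)) (ler_wpM2l kL0 h5).
  apply: le_trans (lerD (lexx `|a0|) h6) _.
  by rewrite /al le_eqVlt; apply/orP; left; apply/eqP; ring.
exists z; split.
- by exists g.
- apply: ge_sup; first by exists `|z 0|, 0 => //=; rewrite in_itv.
  move=> _ [t + <-]; rewrite /= in_itv /= => tT.
  have e : Q (z t) = f t - y t by rewrite /y opprB addrC subrK.
  apply: le_trans (PQn _) _; rewrite e.
  have h1 : `|f t - y t| <= KR * Cnorm T l + (al + kL * kP * KR * Cnorm T l
      + kL * kP * M * `|z0| + kL * kP * KR * L1norm T gl).
    apply: le_trans (ler_normB _ _) _; apply: lerD; last exact: ybd.
    by apply: le_trans (RK _) _; rewrite ler_wpM2l// lsup.
  apply: le_trans (ler_wpM2l g0 h1) _.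
  set N := 1 + `|z0| + Cnorm T l + L1norm T gl.
  have N0 : 0 <= N by rewrite !addr_ge0.
  apply: (@le_trans _ _ (C1 * N)); last first.
    by rewrite ler_wpM2r// -addrA lerDl addr_ge0.
  rewrite /C1 -[leRHS]mulrA; apply: ler_wpM2l => //.
  have b1 : al * 1 <= al * N by rewrite ler_wpM2l// /N; have := normr_ge0 z0; lra.
  have b2 : kL * kP * M * `|z0| <= kL * kP * M * N by rewrite ler_wpM2l// /N; lra.
  have b3 : KR * Cnorm T l <= KR * N.
    by rewrite ler_wpM2l// /N; have := normr_ge0 z0; lra.
  have b4 : kL * kP * KR * Cnorm T l <= kL * kP * KR * N.
    by rewrite ler_wpM2l// /N; have := normr_ge0 z0; lra.
  have b5 : kL * kP * KR * L1norm T gl <= kL * kP * KR * N.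
    by rewrite ler_wpM2l// /N; have := normr_ge0 z0; lra.
  rewrite mulr1 in b1.
  rewrite (_ : (al + kL * kP * M + KR + 2 * (kL * kP * KR)) * N =
    al * N + kL * kP * M * N + KR * N + 2 * (kL * kP * KR * N)); last by ring.
  move: b1 b2 b3 b4 b5.
  move: (al * N) (kL * kP * M * N) (KR * N) (kL * kP * KR * N) => v1 v2 v3 v4.
  move: (KR * Cnorm T l) (kL * kP * M * `|z0|) (kL * kP * KR * Cnorm T l) => v5 v6 v7.
  move: (kL * kP * KR * L1norm T gl) => v8 *; lra.
move=> g1 zg1.
set S := sup _.
have AS t : 0 <= t <= T -> `|min_section A (y t)| <= S.
  move=> tT; apply: ub_le_sup; last by exists t.
  (* The supremum of the minimal section is genuine: [y] stays in a ball and in the domain, where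
     the section is bounded. *)
  have [K hK] := hA0 (al + kL * kP * KR * Cnorm T l + kL * kP * M * `|z0|
    + kL * kP * KR * L1norm T gl).
  exists K => _ [s + <-]; rewrite /= in_itv /= => sT; apply: hK; first exact: zdom.
  exact: ybd.
have S0 : 0 <= S by apply: le_trans (AS 0 T00).
have [g1' [_ gg1 ng1 wz]] := H1_weak hip (ltW T0) zg1.
(* The stability inequality restarted at [y s] makes this an integrable bound for the increments of
   [z], hence for the derivative. *)
pose G x := c1 * mf x + c2 * S.
have G0 x : 0 <= G x by apply: addr_ge0; apply: mulr_ge0.
have iG : itg `[0, T] G by apply: itgD => //; [exact: itgZ | exact: itg_cst].
have zincr s t : 0 <= s -> s <= t -> t <= T -> `|z t - z s| <= intg `[s, t] G.
  move=> s0 st tT; have sT : 0 <= s <= T by rewrite s0 (le_trans st).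
  have imst : itg `[s, t] mf by exact: itgS_itvcc s0 tT imf.
  rewrite RintegralD; [|by []|exact: itgZ|exact: itg_cst].
  rewrite RintegralZl// intg_cst//.
  set L := intg _ mf.
  have Ay := msec _ (zdom s sT).
  have h1 := zstab s t _ _ s0 st tT Ay; rewrite -/L in h1.
  have p0 : p (f s - Q (z s) - (f s - Q (z s))) <= 0.
    by apply: le_trans (p_le _) _; rewrite subrr normr0 mulr0.
  have ts : 0 <= t - s by rewrite subr_ge0.
  have h2 : p (Q (min_section A (y s))) <= kP * (M * S).
    apply: le_trans (p_le _) _; rewrite ler_wpM2l//; apply: le_trans (QM _) _.
    by rewrite ler_wpM2l// AS.
  have h3 : p (y t - y s) <= kP * L + (t - s) * (kP * (M * S)).
    apply: le_trans h1 _; rewrite -[leRHS]add0r -addrA; apply: lerD => //.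
    by rewrite lerD2l ler_wpM2l.
  have h4 := le_trans (le_p _) (ler_wpM2l kL0 h3).
  have h5 : `|f t - f s| <= L by exact: (weak_H1_incr_le hip wf).
  apply: le_trans (PQn _) _.
  have -> : Q (z t - z s) = (f t - f s) - (y t - y s).
    rewrite (blinB hQ) /y; move: (f t) (f s) (Q (z t)) (Q (z s)) => a b q q'.
    have -> : a - q - (b - q') = a - b - (q - q').
      by rewrite !opprB ![q' - _]addrC addrACA.
    by rewrite subKr.
  have h6 := le_trans (ler_normB _ _) (lerD h5 h4).
  apply: le_trans (ler_wpM2l g0 h6) _.
  by rewrite /c1 /c2 le_eqVlt; apply/orP; left; apply/eqP; ring.
have gG := weak_H1_deriv_bound hip T0 hsep wz iG G0 zincr.
have iG2 : itg `[0, T] (fun x => 2 * c1 ^+ 2 * KR ^+ 2 * `|gl' x| ^+ 2 + 2 * c2 ^+ 2 * S ^+ 2).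
  by apply: itgD => //; [exact: itgZ | exact: itg_cst].
have int_le : intg `[0, T] (fun x => `|g1' x| ^+ 2) <=
    2 * c1 ^+ 2 * KR ^+ 2 * intg `[0, T] (fun x => `|gl' x| ^+ 2) + 2 * c2 ^+ 2 * S ^+ 2 * T.
  apply: (@le_trans _ _ (intg `[0, T]
      (fun x => 2 * c1 ^+ 2 * KR ^+ 2 * `|gl' x| ^+ 2 + 2 * c2 ^+ 2 * S ^+ 2))).
    apply: le_intg_ae => //; first exact: weak_H1_itg2 wz.
    apply: ae_mono gG => x hx Dx.
    apply: (@le_trans _ _ (G x ^+ 2)); first by rewrite ler_pXn2r ?nnegrE ?hx.
    rewrite -subr_ge0 (_ : _ - _ = (c1 * mf x - c2 * S) ^+ 2) ?sqr_ge0//.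
    by rewrite /G /mf; ring.
  rewrite RintegralD; [|by []|exact: itgZ|exact: itg_cst].
  by rewrite RintegralZl// intg_cst ?(ltW T0)// subr0.
rewrite ng1 n2; set I2 := intg _ (fun x => `|gl' x| ^+ 2) in int_le *.
have I20 : 0 <= I2 by apply: intg_ge0 => x _; exact: sqr_ge0.
have sI : 0 <= Num.sqrt I2 by exact: sqrtr_ge0.
have NS0 : 0 <= Num.sqrt I2 + S by rewrite addr_ge0.
apply: (@le_trans _ _ (C2 * (Num.sqrt I2 + S))); last first.
  by rewrite ler_wpM2r// addrAC lerDr addr_ge0.
rewrite -[leRHS]ger0_norm ?mulr_ge0// -sqrtr_sqr ler_wsqrtr//.
apply: le_trans int_le _.
rewrite -[X in _ * X + _](sqr_sqrtr I20).
move: (Num.sqrt I2) sI => N N0.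
have T0' := ltW T0.
set u := c1 * KR * N; set v := c2 * S.
have u0 : 0 <= u by apply: mulr_ge0 => //; exact: mulr_ge0.
have v0 : 0 <= v by exact: mulr_ge0.
have e1 : 2 * c1 ^+ 2 * KR ^+ 2 * N ^+ 2 + 2 * c2 ^+ 2 * S ^+ 2 * T = 2 * u ^+ 2 + 2 * v ^+ 2 * T.
  by rewrite /u /v; ring.
(* The factor [1 + T] replaces [sqrt T], so that the comparison of squares below is polynomial. *)
have e2 : 2 * u + 2 * (1 + T) * v <= C2 * (N + S).
  rewrite -subr_ge0 (_ : _ - _ = 2 * (c1 * KR) * S + 2 * (c2 * (1 + T)) * N).
    by apply: addr_ge0; apply: mulr_ge0 => //; apply: mulr_ge0 => //; exact: mulr_ge0.
  by rewrite /C2 /u /v; ring.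
rewrite e1; apply: (@le_trans _ _ ((2 * u + 2 * (1 + T) * v) ^+ 2)); last first.
  have u1 : 0 <= 2 * u + 2 * (1 + T) * v.
    by apply: addr_ge0; apply: mulr_ge0 => //; exact: mulr_ge0.
  by rewrite [leLHS]expr2 [leRHS]expr2; apply: ler_pM.
rewrite -subr_ge0 (_ : _ - _ = 2 * u ^+ 2 + 8 * (u * (1 + T) * v) +
  v ^+ 2 * (4 + 6 * T + 4 * T ^+ 2)); last by ring.
have T2 : 0 <= 4 + 6 * T + 4 * T ^+ 2 by have := sqr_ge0 T; lra.
have uv : 0 <= u * (1 + T) * v by apply: mulr_ge0 => //; exact: mulr_ge0.
apply: addr_ge0; last by apply: mulr_ge0 => //; exact: sqr_ge0.
by apply: addr_ge0; apply: mulr_ge0 => //; exact: sqr_ge0.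
Qed.

End StateEquation.

Unset Implicit Arguments.

Theorem mainTheorem1
  (R : realType) (T : R) (HT : 0 < T)
  (X Xc Y Z W H : completeNormedModType R)
  (eXc : Xc -> X) (heXc : compact_embedding eXc)
  (eYZ : Y -> Z) (eZH : Z -> H) (eHW : H -> W)
  (heYZ : cont_embedding eYZ) (heZH : cont_embedding eZH) (heHW : cont_embedding eHW)
  (ip : H -> H -> R) (hip : is_inner_product ip) (hsep : separable H)
  (A : H -> set H) (hA : maximal_monotone ip A) (hDA : closed (dom A))
  (hA0 : bounded_on_bounded A (min_section A))
  (Rop : X -> Y) (hR : bounded_linear Rop)
  (QW : W -> W) (hQW : bounded_linear QW)
  (QH : H -> H) (QZ : Z -> Z) (QY : Y -> Y)
  (hQH : bounded_linear QH) (hQZ : bounded_linear QZ) (hQY : bounded_linear QY)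
  (hQHr : forall h, eHW (QH h) = QW (eHW h))
  (hQZr : forall z, eHW (eZH (QZ z)) = QW (eHW (eZH z)))
  (hQYr : forall y, eHW (eZH (eYZ (QY y))) = QW (eHW (eZH (eYZ y))))
  (hQsa : forall h k, ip (QH h) k = ip h (QH k))
  (gammaQ : R) (hgamma : 0 < gammaQ)
  (hQcoer : forall h, gammaQ * `|h| ^+ 2 <= ip (QH h) h) :
  let RH := fun x : X => eZH (eYZ (Rop x)) in
  let is_solution := fun (z0 : H) (l : R -> X) (z : R -> H) =>
    exists g : R -> H, [/\ H1_deriv T z g, z 0 = z0 &
      {ae (@lebesgue_measure R), forall t, `[0%R, T]%classic t ->
          A (RH (l t) - QH (z t)) (g t)}] in
  exists C : R, 0 < C /\
  forall (z0 : H) (l : R -> X) (gl : R -> X),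
    H1_deriv T l gl -> dom A (RH (l 0) - QH z0) ->
    exists z : R -> H,
      [/\ is_solution z0 l z,
          (forall z' : R -> H, is_solution z0 l z' ->
              forall t, 0 <= t <= T -> z' t = z t),
          Cnorm T z <= C * (1 + `|z0| + Cnorm T l + L1norm T gl) &
          forall g : R -> H, H1_deriv T z g ->
            L2norm T g <=
              C * (L2norm T gl +
                   sup [set `|min_section A (RH (l tau) - QH (z tau))|
                         | tau in `[0%R, T]%classic])].
Proof.
move=> RH is_solution.
have hRH : bounded_linear RH.
  exact: bounded_linear_comp (bounded_linear_comp hR heYZ.1) heZH.1.
have [C [C0 hC]] := state_equation HT hip hsep hA hDA hA0 hRH hQH hQsa hgamma hQcoer.
exists C; split => // z0 l gl hl hdom.
have [z [hz hCz hg]] := hC z0 l gl hl hdom.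
exists z; split => // z' hz'.
exact: (state_solution_unique HT hip hA hQH hQsa hgamma hQcoer hz hz').
Qed.
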